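(* Let $\lambda=(\lambda_1,\dots,\lambda_k)$ be a composition of $n$ and $S_\lambda=S_{\lambda_1}\times\cdots\times S_{\lambda_k}\subseteq S_n$ the corresponding Young subgroup. Then the quotient complex $\Delta(\Pi_n)/S_\lambda$ is partitionable.
   Context: $\Pi_n$ is the lattice of set partitions of $\{1,\dots,n\}$ ordered by refinement, with minimum $\hat 0$ and maximum $\hat 1$. Its order complex $\Delta(\Pi_n)$ has a face for each chain $\hat 0<u_0<\dots<u_m<\hat 1$ of elements of the proper part. $S_n$ acts on $\Pi_n$ by permuting $\{1,\dots,n\}$, and hence on faces of $\Delta(\Pi_n)$; for a subgroup $G$, the quotient complex $\Delta(\Pi_n)/G$ is the boolean cell complex whose cells are the $G$-orbits of faces (chains), ordered by: an orbit $O'$ lies below an orbit $O$ if some chain in $O'$ is a subchain of some chain in $O$; its facets are the orbits of maximal chains, and the faces below a facet form a boolean lattice. Such a complex is partitionable if its set of faces can be written as a disjoint union $[G_1,F_1]\cup\cdots\cup[G_m,F_m]$ where $F_1,\dots,F_m$ are all the facets, each $G_t$ is a face of $F_t$, and $[G_t,F_t]$ denotes the set of faces $G$ with $G_t\le G\le F_t$. *)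

(* Defs.v *)
From mathcomp Require Import all_boot all_order all_fingroup.

Set Implicit Arguments.
Unset Strict Implicit.
Unset Printing Implicit Defensive.

(* A set partition of {1,...,n} is a P : {set {set 'I_n}} such that
   partition P [set: 'I_n]. *)
Section PartitionLattice.
Variable n : nat.
Implicit Types P Q : {set {set 'I_n}}.

Definition refines P Q := [forall A in P, exists B in Q, A \subset B].

Definition srefines P Q := (P != Q) && refines P Q.

Definition Pi_bot : {set {set 'I_n}} := [set [set i] | i : 'I_n].

(* For n = 0 this is not a partition; the only partition of the empty set is
   then Pi_bot = set0, which Pi_proper excludes. *)
Definition Pi_top : {set {set 'I_n}} := [set [set: 'I_n]].

Definition Pi_proper : {set {set {set 'I_n}}} :=
  [set P | [&& partition P [set: 'I_n], srefines Pi_bot P & srefines P Pi_top]].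

(* A chain is given by its set of elements; the empty chain is a face. *)
Definition order_complex_Pi : {set {set {set {set 'I_n}}}} :=
  [set C : {set {set {set 'I_n}}} | (C \subset Pi_proper) &&
     [forall P in C, forall Q in C, refines P Q || refines Q P]].

End PartitionLattice.

Record cell_complex (T : finType) := CellComplex {
  faces : {set T};
  facets : {set T};
  face_le : rel T
}.

(* The union of the intervals [Gf F, F] over the facets F is disjoint and
   covers all faces; Gf is only relevant on facets. *)
Definition partitionable (T : finType) (K : cell_complex T) : Prop :=
  let itv G F := [set H in faces K | face_le K G H && face_le K H F] in
  exists Gf : T -> T,
    [/\ {in facets K, forall F, Gf F \in faces K /\ face_le K (Gf F) F},
        \bigcup_(F in facets K) itv (Gf F) F = faces K
      & {in facets K &, forall F1 F2, F1 != F2 ->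
           [disjoint itv (Gf F1) F1 & itv (Gf F2) F2]}].

(* Quotient of a simplicial complex D, given by its set of faces, by a group
   G acting on the vertices; the cells are the G-orbits of faces. *)
Definition quotient_complex (aT : finGroupType) (V : finType)
    (to : {action aT &-> V}) (D : {set {set V}}) (G : {group aT}) :
    cell_complex {set {set V}} :=
  {| faces := [set orbit to^* G C | C in D];
     facets := [set orbit to^* G C | C in [set C | maxset [in D] C]];
     face_le := fun O' O : {set {set V}} =>
       [exists C' in O', exists C in O, C' \subset C] |}.

Definition is_composition (n : nat) (lam : seq nat) : bool :=
  all (leq 1) lam && (sumn lam == n).

Section Young.
Variables (n : nat) (lam : seq nat).

(* The j-th block of lam_j consecutive elements, j counted from 0. *)
Definition young_block (j : nat) : {set 'I_n} :=
  [set i : 'I_n | sumn (take j lam) <= i < sumn (take j.+1 lam)].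

(* Sym A is the group of permutations fixing every point outside A. *)
Definition young : {group 'S_n} :=
  (\prod_(j < size lam) [group of Sym (young_block j)])%G.

End Young.

(* 'P is the natural action of 'S_n on 'I_n; each ^* lifts it to sets, here
   first to blocks, then to set partitions. *)
Definition Pi_action (n : nat) : {action 'S_n &-> {set {set 'I_n}}} :=
  ('P^*^*)%act.

(* Main.v *)
(* A chain [C] of set partitions amounts to the ultrametric counting the members
   of [C] that join two points; a subchain composes it with a monotone map of
   levels.  An ultrametric on coloured points is encoded, completely up to
   isomorphism, by a tag and a word [b] of length [n - 1] listing its levels,
   so that
   - a monotone [phi] that keeps the descents of [b] strict leaves the tag alone
     and turns [b] into [phi b];
   - any standardisation of [b] is the word of an ultrametric with the same tag,
     from which the original one is obtained by a monotone relabelling.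
   The words of facets are permutations.  A facet [F] covers the chains between
   the members of [F] whose rank [j] precedes [j - 1] in the word of [F], and [F]
   itself.  A chain lies in the interval of the facet whose word is the
   standardisation of its own, and in no other since the code is complete.

   The code is defined recursively.  Let [v] be the largest level such that the
   levels up to [v] split off blocks one at a time, by nondecreasing size (a
   comb).  Each block gives a row, made of the level at which it splits off
   followed by its own word; the rows are sorted and their cells are read in the
   order of labels that see the cyclic continuation of the row.  The tag records
   the shape of the rows and the reading order. *)

Require Import Defs.
From mathcomp Require Import all_boot all_order all_fingroup.
From mathcomp Require Import zify.

Set Implicit Arguments.
Unset Strict Implicit.
Unset Printing Implicit Defensive.

(** * Words of sorted lists of rows *)

(** The comb depth has to follow the levels both when levels are merged and when ties are broken,
    and this dictates the details of the code. Splitting blocks off one at a time is too weak a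
    condition: let parts X and Y separate at level 0, X break at level 1 and Y at level 2. The comb
    stops at level 1, but once 0 and 1 are merged it runs on to the last level. The size condition
    excludes this: the comb up to level 1 needs Y to be at most as large as each part of X, while
    the merged comb needs each part of X to be at most as large as each part of Y. The reading order
    serves the same purpose. Exit levels are read last, so that an inner level always forms a
    descent with them and a compatible map cannot draw it into the comb. Smaller blocks are read
    first, so that among equal inner levels those of smaller blocks get smaller values, and the comb
    does not grow when ties are broken. For this last point size bounds must also survive inside a
    block, one reason why the tag records the shape of the rows. *)

Section Lexicographic.

Fixpoint lexlt (s t : seq nat) : bool :=
  match s, t with
  | x :: s', y :: t' => (x < y) || (x == y) && lexlt s' t'
  | [::], _ :: _ => true
  | _, [::] => false
  end.

Definition lexle (s t : seq nat) := (s == t) || lexlt s t.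

Lemma lexlt_irr s : lexlt s s = false.
Proof. by elim: s => //= x s ->; rewrite ltnn eqxx. Qed.

Lemma lexlt_trans : transitive lexlt.
Proof.
move=> t s u; elim: s t u => [|x s IH] [|y t] [|z u] //=.
case/orP=> [xy|/andP[/eqP-> st]]; case/orP=> [yz|/andP[/eqP<- tu]].
- by rewrite (ltn_trans xy yz).
- by rewrite xy.
- by rewrite yz.
- by rewrite eqxx (IH _ _ st tu) orbT.
Qed.

Lemma lexlt_trichotomy s t : [|| s == t, lexlt s t | lexlt t s].
Proof.
elim: s t => [|x s IH] [|y t] //=.
rewrite eqseq_cons; case: (ltngtP x y) => //= _; exact: IH.
Qed.

Lemma lexlt_asym s t : lexlt s t -> lexlt t s -> False.
Proof. by move=> st ts; have := lexlt_trans st ts; rewrite lexlt_irr. Qed.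

Lemma lexleNgt s t : lexle s t = ~~ lexlt t s.
Proof.
rewrite /lexle; apply/idP/negP.
  by case/orP=> [/eqP-> | st ts]; [rewrite lexlt_irr | exact: lexlt_asym ts].
by have := lexlt_trichotomy s t; case: (s == t) => //=; case/orP.
Qed.

Lemma lexle_refl s : lexle s s. Proof. by rewrite /lexle eqxx. Qed.

Lemma lexle_total : total lexle.
Proof.
move=> s t; rewrite /lexle eq_sym.
by have := lexlt_trichotomy t s; case: (t == s) => //=; rewrite orbC.
Qed.

Lemma lexle_trans : transitive lexle.
Proof.
move=> t s u; rewrite /lexle; case/orP=> [/eqP-> // | st].
by case/orP=> [/eqP<- | tu]; rewrite ?st ?(lexlt_trans st tu) orbT.
Qed.

Lemma lexle_anti : antisymmetric lexle.
Proof.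
move=> s t /andP[]; rewrite /lexle; case/orP=> [/eqP// | st].
by case/orP=> [/eqP// | ts]; case: (lexlt_asym st ts).
Qed.

Lemma lexlt_neq s t : lexlt s t = (s != t) && lexle s t.
Proof.
by rewrite /lexle; case: eqP => [->|] //=; rewrite lexlt_irr.
Qed.

Lemma lexlt_cat s t u v : size s = size t ->
  lexlt (s ++ u) (t ++ v) = lexlt s t || (s == t) && lexlt u v.
Proof.
elim: s t => [|x s IH] [|y t] //= [/IH->]; rewrite eqseq_cons.
by case: (ltngtP x y).
Qed.

Lemma lexlt_cat2l s u v : lexlt (s ++ u) (s ++ v) = lexlt u v.
Proof. by rewrite lexlt_cat // lexlt_irr eqxx. Qed.

Lemma lexle_cat2l s u v : lexle (s ++ u) (s ++ v) = lexle u v.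
Proof. by rewrite /lexle lexlt_cat2l eqseq_cat // eqxx. Qed.

Lemma lexlt_cons x s y t :
  lexlt (x :: s) (y :: t) = (x < y) || (x == y) && lexlt s t.
Proof. by []. Qed.

Lemma lexle_cons x s y t :
  lexle (x :: s) (y :: t) = (x < y) || (x == y) && lexle s t.
Proof. by rewrite /lexle eqseq_cons /=; case: (ltngtP x y). Qed.

End Lexicographic.

Arguments lexlt : simpl never.

(* The tag of a block, then its exit level followed by its word. *)
Definition row := (nat * seq nat)%type.
Definition row0 : row := (0, [::]).

(** Size comes right after the exit level because a comb already orders blocks with different exit
    levels by size: rows stay sorted when such levels merge. It also tells an empty row from the row
    [[:: 0]], which makes the key injective. *)
Definition row_key (r : row) := [:: nth 0 r.2 0; size r.2; r.1] ++ drop 1 r.2.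
Definition row_le (r r' : row) := lexle (row_key r) (row_key r').

Section Rows.
Variable R : seq row.

Definition rtag i := (nth row0 R i).1.
Definition rlev i := (nth row0 R i).2.
Definition rsz i := size (rlev i).
Definition rtop i := nth 0 (rlev i) 0.

(* The last two rows have the same first entry, for two blocks that split from
   each other: the cell of the last one is skipped. *)
Definition cells : seq (nat * nat) :=
  [seq p <- [seq (i, c) | i <- iota 0 (size R), c <- iota 0 (rsz i)]
     | p != ((size R).-1, 0)].

(* Cells of a column are compared by reading their rows cyclically to the right,
   so merging two levels leaves the decision to the next cell, whose label
   already agrees with it. *)
Definition label (p : nat * nat) : seq nat :=
  [:: nat_of_bool (p.2 == 0); rsz p.1; rtag p.1; p.2]
    ++ (drop p.2.+1 (rlev p.1) ++ rlev p.1) ++ [:: p.1].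

Definition entry (p : nat * nat) := nth 0 (rlev p.1) p.2.

Definition label_le p q := lexle (label p) (label q).

Definition cell_order := sort label_le cells.

Definition word := [seq entry p | p <- cell_order].

Definition row_shape := [seq (r.1, size r.2) | r <- R].

(** What remains of a comb once its blocks are reduced to rows. [comb_last] reflects that at least
    two blocks exit at the last level of the comb, [comb_above] that inner levels lie beyond that
    level. *)
Record comb_rows : Prop := CombRows {
  comb_size : 1 < size R;
  comb_ne : forall i, i < size R -> 0 < rsz i;
  comb_sorted : sorted row_le R;
  comb_last : rtop (size R).-2 = rtop (size R).-1;
  comb_mono : forall i j, i < size R -> j < size R ->
    rtop i < rtop j -> rsz i <= rsz j;
  comb_above : forall i j c, i < size R -> j < size R -> 0 < c < rsz j ->
    rtop i < entry (j, c) }.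

Lemma row_le_trans : transitive row_le.
Proof. by move=> r1 r2 r3; apply: lexle_trans. Qed.

Lemma row_le_total : total row_le.
Proof. by move=> r1 r2; apply: lexle_total. Qed.

Lemma row_key_inj : injective row_key.
Proof.
case=> F [|a x] [G [|b y]]; rewrite /row_key /= ?drop0 => -[] //.
  by move=> ->.
by move=> -> _ -> ->.
Qed.

Lemma row_le_anti : antisymmetric row_le.
Proof. by move=> r1 r2 /lexle_anti /row_key_inj. Qed.

Lemma rtop_sorted i j : sorted row_le R -> i <= j < size R -> rtop i <= rtop j.
Proof.
move=> srt /andP[ij jR]; have rf : reflexive row_le by move=> r; apply: lexle_refl.
have := sorted_leq_nth row_le_trans rf row0 srt; rewrite /row_le /row_key.
move=> /(_ i j); rewrite !inE jR (leq_ltn_trans ij jR) ij => /(_ isT isT isT).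
by rewrite !cat_cons lexle_cons /rtop /rlev; case: ltngtP.
Qed.

Lemma mem_cells p : (p \in cells) =
  [&& p.1 < size R, p.2 < rsz p.1 & p != ((size R).-1, 0)].
Proof.
case: p => i c; rewrite mem_filter andbC.
have -> : ((i, c) \in [seq (i, c) | i <- iota 0 (size R), c <- iota 0 (rsz i)])
          = (i < size R) && (c < rsz i).
  apply/allpairsPdep/andP => [[j [d [jR dR [-> ->]]]]|[iR cR]].
    by move: jR dR; rewrite !mem_iota !add0n.
  by exists i, c; rewrite !mem_iota.
by rewrite andbA.
Qed.

Lemma uniq_cells : uniq cells.
Proof.
rewrite filter_uniq // allpairs_uniq_dep ?iota_uniq //.
- by move=> i _; rewrite iota_uniq.
- by move=> [i c] [j d] _ _ [-> ->].
Qed.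

Lemma mem_cell_order p : (p \in cell_order) = (p \in cells).
Proof. exact: mem_sort. Qed.

Lemma uniq_cell_order : uniq cell_order.
Proof. by rewrite sort_uniq uniq_cells. Qed.

Lemma size_word : size word = size cell_order.
Proof. by rewrite size_map. Qed.

Lemma label_inj : injective label.
Proof.
case=> i c [j d] /= [_ _ _ <-].
rewrite !cats1 => /(congr1 (last 0)); by rewrite !last_rcons => ->.
Qed.

Lemma label_lexleP p q : p != q -> lexlt (label p) (label q) = label_le p q.
Proof.
by move=> pq; rewrite /label_le lexlt_neq (inj_eq label_inj) pq.
Qed.

Lemma index_cell_order p q : p \in cells -> q \in cells ->
  (index p cell_order < index q cell_order) = lexlt (label p) (label q).
Proof.
move=> pC qC.
have srt : sorted label_le cell_order.
  by apply: sort_sorted => ? ?; apply: lexle_total.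
have tr : transitive label_le by move=> ? ? ?; apply: lexle_trans.
have rf : reflexive label_le by move=> ?; apply: lexle_refl.
have hle x y : x \in cells -> y \in cells ->
    index x cell_order <= index y cell_order -> label_le x y.
  move=> xC yC; move/(sorted_leq_nth tr rf (0,0) srt) => H.
  have := H; rewrite !inE !index_mem !mem_cell_order => /(_ xC yC).
  by rewrite !nth_index ?mem_cell_order.
case: (eqVneq p q) => [->|npq]; first by rewrite ltnn lexlt_irr.
rewrite label_lexleP //; apply/idP/idP => [/ltnW|]; first exact: hle.
rewrite ltnNge => pq; apply/negP => /(hle _ _ qC pC) qp.
by case/eqP: npq; apply/label_inj/lexle_anti/andP.
Qed.

Lemma nth_word p : p \in cells -> nth 0 word (index p cell_order) = entry p.
Proof.
move=> pC; rewrite (nth_map (0, 0)) ?index_mem ?mem_cell_order //.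
by rewrite nth_index ?mem_cell_order.
Qed.

Lemma index_cell_size p : p \in cells -> index p cell_order < size word.
Proof. by rewrite size_word index_mem mem_cell_order. Qed.

End Rows.

Arguments label : simpl never.
Arguments entry : simpl never.

(* A relabelling of levels compatible with a word [b] may merge two levels
   only where doing so does not change the standardisation of [b]. *)
Definition compatible (phi : nat -> nat) (b : seq nat) :=
  forall p q, p < q < size b -> nth 0 b q < nth 0 b p ->
    phi (nth 0 b q) < phi (nth 0 b p).

Definition same_pattern (y b : seq nat) :=
  forall p q, p < q < size b -> (nth 0 y p < nth 0 y q) = (nth 0 b p <= nth 0 b q).

Definition relabel_rows (phi : nat -> nat) (R : seq row) : seq row :=
  [seq (r.1, map phi r.2) | r <- R].

Lemma lexle_cat s t u v : size s = size t ->
  lexle (s ++ u) (t ++ v) = lexlt s t || (s == t) && lexle u v.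
Proof.
move=> st; rewrite {1}/lexle eqseq_cat // lexlt_cat // /lexle.
by case: eqP; case: eqP; case: (lexlt s t).
Qed.

(** * Labels of the rows of a comb and the skipped cell *)

Section CombRows.
Variable R : seq row.
Hypothesis RP : comb_rows R.

Notation "'lst'" := (size R).-1.

Definition cyc k i := drop k (rlev R i) ++ rlev R i.

Lemma label_cons p : label R p = [:: nat_of_bool (p.2 == 0); rsz R p.1; rtag R p.1; p.2]
    ++ cyc p.2.+1 p.1 ++ [:: p.1].
Proof. by []. Qed.

Lemma rlev_cons i : i < size R -> rlev R i = rtop R i :: drop 1 (rlev R i).
Proof.
by move=> iR; rewrite -[LHS]drop0 (drop_nth 0) // -/(rsz R i) (comb_ne RP).
Qed.

Lemma row_le_nth i j : i <= j < size R -> row_le (nth row0 R i) (nth row0 R j).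
Proof.
case/andP=> ij jR; have rf : reflexive row_le by move=> r; apply: lexle_refl.
apply: (sorted_leq_nth (@row_le_trans) rf row0 (comb_sorted RP)); rewrite ?inE //.
exact: leq_ltn_trans ij jR.
Qed.

Lemma row_leE i j : row_le (nth row0 R i) (nth row0 R j) =
  (rtop R i < rtop R j) || (rtop R i == rtop R j) &&
  ((rsz R i < rsz R j) || (rsz R i == rsz R j) &&
   ((rtag R i < rtag R j) || (rtag R i == rtag R j) &&
     lexle (drop 1 (rlev R i)) (drop 1 (rlev R j)))).
Proof. by rewrite /row_le /row_key !cat_cons !lexle_cons. Qed.

Lemma rtop_leq i j : i <= j < size R -> rtop R i <= rtop R j.
Proof. exact: rtop_sorted (comb_sorted RP). Qed.

Lemma size_cyc i j k : rsz R i = rsz R j -> size (cyc k i) = size (cyc k j).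
Proof. by rewrite /rsz => e; rewrite !size_cat !size_drop e. Qed.

Lemma label_same_column i j c : rsz R i = rsz R j -> rtag R i = rtag R j ->
  lexlt (label R (i, c)) (label R (j, c)) = lexlt (cyc c.+1 i ++ [:: i]) (cyc c.+1 j ++ [:: j]).
Proof. by move=> s F; rewrite !label_cons /= !lexlt_cons s F !ltnn !eqxx. Qed.

(** Rows with one exit level are sorted by size, tag and inner word, which is also what the labels
    of their exit cells compare; a complete tie falls to the row index. *)
Lemma label_top i j : i < j < size R -> rtop R i = rtop R j ->
  lexlt (label R (i, 0)) (label R (j, 0)).
Proof.
case/andP=> ij jR tij; have iR := ltn_trans ij jR.
have := @row_le_nth i j; rewrite ltnW // jR => /(_ isT); rewrite row_leE tij ltnn eqxx /=.
rewrite !label_cons /= !lexlt_cons /=.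
case: ltngtP => //= sij.
case: ltngtP => //= Fij.
rewrite lexlt_cat; last exact: (size_cyc 1 sij).
rewrite /cyc lexlt_cat ?size_drop -?/(rsz R _) ?sij // eqseq_cat ?size_drop -?/(rsz R _) ?sij //.
rewrite /lexle; case: eqP => [e _|_] /=; last by move->.
have -> : rlev R i = rlev R j by rewrite (rlev_cons iR) (rlev_cons jR) tij e.
by rewrite lexlt_irr eqxx lexlt_cons ij orbT.
Qed.

Lemma lt_lst : lst < size R. Proof. by case: RP => sz *; lia. Qed.
Lemma lt_twin : (size R).-2 < lst. Proof. by case: RP => sz *; lia. Qed.

Lemma twin_cell : ((size R).-2, 0) \in cells R.
Proof.
have l1 := lt_lst; have l2 := lt_twin; rewrite mem_cells /=.
rewrite (ltn_trans l2 l1) (comb_ne RP (ltn_trans l2 l1)) /=.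
by apply/eqP=> -[]; lia.
Qed.

Lemma label_twin : lexlt (label R ((size R).-2, 0)) (label R (lst, 0)).
Proof. by rewrite label_top ?lt_twin ?lt_lst //; case: RP. Qed.

(** Unlike [cells], this includes the skipped cell of the last row. *)
Definition full_cell p := (p.1 < size R) && (p.2 < rsz R p.1).

Lemma entry_top_le i : i < size R -> entry R (i, 0) <= entry R (lst, 0).
Proof. move=> iR; apply: rtop_leq; rewrite lt_lst andbT. by rewrite -ltnS prednK // (leq_ltn_trans _ iR). Qed.

(** The skipped cell has the level of its twin, the exit cell just above it, and a larger label. As
    [p] it is replaced by the twin by transitivity. As [q] it has the largest exit level, so a [p]
    with a larger entry is an inner cell and precedes the twin too. *)
Lemma compatible_full phi : compatible phi (word R) ->
  forall p q, full_cell p -> full_cell q -> lexlt (label R p) (label R q) ->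
  entry R q < entry R p -> phi (entry R q) < phi (entry R p).
Proof.
move=> cp.
have real p q : p \in cells R -> q \in cells R -> lexlt (label R p) (label R q) ->
    entry R q < entry R p -> phi (entry R q) < phi (entry R p).
  move=> pC qC; rewrite -index_cell_order // => lt e.
  have := cp (index p (cell_order R)) (index q (cell_order R)).
  by rewrite lt index_cell_size // !nth_word //; apply.
have fullE p : full_cell p -> p = (lst, 0) \/ p \in cells R.
  rewrite mem_cells andbA /full_cell => ->; by case: eqP; [left | right].
have te : entry R ((size R).-2, 0) = entry R (lst, 0) by case: RP.
move=> p q pC qC; case: (fullE _ pC) (fullE _ qC) => [pE|{}pC'] [qE|{}qC'].
- by rewrite pE qE ltnn.
- move=> l; rewrite pE -te; apply: real => //; first exact: twin_cell.
  by rewrite pE in l; apply: lexlt_trans label_twin l.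
- move=> l; rewrite qE -te => e; apply: real => //; first exact: twin_cell.
  case: p pC pC' l e => i [|c] pC pC' l e.
    have := @entry_top_le i; case/andP: pC => /= -> _ => /(_ isT).
    by rewrite -te leqNgt e.
  by rewrite !label_cons /= lexlt_cons.
- exact: real.
Qed.

End CombRows.

(** * Merging levels of a comb *)

Section Relabel.
Variables (R : seq row) (phi : nat -> nat).
Hypotheses (RP : comb_rows R) (phiM : {homo phi : x y / x <= y}).
Hypothesis cp : compatible phi (word R).

Let R' := relabel_rows phi R.

Lemma size_relabel : size R' = size R. Proof. exact: size_map. Qed.

Lemma rlev_relabel i : rlev R' i = map phi (rlev R i).
Proof.
rewrite /rlev /R' /relabel_rows; case: (ltnP i (size R)) => iR.
  by rewrite (nth_map row0).
by rewrite !nth_default ?size_map.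
Qed.

Lemma rtag_relabel i : rtag R' i = rtag R i.
Proof.
rewrite /rtag /R' /relabel_rows; case: (ltnP i (size R)) => iR.
  by rewrite (nth_map row0).
by rewrite !nth_default ?size_map.
Qed.

Lemma rsz_relabel i : rsz R' i = rsz R i.
Proof. by rewrite /rsz rlev_relabel size_map. Qed.

Lemma entry_relabel p : full_cell R p -> entry R' p = phi (entry R p).
Proof. by case/andP=> _ c; rewrite /entry rlev_relabel (nth_map 0). Qed.

Lemma rtop_relabel i : i < size R -> rtop R' i = phi (rtop R i).
Proof. by move=> iR; rewrite /rtop rlev_relabel (nth_map 0) //; exact: comb_ne. Qed.

Lemma cells_relabel : cells R' = cells R.
Proof.
rewrite /cells size_relabel; congr filter; congr flatten.
by apply: eq_map => i; rewrite rsz_relabel.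
Qed.

Lemma cyc_cons S k i : k < rsz S i -> cyc S k i = nth 0 (rlev S i) k :: cyc S k.+1 i.
Proof. by move=> ks; rewrite /cyc (drop_nth 0). Qed.

Lemma cyc_rsz S i : cyc S (rsz S i) i = rlev S i.
Proof. by rewrite /cyc drop_size. Qed.

Lemma cyc_inj S k i j : rsz S i = rsz S j -> cyc S k i = cyc S k j -> rlev S i = rlev S j.
Proof.
rewrite /rsz => s /eqP; rewrite eqseq_cat ?size_drop ?s //.
by case/andP=> _ /eqP.
Qed.

Section TwoRows.
Variables i j : nat.
Hypotheses (iR : i < size R) (jR : j < size R).
Hypotheses (sij : rsz R i = rsz R j) (Fij : rtag R i = rtag R j).

(** In the opposite order the two cells would form a descent of the word, and [phi] keeps descents
    strict. *)
Lemma merged_next k : k < rsz R i ->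
  nth 0 (rlev R i) k < nth 0 (rlev R j) k ->
  phi (nth 0 (rlev R i) k) = phi (nth 0 (rlev R j) k) ->
  lexlt (cyc R k.+1 i) (cyc R k.+1 j).
Proof.
move=> ks lt e.
have nij : (i, k) != (j, k) by apply/eqP=> -[E]; rewrite E ltnn in lt.
have lab : lexlt (label R (i, k)) (label R (j, k)).
  have := lexlt_trichotomy (label R (i, k)) (label R (j, k)).
  rewrite (inj_eq (@label_inj R)) (negPf nij) /=; case/orP=> // l.
  have := @compatible_full R RP phi cp (j, k) (i, k).
  rewrite /full_cell /= iR jR ks -sij ks /entry /= lt e ltnn.
  by move=> /(_ isT isT l isT).
move: lab; rewrite label_same_column // lexlt_cat; last exact: size_cyc.
case/orP=> // /andP[/eqP ce _].
by rewrite (cyc_inj sij ce) ltnn in lt.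
Qed.

(** Each merged cell hands the comparison to its right neighbour. The hypothesis on [Ti] and [Tj]
    takes over where the cyclic reading returns to the start of the row. *)
Lemma relabel_tail Ti Tj k : k <= rsz R i ->
  (lexlt (rlev R i) (rlev R j) -> lexle Ti Tj) ->
  lexlt (cyc R k i) (cyc R k j) ->
  lexle (map phi (drop k (rlev R i)) ++ Ti) (map phi (drop k (rlev R j)) ++ Tj).
Proof.
move=> ks base; move: {2}(rsz R i - k) (erefl (rsz R i - k)) => m.
elim: m k ks => [|m IH] k ks mE.
  have {mE}-> : k = rsz R i by lia.
  rewrite cyc_rsz [X in cyc R X j]sij cyc_rsz.
  by rewrite !drop_oversize -?/(rsz R _) ?sij.
have kl : k < rsz R i by lia.
have kl' : k < rsz R j by rewrite -sij.
rewrite (cyc_cons kl) (cyc_cons kl') /= !(drop_nth 0 kl) !(drop_nth 0 kl') /=.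
rewrite lexlt_cons lexle_cons; case: (ltngtP (nth 0 (rlev R i) k)) => //= [lt _ | e l].
- have := phiM (ltnW lt); rewrite leq_eqVlt => /orP[/eqP e | ->] //.
  by rewrite e eqxx ltnn /= IH //; [lia | exact: merged_next].
- by rewrite e eqxx ltnn /= IH //; lia.
Qed.

End TwoRows.

Lemma rlev_lt_index i j : i < size R -> j < size R -> rsz R i = rsz R j ->
  rtag R i = rtag R j -> lexlt (rlev R i) (rlev R j) -> i < j.
Proof.
move=> iR jR s F; rewrite (rlev_cons RP iR) (rlev_cons RP jR) lexlt_cons => lt.
rewrite ltnNge; apply/negP=> ji.
have := @row_le_nth R RP j i; rewrite ji iR => /(_ isT).
rewrite row_leE s F !ltnn !eqxx /= lexleNgt.
by case: ltngtP lt => //= _ ->.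
Qed.

(** Past the end of the row the whole relabelled rows are compared. Should merging make them equal,
    the row index decides, and it decides the same way because the rows are sorted. *)
Lemma label_relabel p q : p \in cells R -> q \in cells R ->
  lexlt (label R p) (label R q) -> lexlt (label R' p) (label R' q).
Proof.
rewrite !mem_cells; case: p q => [i c] [j d] /= /and3P[iR ci _] /and3P[jR dj _].
rewrite !label_cons /= !lexlt_cons !rsz_relabel !rtag_relabel; case: ltngtP => //= _.
case: ltngtP => //= s; case: ltngtP => //= F; case: ltngtP => //= ?; subst d.
rewrite -/(cyc R c.+1 i) -/(cyc R c.+1 j) /cyc !rlev_relabel -!map_drop.
rewrite -!catA => lt; case: (eqVneq i j) => [ij|nij].
  by move: lt; rewrite ij lexlt_irr.
rewrite lexlt_neq; apply/andP; split.
  apply: contra_neq nij => /(congr1 (last 0)).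
  by rewrite !catA !last_cat.
have ci' : c.+1 <= rsz R i by [].
have sz k : size (cyc R k i) = size (cyc R k j) by exact: size_cyc.
move: lt; rewrite !catA -/(cyc R c.+1 i) -/(cyc R c.+1 j) lexlt_cat //.
case/orP=> [lt|/andP[/eqP /(cyc_inj s) e lt]]; last first.
  by rewrite e lexle_cat2l /lexle lt orbT.
rewrite -!catA; apply: relabel_tail => // l.
have ij := rlev_lt_index iR jR s F l.
have l' : lexle (map phi (rlev R i)) (map phi (rlev R j)).
  have := @relabel_tail i j iR jR s F [::] [::] 0 (leq0n _).
  rewrite !cats0 !drop0; apply; first by rewrite lexle_refl.
  by rewrite /cyc !drop0 lexlt_cat ?l.
rewrite lexle_cat ?size_map // lexle_cons ij /=.
by move: l'; rewrite /lexle orbC andbT.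
Qed.

Lemma cell_order_relabel : cell_order R' = cell_order R.
Proof.
rewrite /cell_order cells_relabel.
have tot S : total (label_le S) by move=> ? ?; apply: lexle_total.
have tr S : transitive (label_le S) by move=> ? ? ?; apply: lexle_trans.
have an S : antisymmetric (label_le S).
  by move=> p q /lexle_anti /label_inj.
apply: (sorted_eq (@tr R') (@an R')); rewrite ?sort_sorted //; last first.
  by rewrite perm_sort perm_sym perm_sort.
apply: (sub_in_sorted (P := mem (cells R)) (e := label_le R)).
- move=> p q pC qC; rewrite /label_le /lexle.
  by case/orP=> [/eqP/label_inj-> | /label_relabel->]; rewrite ?eqxx ?orbT.
- by apply/allP=> p; rewrite mem_sort.
- exact: sort_sorted.
Qed.

Lemma word_relabel : word R' = map phi (word R).
Proof.
rewrite /word cell_order_relabel -map_comp; apply/eq_in_map => p.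
rewrite mem_cell_order mem_cells => /and3P[pR pc _] /=.
by rewrite entry_relabel // /full_cell pR.
Qed.

Lemma shape_relabel : row_shape R' = row_shape R.
Proof. by rewrite /row_shape -map_comp; apply: eq_map => r /=; rewrite size_map. Qed.

(** Only merged exit levels need an argument. [comb_mono] then orders the sizes; for equal sizes the
    labels of the two exit cells, which would otherwise form a descent, order the tags and the inner
    words. *)
Lemma sorted_relabel : sorted row_le R'.
Proof.
apply/(sortedP row0) => i; rewrite size_relabel => iR'.
have iR : i < size R by apply: ltnW.
rewrite row_leE !rtop_relabel // !rsz_relabel !rtag_relabel.
have := @row_le_nth R RP i i.+1; rewrite leqnSn iR' => /(_ isT).
rewrite row_leE !rlev_relabel -!map_drop.
have tail : rsz R i = rsz R i.+1 -> rtag R i = rtag R i.+1 ->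
    lexlt (cyc R 1 i) (cyc R 1 i.+1) ->
    lexle (map phi (drop 1 (rlev R i))) (map phi (drop 1 (rlev R i.+1))).
  move=> s F l; have := @relabel_tail i i.+1 iR iR' s F [::] [::] 1.
  by rewrite !cats0; apply=> //; apply: comb_ne.
case: (ltngtP (rtop R i)) => //= [lt _|te].
- have := phiM (ltnW lt); rewrite leq_eqVlt => /orP[/eqP e | ->] //.
  rewrite e eqxx ltnn /=.
  have := comb_mono RP iR iR' lt; rewrite leq_eqVlt => /orP[/eqP s | ->] //.
  rewrite s ltnn eqxx /=.
  have lab : lexlt (label R (i, 0)) (label R (i.+1, 0)).
    have := lexlt_trichotomy (label R (i, 0)) (label R (i.+1, 0)).
    rewrite (inj_eq (@label_inj R)) xpair_eqE eqn_leq ltnn andbF /=.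
    case/orP=> // l.
    have := @compatible_full R RP phi cp (i.+1, 0) (i, 0).
    rewrite /full_cell /= iR iR' !(comb_ne RP) //.
    by move=> /(_ isT isT l lt); rewrite /entry /= -!/(rtop R _) e ltnn.
  move: lab; rewrite !label_cons /= !lexlt_cons s !ltnn !eqxx /=.
  case: ltngtP => //= F; rewrite -/(cyc R 1 i) -/(cyc R 1 i.+1) lexlt_cat; last exact: size_cyc.
  case/orP=> [|/andP[/eqP /(cyc_inj s) ce _]]; first exact: tail.
  by rewrite /rtop ce ltnn in lt.
- rewrite te ltnn eqxx /=; case: ltngtP => //= s; case: ltngtP => //= F.
  rewrite /lexle; case/orP=> [/eqP-> | l]; first by rewrite eqxx.
  apply: tail => //; rewrite /cyc lexlt_cat ?l //.
  by rewrite !size_drop -!/(rsz R _) s.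
Qed.

End Relabel.

(** * Breaking the ties of a comb *)

Section Spread.
Variables (R : seq row) (y : seq nat).
Hypotheses (RP : comb_rows R) (yU : uniq y) (ysz : size y = size (word R)).
Hypothesis yR : same_pattern y (word R).

Let twin := ((size R).-2, 0).

Definition spread_entry p :=
  nth 0 y (index (if p == ((size R).-1, 0) then twin else p) (cell_order R)).

Definition spread_rows : seq row :=
  mkseq (fun i => (rtag R i, mkseq (fun c => spread_entry (i, c)) (rsz R i))) (size R).

Let S := spread_rows.

Lemma size_spread : size S = size R. Proof. exact: size_mkseq. Qed.

Lemma rlev_spread i : i < size R -> rlev S i = mkseq (fun c => spread_entry (i, c)) (rsz R i).
Proof. by move=> iR; rewrite /rlev /S /spread_rows nth_mkseq. Qed.

Lemma rtag_spread i : rtag S i = rtag R i.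
Proof.
case: (ltnP i (size R)) => iR; first by rewrite /rtag /S /spread_rows nth_mkseq.
by rewrite /rtag !nth_default ?size_spread.
Qed.

Lemma rsz_spread i : rsz S i = rsz R i.
Proof.
case: (ltnP i (size R)) => iR; first by rewrite /rsz rlev_spread // size_mkseq.
by rewrite /rsz /rlev !nth_default ?size_spread.
Qed.

Lemma entry_spread p : full_cell R p -> entry S p = spread_entry p.
Proof. by case: p => i c /andP[/= iR cs]; rewrite /entry rlev_spread // nth_mkseq. Qed.

Lemma cells_spread : cells S = cells R.
Proof.
rewrite /cells size_spread; congr filter; congr flatten.
by apply: eq_map => i; rewrite rsz_spread.
Qed.

Lemma cell_full p : p \in cells R -> full_cell R p.
Proof. by rewrite mem_cells andbA => /andP[]. Qed.

Lemma spread_entryE p : p \in cells R ->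
  spread_entry p = nth 0 y (index p (cell_order R)).
Proof. by rewrite mem_cells /spread_entry => /and3P[_ _ /negPf->]. Qed.

Lemma spread_last : spread_entry ((size R).-1, 0) = spread_entry twin.
Proof. by rewrite /spread_entry eqxx; case: ifP. Qed.

Lemma spread_lt p q : p \in cells R -> q \in cells R ->
  (spread_entry p < spread_entry q) =
  (entry R p < entry R q) || (entry R p == entry R q) && lexlt (label R p) (label R q).
Proof.
move=> pC qC; rewrite !spread_entryE // -index_cell_order //.
rewrite -(nth_word pC) -(nth_word qC).
have := index_cell_size pC; have := index_cell_size qC.
move: (index p _) (index q _) => a b bw aw.
case: (ltngtP a b) => [ab|ba|<-]; last by rewrite !ltnn andbF.
- by rewrite yR ?ab // andbT leq_eqVlt orbC.
- rewrite andbF orbF.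
  have := @yR b a; rewrite ba aw => /(_ isT) e.
  have : nth 0 y a != nth 0 y b by rewrite nth_uniq ?ysz // gtn_eqF.
  by move: e; case: ltngtP => //= _; case: ltngtP.
Qed.

Lemma spread_top i j : i < j < size R -> i < (size R).-2 ->
  spread_entry (i, 0) < spread_entry (j, 0).
Proof.
have main k : i < k < (size R).-1 -> spread_entry (i, 0) < spread_entry (k, 0).
  case/andP=> ik kR; have l := lt_lst RP.
  have kR' : k < size R by apply: ltn_trans l.
  have iR : i < size R by apply: ltn_trans kR'.
  rewrite spread_lt ?mem_cells /= ?iR ?kR' ?(comb_ne RP) //; last 2 first.
  - by apply/eqP=> -[]; lia.
  - by apply/eqP=> -[]; lia.
  have := @rtop_leq R RP i k; rewrite ltnW //= kR' => /(_ isT).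
  rewrite leq_eqVlt /rtop => /orP[/eqP e | ->] //.
  by rewrite /entry /= e eqxx ltnn /= label_top // ik.
case/andP=> ij jR it; case: (ltnP j (size R).-1) => jl.
  by apply: main; rewrite ij.
have -> : j = (size R).-1 by lia.
by rewrite spread_last main // it lt_twin.
Qed.

(** The level of a cell followed by the tail of its label is the cyclic reading that starts at the
    cell itself. The new values compare levels and then labels, hence exactly these readings. *)
Lemma spread_column i j k : i < size R -> j < size R -> rsz R i = rsz R j ->
  rtag R i = rtag R j -> 0 < k < rsz R i ->
  lexlt (cyc R k i ++ [:: i]) (cyc R k j ++ [:: j]) ->
  spread_entry (i, k) < spread_entry (j, k).
Proof.
move=> iR jR s F /andP[k0 ks].
have ks' : k < rsz R j by rewrite -s.
rewrite (cyc_cons ks) (cyc_cons ks') /= lexlt_cons -label_same_column // => l.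
rewrite spread_lt ?mem_cells /= ?iR ?jR -?s ?ks //.
  by apply/eqP=> -[_ e]; rewrite e in k0.
by apply/eqP=> -[_ e]; rewrite e in k0.
Qed.

Lemma rlev_lt_tail i j : i < size R -> j < size R -> rsz R i = rsz R j ->
  rtop R i = rtop R j -> i < j -> lexle (drop 1 (rlev R i)) (drop 1 (rlev R j)) ->
  lexlt (cyc R 1 i ++ [:: i]) (cyc R 1 j ++ [:: j]).
Proof.
move=> iR jR s t ij; rewrite /lexle => /orP[/eqP e|l].
  by rewrite /cyc (rlev_cons RP iR) (rlev_cons RP jR) e t lexlt_cat2l lexlt_cons ij.
by rewrite /cyc -!catA lexlt_cat ?l // !size_drop -!/(rsz R _) s.
Qed.

Lemma spread_tail i j : i < size R -> j < size R -> rsz R i = rsz R j ->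
  rtag R i = rtag R j -> rtop R i = rtop R j -> i < j ->
  lexle (drop 1 (rlev R i)) (drop 1 (rlev R j)) ->
  lexle (drop 1 (rlev S i)) (drop 1 (rlev S j)).
Proof.
move=> iR jR s F t ij le; have := comb_ne RP iR; rewrite leq_eqVlt => /orP[/eqP e1|s1].
  rewrite !drop_oversize ?lexle_refl //; first by rewrite -/(rsz S j) rsz_spread -s e1.
  by rewrite -/(rsz S i) rsz_spread -e1.
have [si sj] : 1 < size (rlev S i) /\ 1 < size (rlev S j).
  by rewrite -!/(rsz S _) !rsz_spread -s.
rewrite (drop_nth 0 si) (drop_nth 0 sj) lexle_cons.
rewrite -/(entry S (i, 1)) -/(entry S (j, 1)) !entry_spread /full_cell /= -?s ?iR ?jR //.
by rewrite spread_column // rlev_lt_tail.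
Qed.

(** New values in different cells differ, so the next cell alone decides. At the end of a row the
    next cell is an exit cell, and there only the skipped cell and its twin tie; inner words and
    then row indices settle that case. *)
Lemma label_spread p q : p \in cells R -> q \in cells R ->
  lexlt (label R p) (label R q) -> lexlt (label S p) (label S q).
Proof.
rewrite !mem_cells; case: p q => [i c] [j d] /= /and3P[iR ci _] /and3P[jR dj _].
rewrite !label_cons /= !lexlt_cons !rsz_spread !rtag_spread; case: ltngtP => //= _.
case: ltngtP => //= s; case: ltngtP => //= F; case: ltngtP => //= ?; subst d.
rewrite -!/(cyc _ c.+1 _) => lt.
move: (ci); rewrite leq_eqVlt => /orP[/eqP ce|cs]; last first.
  have := @spread_column i j c.+1 iR jR s F cs lt.
  have si : c.+1 < rsz S i by rewrite rsz_spread.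
  have sj : c.+1 < rsz S j by rewrite rsz_spread -s.
  by rewrite (cyc_cons si) (cyc_cons sj) /= lexlt_cons !rlev_spread // !nth_mkseq -?s // => ->.
have cycE Q k : rsz Q k = rsz R i -> cyc Q c.+1 k = rlev Q k.
  by move=> e; rewrite ce -e cyc_rsz.
rewrite !cycE ?rsz_spread //; move: lt; rewrite !cycE // lexlt_cat // => lt.
have ij : i < j.
  case/orP: lt => [|/andP[_]]; first exact: rlev_lt_index.
  by rewrite lexlt_cons orbC andbC.
have r0 k : k < size R -> rlev S k = spread_entry (k, 0) :: drop 1 (rlev S k).
  move=> kR; have sk : 0 < size (rlev S k) by rewrite -/(rsz S k) rsz_spread (comb_ne RP).
  rewrite -[LHS]drop0 (drop_nth 0 sk) -/(entry S (k, 0)) entry_spread //.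
  by rewrite /full_cell kR (comb_ne RP).
rewrite (r0 _ iR) (r0 _ jR) /= lexlt_cons.
case: (ltnP i (size R).-2) => [it|ti]; first by rewrite spread_top ?ij.
have ei : i = (size R).-2 by lia.
have ej : j = (size R).-1 by lia.
have t : rtop R i = rtop R j by rewrite ei ej; case: RP.
rewrite {1}ej spread_last -/twin /twin -ei ltnn {1}ej spread_last /twin -ei eqxx /=.
have le : lexle (drop 1 (rlev R i)) (drop 1 (rlev R j)).
  move: lt; rewrite (rlev_cons RP iR) (rlev_cons RP jR) t lexlt_cons ltnn eqseq_cons !eqxx /=.
  by case/orP=> [l | /andP[/eqP-> _]]; rewrite !drop0 /lexle ?l ?eqxx ?orbT.
have := spread_tail iR jR s F t ij le.
rewrite /lexle lexlt_cat; last by rewrite !size_drop -!/(rsz S _) !rsz_spread s.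
by rewrite lexlt_cons ij andbT orbC.
Qed.

Lemma cell_order_spread : cell_order S = cell_order R.
Proof.
rewrite /cell_order cells_spread.
have tot Q : total (label_le Q) by move=> ? ?; apply: lexle_total.
have tr Q : transitive (label_le Q) by move=> ? ? ?; apply: lexle_trans.
have an Q : antisymmetric (label_le Q).
  by move=> p q /lexle_anti /label_inj.
apply: (sorted_eq (@tr S) (@an S)); rewrite ?sort_sorted //; last first.
  by rewrite perm_sort perm_sym perm_sort.
apply: (sub_in_sorted (P := mem (cells R)) (e := label_le R)).
- move=> p q pC qC; rewrite /label_le /lexle.
  by case/orP=> [/eqP/label_inj-> | /label_spread->]; rewrite ?eqxx ?orbT.
- by apply/allP=> p; rewrite mem_sort.
- exact: sort_sorted.
Qed.

Lemma word_spread : word S = y.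
Proof.
apply: (@eq_from_nth _ 0); first by rewrite ysz !size_word cell_order_spread.
move=> k; rewrite size_word cell_order_spread => kw.
rewrite (nth_map (0, 0)) cell_order_spread //.
set p := nth _ _ k; have pC : p \in cells R by rewrite -mem_cell_order mem_nth.
by rewrite entry_spread ?cell_full // spread_entryE // index_uniq ?uniq_cell_order.
Qed.

Lemma shape_spread : row_shape S = row_shape R.
Proof.
apply: (@eq_from_nth _ (0, 0)) => [|i]; first by rewrite !size_map size_iota.
rewrite size_map size_spread => iR.
rewrite !(nth_map row0) ?size_spread // -/(rtag S i) -/(rsz S i) rtag_spread.
by rewrite -/(rlev S i) -/(rsz S i) rsz_spread.
Qed.

Lemma rtop_spread i : i < size R -> rtop S i = spread_entry (i, 0).
Proof. by move=> iR; rewrite /rtop rlev_spread // nth_mkseq // (comb_ne RP). Qed.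

(** Exit levels that were tied become ordered as the rows are, hence by size first, which is what
    [comb_mono] asks of the new strict inequalities. *)
Lemma spread_comb : comb_rows S.
Proof.
have l1 := lt_lst RP; have l2 := lt_twin RP; have l3 := ltn_trans l2 l1.
have rtop_eq : rtop R (size R).-2 = rtop R (size R).-1 by case: RP.
split; rewrite ?size_spread.
- by case: RP.
- by move=> i iR; rewrite rsz_spread (comb_ne RP).
- apply/(sortedP row0) => i; rewrite size_spread => iR'.
  have iR : i < size R by apply: ltnW.
  rewrite row_leE !rtop_spread // !rsz_spread !rtag_spread.
  case: (ltnP i (size R).-2) => [it|ti]; first by rewrite spread_top // leqnn.
  have ei : i = (size R).-2 by lia.
  have ej : i.+1 = (size R).-1 by lia.
  have t : rtop R i = rtop R i.+1 by rewrite ej ei.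
  rewrite ej spread_last /twin -ei ltnn eqxx -ej /=.
  have := @row_le_nth R RP i i.+1; rewrite leqnSn iR' => /(_ isT).
  rewrite row_leE t ltnn eqxx /=; case: ltngtP => //= s; case: ltngtP => //= F.
  exact: spread_tail.
- by rewrite !rtop_spread // spread_last.
- move=> i j iR jR; rewrite !rtop_spread // !rsz_spread => lt.
  have ij : i < j.
    rewrite ltnNge; apply/negP=> ji; move: (ji); rewrite leq_eqVlt => /orP[/eqP e|ji'].
      by rewrite e ltnn in lt.
    case: (ltnP j (size R).-2) => [jt|tj].
      by have := @spread_top j i; rewrite ji' iR => /(_ isT jt); lia.
    have ei : i = (size R).-1 by lia.
    have ej : j = (size R).-2 by lia.
    by move: lt; rewrite ei ej spread_last ltnn.
  have := @row_le_nth R RP i j; rewrite ltnW // jR => /(_ isT); rewrite row_leE.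
  case: ltngtP => //= [t _|_]; first exact: (comb_mono RP).
  by case: ltngtP.
- move=> i j c iR jR; rewrite rsz_spread => cj.
  rewrite rtop_spread // entry_spread; last by rewrite /full_cell jR; case/andP: cj.
  have jC : (j, c) \in cells R.
    rewrite mem_cells /= jR; case/andP: cj => c0 -> /=.
    by apply/eqP=> -[_ e]; rewrite e in c0.
  have main k : (k, 0) \in cells R -> spread_entry (k, 0) < spread_entry (j, c).
    move=> kC; rewrite spread_lt //.
    suff -> : entry R (k, 0) < entry R (j, c) by [].
    by move: kC; rewrite mem_cells => /andP[kR _]; apply: (comb_above RP).
  case: (eqVneq i (size R).-1) => [->|ni].
    by rewrite spread_last; apply: main; apply: twin_cell.
  apply: main; rewrite mem_cells /= iR (comb_ne RP) //=.
  by apply: contra_neq ni => -[].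
Qed.

Lemma spread_inj p q : p \in cells R -> q \in cells R ->
  spread_entry p = spread_entry q -> p = q.
Proof.
move=> pC qC; rewrite !spread_entryE // => /eqP.
rewrite nth_uniq ?ysz ?index_cell_size // => /eqP e.
rewrite -(nth_index (0, 0) (s := cell_order R) (x := p)) ?mem_cell_order //.
by rewrite e nth_index ?mem_cell_order.
Qed.

Section Row.
Variable i : nat.
Hypothesis iR : i < size R.

Lemma row_cell c : c < (rsz R i).-1 -> (i, c.+1) \in cells R.
Proof.
by move=> cs; rewrite mem_cells /= iR -ltn_predRL cs xpair_eqE andbF.
Qed.

Lemma nth_spread_row c : c < (rsz R i).-1 ->
  nth 0 (drop 1 (rlev S i)) c = spread_entry (i, c.+1).
Proof. by move=> cs; rewrite nth_drop rlev_spread // nth_mkseq // -ltn_predRL. Qed.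

Lemma size_spread_row : size (drop 1 (rlev S i)) = (rsz R i).-1.
Proof. by rewrite size_drop -/(rsz S i) rsz_spread subn1. Qed.

Lemma uniq_spread_row : uniq (drop 1 (rlev S i)).
Proof.
apply/(uniqP 0) => c d; rewrite !inE size_spread_row => cs ds.
rewrite !nth_spread_row // => /spread_inj.
by move=> /(_ (row_cell cs) (row_cell ds)) [].
Qed.

Lemma pattern_spread_row :
  same_pattern (drop 1 (rlev S i)) (drop 1 (rlev R i)).
Proof.
move=> c d; rewrite size_drop -/(rsz R i) subn1 => /andP[cd ds].
have cs := ltn_trans cd ds; rewrite !nth_spread_row // spread_lt ?row_cell //.
rewrite !nth_drop !add1n !label_cons /= !lexlt_cons !ltnn !eqxx /= ltnS cd /=.
by rewrite andbT /entry /= orbC -leq_eqVlt.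
Qed.

End Row.

End Spread.

(** * The word determines the rows *)

Section WordContents.
Variable R : seq row.
Hypothesis RP : comb_rows R.

Lemma mem_word v :
  reflect (exists2 p, full_cell R p & entry R p = v) (v \in word R).
Proof.
apply: (iffP mapP) => [[p pC ->]|[p pC <-]].
  by exists p => //; apply: cell_full; rewrite -mem_cell_order.
case: (eqVneq p ((size R).-1, 0)) => [->|np].
  exists ((size R).-2, 0); first by rewrite mem_cell_order twin_cell.
  by rewrite /entry /= -!/(rtop R _); case: RP.
by exists p => //; rewrite mem_cell_order mem_cells np andbT.
Qed.

Lemma size_wordS : (size (word R)).+1 = \sum_(i < size R) rsz R i.
Proof.
rewrite size_word size_sort.
set s := [seq (i, c) | i <- iota 0 (size R), c <- iota 0 (rsz R i)].
have l := lt_lst RP.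
have ss : size s = \sum_(i < size R) rsz R i.
  rewrite size_allpairs_dep sumnE big_map -(big_mkord xpredT (rsz R)) /index_iota subn0.
  by apply: eq_bigr => i _; rewrite size_iota.
have su : uniq s.
  rewrite allpairs_uniq_dep ?iota_uniq // => [i _|[i c] [j d] _ _ [-> ->] //].
  by rewrite iota_uniq.
have sl : ((size R).-1, 0) \in s.
  apply/allpairsPdep; exists (size R).-1, 0.
  by rewrite !mem_iota !add0n l (comb_ne RP).
rewrite -ss /cells -/s.
rewrite -(rem_filter _ su) size_rem // prednK //.
by case: (s) sl.
Qed.

End WordContents.

(** The reading order tells which cell each letter belongs to, and the skipped cell repeats its
    twin. *)
Lemma rows_eq (R R' : seq row) : comb_rows R -> comb_rows R' ->
  row_shape R = row_shape R' -> cell_order R = cell_order R' -> word R = word R' ->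
  R = R'.
Proof.
move=> RP RP' sh co wd.
have sz : size R = size R' by rewrite -(size_map (fun r => (r.1, size r.2)) R) -/(row_shape R) sh size_map.
have cE p : (p \in cells R) = (p \in cells R') by rewrite -!mem_cell_order co.
have eE p : p \in cells R -> entry R p = entry R' p.
  by move=> pC; rewrite -(nth_word pC) wd co nth_word -?cE.
apply: (@eq_from_nth _ row0) => // i iR.
have := congr1 (fun s => nth (0, 0) s i) sh.
rewrite !(nth_map row0) -?sz // => -[tg s].
rewrite [LHS]surjective_pairing [RHS]surjective_pairing tg; congr pair.
apply: (@eq_from_nth _ 0) => // c cs.
rewrite -/(rlev R i) -/(rlev R' i) -[LHS]/(entry R (i, c)) -[RHS]/(entry R' (i, c)).
case: (eqVneq (i, c) ((size R).-1, 0)) => [[-> ->]|np]; last first.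
  by apply: eE; rewrite mem_cells iR np andbT.
have -> : entry R ((size R).-1, 0) = entry R ((size R).-2, 0) by case: RP.
have -> : entry R' ((size R).-1, 0) = entry R' ((size R).-2, 0) by rewrite sz; case: RP'.
by rewrite eE ?sz // cE -?sz sz twin_cell.
Qed.

(** * Ultrametrics and combs *)

Section Ultrametrics.
Variable T : finType.
Implicit Types (A B : {set T}) (d : T -> T -> nat) (v w : nat).

(* [d x y] is the level at which [x] and [y] get separated; the diagonal
   carries no information. *)
Definition ultrametric A d :=
  {in A &, forall x y, d x y = d y x} /\
  {in A & &, forall x y z, x != z -> minn (d x y) (d y z) <= d x z}.

Definition near d v (x y : T) := (x == y) || (v < d x y).

Definition block d v A x := [set y in A | near d v x y].

Definition blocks d v A := equivalence_partition (near d v) A.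

(** Larger values mean later separation, so the maximum is the level at which the block of [x] has
    become separate from all others. It is 0 if there is no far point. *)
Definition exit d v A x := \max_(y in A | ~~ near d v x y) d x y.

(* The levels up to [v] split off the blocks of [A] one after the other, in
   an order of nondecreasing size. *)
Definition comb d v A :=
  [forall x in A, forall y in A, ~~ near d v x y ==>
     (d x y == minn (exit d v A x) (exit d v A y)) &&
     ((exit d v A x < exit d v A y) ==> (#|block d v A x| <= #|block d v A y|))].

Definition level d A v := [exists x in A, exists y in A, (x != y) && (d x y == v)].

(** Ranging over pairs of distinct points keeps the maximum among the levels that occur, so that at
    least two blocks exit at the depth. *)
Definition comb_depth d A :=
  \max_(p in setX A A | (p.1 != p.2) && comb d (d p.1 p.2) A) d p.1 p.2.

Lemma levelP d A v :
  reflect (exists x y, [/\ x \in A, y \in A, x != y & d x y = v]) (level d A v).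
Proof.
apply: (iffP exists_inP) => [[x xA /exists_inP[y yA /andP[xy /eqP e]]]|[x [y [xA yA xy e]]]].
  by exists x, y.
by exists x => //; apply/exists_inP; exists y; rewrite // xy e eqxx.
Qed.

Lemma level_d d A x y : x \in A -> y \in A -> x != y -> level d A (d x y).
Proof. by move=> xA yA xy; apply/levelP; exists x, y. Qed.

Lemma combP d v A :
  reflect (forall x y, x \in A -> y \in A -> ~~ near d v x y ->
     d x y = minn (exit d v A x) (exit d v A y) /\
     (exit d v A x < exit d v A y -> #|block d v A x| <= #|block d v A y|))
    (comb d v A).
Proof.
apply: (iffP forall_inP) => H.
  move=> x y xA yA nxy; have /forall_inP/(_ y yA)/implyP/(_ nxy) := H x xA.
  by case/andP=> /eqP-> /implyP.
move=> x xA; apply/forall_inP=> y yA; apply/implyP=> nxy.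
by have [e s] := H x y xA yA nxy; rewrite -e eqxx; apply/implyP.
Qed.

Lemma comb_pair d v A x y : comb d v A -> x \in A -> y \in A -> ~~ near d v x y ->
  d x y = minn (exit d v A x) (exit d v A y) /\
  (exit d v A x < exit d v A y -> #|block d v A x| <= #|block d v A y|).
Proof. by move/combP=> H xA yA; apply: H. Qed.

Lemma exit_ub d v A x y : y \in A -> ~~ near d v x y -> d x y <= exit d v A x.
Proof. by move=> yA n; apply: (@leq_bigmax_cond _ _ (d x)); rewrite yA. Qed.

Lemma exit_le d v A x : exit d v A x <= v.
Proof.
by apply/bigmax_leqP=> y /andP[_]; rewrite negb_or -leqNgt => /andP[].
Qed.

Lemma exit_attained d v A x y : y \in A -> ~~ near d v x y ->
  exists z, [/\ z \in A, ~~ near d v x z & exit d v A x = d x z].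
Proof.
move=> yA n; have c0 : 0 < #|[pred y | (y \in A) && ~~ near d v x y]|.
  by apply/card_gt0P; exists y; rewrite inE yA.
have [z /andP[zA nz] e] := eq_bigmax_cond (d x) c0.
by exists z; split.
Qed.

Lemma far_neq d v x y : ~~ near d v x y -> x != y.
Proof. by rewrite negb_or => /andP[]. Qed.

Lemma far_le d v x y : ~~ near d v x y -> d x y <= v.
Proof. by rewrite negb_or -leqNgt => /andP[]. Qed.

Lemma near_lt d v x y : x != y -> near d v x y = (v < d x y).
Proof. by rewrite /near => /negPf->. Qed.

Lemma nearxx d v x : near d v x x. Proof. by rewrite /near eqxx. Qed.

Lemma near_leq d v w x y : v <= w -> near d w x y -> near d v x y.
Proof. by move=> vw /orP[/eqP->|l]; rewrite /near ?eqxx // (leq_ltn_trans vw l) orbT. Qed.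

Lemma mem_block d v A x y : (y \in block d v A x) = (y \in A) && near d v x y.
Proof. by rewrite inE. Qed.

Section OneUltrametric.
Variables (A : {set T}) (d : T -> T -> nat).
Hypothesis dU : ultrametric A d.

Lemma near_equiv v : {in A & &, equivalence_rel (near d v)}.
Proof.
case: dU => dS dT.
have sy x y : x \in A -> y \in A -> near d v x y -> near d v y x.
  by move=> xA yA; rewrite /near eq_sym dS.
have tr x y z : x \in A -> y \in A -> z \in A ->
    near d v x y -> near d v y z -> near d v x z.
  move=> xA yA zA; rewrite /near; case: (eqVneq x z) => //= xz.
  case: eqP => [<- _|_ /= xy]; first by rewrite (negPf xz).
  case: eqP => [<-|_ /= yz]; first by rewrite xy.
  by apply: leq_trans (dT x y z xA yA zA xz); rewrite leq_min xy.
move=> x y z xA yA zA; split; first exact: nearxx.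
move=> xy; apply/idP/idP => [xz|yz]; first exact: (tr y x z) (sy _ _ _ _ xy) xz.
exact: (tr x y z).
Qed.

Lemma near_sym v : {in A &, forall x y, near d v x y = near d v y x}.
Proof. by case: dU => dS _ x y xA yA; rewrite /near eq_sym dS. Qed.

Lemma exit_near v x y : x \in A -> y \in A -> near d v x y ->
  exit d v A x = exit d v A y.
Proof.
have main x' y' : x' \in A -> y' \in A -> near d v x' y' -> exit d v A x' <= exit d v A y'.
  move=> xA yA xy; apply/bigmax_leqP=> z /andP[zA nz].
  have nyz : ~~ near d v y' z by rewrite -((near_equiv v xA yA zA).2 xy).
  apply: leq_trans (exit_ub zA nyz).
  case: (eqVneq x' y') => [->//|nxy]; have [dS dT] := dU.
  apply: leq_trans (dT y' x' z yA xA zA (far_neq nyz)).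
  rewrite leq_min leqnn andbT (dS y' x') // ltnW //; apply: leq_ltn_trans (far_le nz) _.
  by rewrite -near_lt.
move=> xA yA xy; apply/eqP; rewrite eqn_leq !main //.
by rewrite near_sym.
Qed.

Lemma exists_level : 1 < #|A| -> exists v, level d A v.
Proof.
by case/card_gt1P=> x [y [xA yA xy]]; exists (d x y); apply: level_d.
Qed.

(** Every far pair lies exactly at level [v], so all exits are equal and the size condition holds
    vacuously. *)
Lemma comb_min v : (forall w, level d A w -> v <= w) -> comb d v A.
Proof.
move=> vm; apply/combP=> x y xA yA nxy.
have e x' y' : x' \in A -> y' \in A -> ~~ near d v x' y' -> d x' y' = v.
  move=> xA' yA' n; apply/eqP; rewrite eqn_leq far_le // vm // level_d //.
  exact: far_neq n.
have ex x' y' : x' \in A -> y' \in A -> ~~ near d v x' y' -> exit d v A x' = v.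
  move=> xA' yA' n; apply/eqP; rewrite eqn_leq exit_le.
  by rewrite -{1}(e _ _ xA' yA' n) exit_ub.
have nyx : ~~ near d v y x by rewrite near_sym.
by rewrite (ex x y) // (ex y x) // e // minnn ltnn.
Qed.

Lemma comb_depth_spec : 1 < #|A| ->
  [/\ level d A (comb_depth d A), comb d (comb_depth d A) A &
      forall v, level d A v -> comb d v A -> v <= comb_depth d A].
Proof.
move=> A1; have [v0 lv0 m0] : exists2 v, level d A v & forall w, level d A w -> v <= w.
  by case: (ex_minnP (exists_level A1)) => v lv m; exists v.
have c0 := comb_min m0.
have pos : 0 < #|[pred p | (p \in setX A A) && ((p.1 != p.2) && comb d (d p.1 p.2) A)]|.
  case/levelP: lv0 => x [y [xA yA xy e]]; apply/card_gt0P; exists (x, y).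
  by rewrite !inE /= xA yA xy e c0.
have [[x y] /=] := eq_bigmax_cond (fun p : T * T => d p.1 p.2) pos.
rewrite !inE /= => /andP[/andP[xA yA] /andP[xy cxy]] e.
split; first by rewrite /comb_depth e level_d.
  by rewrite /comb_depth e.
move=> v /levelP[x' [y' [xA' yA' xy' <-]]] c.
apply: (@leq_bigmax_cond _ _ (fun p : T * T => d p.1 p.2) (x', y')).
by rewrite !inE /= xA' yA' xy'.
Qed.

Lemma comb_depth_eq v : level d A v -> comb d v A ->
  (forall w, level d A w -> comb d w A -> w <= v) -> comb_depth d A = v.
Proof.
move=> lv cv m; have A1 : 1 < #|A|.
  by case/levelP: lv => x [y [xA yA xy _]]; apply/card_gt1P; exists x, y.
have [l c m'] := comb_depth_spec A1.
by apply/eqP; rewrite eqn_leq m // m'.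
Qed.

Lemma exit_block_eq v w x : v <= w -> x \in A ->
  (forall z, z \in A -> near d v x z -> near d w x z) ->
  exit d v A x = exit d w A x /\ block d v A x = block d w A x.
Proof.
move=> vw xA H.
have e z : z \in A -> near d v x z = near d w x z.
  by move=> zA; apply/idP/idP; [exact: H | exact: near_leq].
split; last by apply/setP=> z; rewrite !inE; case: (boolP (z \in A)) => //= /e.
by apply: eq_bigl => z; case: (boolP (z \in A)) => //= /e ->.
Qed.

(** Stability of the depth: if merging levels gives a comb that continues past [th], then [d] itself
    is a comb up to [v], its next level. The sizes enter with opposite inequalities in the two
    combs, and this excludes the bad configurations. *)
Lemma comb_extend phi th v w : {homo phi : x y / x <= y} -> comb d th A ->
  (forall u, level d A u -> th < u -> v <= u) ->
  phi th < phi v -> phi v <= w -> comb (fun x y => phi (d x y)) w A ->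
  comb d v A.
Proof.
move=> phiM cth vm thv vw cQ; set dQ := fun x y => phi (d x y) in cQ.
have thv' : th < v by rewrite ltnNge; apply/negP=> /phiM; rewrite leqNgt thv.
have [dS dT] := dU.
have nearQ x z : near dQ w x z -> near d v x z.
  case/orP=> [/eqP->|l]; first exact: nearxx.
  apply/orP; right; rewrite ltnNge; apply/negP=> /phiM.
  by rewrite leqNgt (leq_ltn_trans vw l).
have farQ x z : z \in A -> ~~ near d v x z -> phi (d x z) <= exit dQ w A x.
  by move=> zA n; apply: (@exit_ub dQ) => //; apply: contra n; apply: nearQ.
have above x z : x \in A -> z \in A -> x != z -> near d th x z -> v <= d x z.
  by move=> xA zA xz; rewrite near_lt // => l; apply: vm => //; apply: level_d.
have small x : x \in A -> exit dQ w A x <= phi th ->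
    forall z, z \in A -> near d th x z -> near dQ w x z.
  move=> xA s z zA nz; apply/negPn/negP=> nQ.
  have := exit_ub zA nQ; rewrite leqNgt (leq_ltn_trans s) //.
  by apply: leq_trans thv (phiM _ _ _); apply: above => //; apply: far_neq nQ.
have subQ x : block dQ w A x \subset block d v A x.
  by apply/subsetP=> z; rewrite !inE => /andP[-> /nearQ].
have smallE x : x \in A -> exit dQ w A x <= phi th ->
    [/\ exit d th A x = exit d v A x, block d th A x = block d v A x
      & block d th A x = block dQ w A x].
  move=> xA s; have sm := small x xA s.
  have [e b] := exit_block_eq (ltnW thv') xA (fun z zA n => nearQ _ _ (sm z zA n)).
  split=> //; apply/eqP; rewrite eqEsubset {2}b subQ andbT.
  by apply/subsetP=> z; rewrite !inE => /andP[zA nz]; rewrite zA sm.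
(* Suppose [x] and [y] part below both of their exits, and [x] has become separate by then after
   merging. The comb at [th] makes the [th]-block of [y] at most as large as that of [x]. The merged
   comb makes the block of [x], which is the same as at [th], at most as large as the merged block
   of [y]; but the latter is strictly inside the [th]-block of [y]. *)
have key x y : x \in A -> y \in A -> ~~ near d v x y ->
    d x y < exit d v A x -> d x y < exit d v A y -> exit dQ w A x <= phi (d x y) -> False.
  move=> xA yA nxy ltx lty eQ.
  have xy := far_neq nxy; have yx : y != x by rewrite eq_sym.
  have ath : d x y <= th.
    rewrite leqNgt; apply/negP=> l; have := vm _ (level_d d xA yA xy) l.
    by rewrite leqNgt (leq_trans ltx) // exit_le.
  have eQ' := leq_trans eQ (phiM _ _ ath).
  have [ex bx bxQ] := smallE _ xA eQ'.
  have nth : ~~ near d th x y by rewrite near_lt // -leqNgt.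
  have nth' : ~~ near d th y x by rewrite near_sym.
  have [e1 _] := comb_pair cth xA yA nth.
  have ey : exit d th A y = d x y.
    by move: e1 ltx; rewrite -ex /minn; case: ifP => // _ ->; rewrite ltnn.
  have [_ s1] := comb_pair cth yA xA nth'.
  have {}s1 : #|block d th A y| <= #|block d th A x| by apply: s1; rewrite ey ex.
  have nyx : ~~ near d v y x by rewrite near_sym.
  have [z [zA nz ez]] := exit_attained xA nyx.
  have nthz : near d th y z.
    by apply/negPn/negP=> n; have := exit_ub zA n; rewrite ey -ez leqNgt lty.
  have nQ : ~~ near dQ w x y by apply: contra nxy; apply: nearQ.
  have [_ s2] := comb_pair cQ xA yA nQ.
  have : #|block dQ w A x| <= #|block dQ w A y|.
    apply: s2; apply: leq_ltn_trans eQ' _; apply: leq_trans (farQ y z zA nz).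
    by apply: leq_trans thv (phiM _ _ _); apply: above => //; apply: far_neq nz.
  rewrite -bxQ; apply/negP; rewrite -ltnNge; apply: leq_trans s1.
  apply: proper_card; apply/properP; split.
    apply: subset_trans (subQ y) _; apply/subsetP=> u; rewrite !inE => /andP[-> n].
    exact: near_leq (ltnW thv') n.
  exists z; rewrite !inE zA //=; apply: contra nz; exact: nearQ.
apply/combP=> x y xA yA nxy.
have nyx : ~~ near d v y x by rewrite near_sym.
have nQ : ~~ near dQ w x y by apply: contra nxy; apply: nearQ.
have [eQ sQ] := comb_pair cQ xA yA nQ.
have ubx := exit_ub yA nxy; have uby := exit_ub xA nyx.
have dyx : d y x = d x y by apply: dS.
split.
  apply/eqP; rewrite eqn_leq leq_min ubx -dyx uby dyx /= leqNgt leq_min.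
  apply/negP=> /andP[ltx lty].
  case: (leqP (exit dQ w A x) (exit dQ w A y)) => le.
    by apply: (key x y) => //; rewrite -/(dQ x y) eQ (minn_idPl le).
  by apply: (key y x); rewrite // ?dyx // -/(dQ x y) eQ (minn_idPr (ltnW le)).
move=> lt.
(* No level lies strictly between [th] and [v], so a block that exits before [v] is already a block
   at [th]. *)
have small' x' : x' \in A -> exit d v A x' < v ->
    exit d th A x' = exit d v A x' /\ block d th A x' = block d v A x'.
  move=> xA' l; apply: exit_block_eq => // [|z zA nz]; first exact: ltnW.
  apply/negPn/negP=> n; have := exit_ub zA n; rewrite leqNgt (leq_trans l) //.
  by apply: above => //; apply: far_neq n.
have ev := exit_le d v A y; have ltv : exit d v A x < v := leq_trans lt ev.
have [ex bx] := small' _ xA ltv.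
have nth : ~~ near d th x y.
  apply: contra nxy => n; suff: y \in block d v A x by rewrite inE yA.
  by rewrite -bx inE yA.
move: ev; rewrite leq_eqVlt => /orP[/eqP ev|ev]; last first.
  have [ey byy] := small' _ yA ev.
  have [_ s] := comb_pair cth xA yA nth.
  by rewrite -bx -byy; apply: s; rewrite ex ey.
(* Here [y] exits at [v] itself. Merging keeps the exit of [x] at most [phi th] and that of [y] at
   least [phi v], so the merged comb supplies the inequality of sizes. *)
have [z [zA nz ez]] := exit_attained xA nyx.
have outy : phi v <= exit dQ w A y by rewrite -ev ez; apply: farQ.
have outx : exit dQ w A x <= phi th.
  have : dQ x y <= phi th by apply: phiM; apply: far_le nth.
  by rewrite eQ geq_min => /orP[//|]; rewrite leqNgt (leq_trans thv).
have [_ _ bQ] := smallE _ xA outx.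
rewrite -bx bQ; apply: leq_trans (subset_leq_card (subQ y)).
by apply: sQ; apply: leq_ltn_trans outx (leq_trans thv outy).
Qed.

End OneUltrametric.
End Ultrametrics.

(** * Codes of ultrametrics *)

(** Gathers witnesses found block by block into one function without a choice axiom. *)
Lemma finite_choice (X : Type) (x0 : X) (P : nat -> X -> Prop) n :
  (forall i, i < n -> exists x, P i x) ->
  exists g : nat -> X, forall i, i < n -> P i (g i).
Proof.
elim: n => [|n IH] H; first by exists (fun=> x0).
have [g Pg] := IH (fun i l => H i (ltnW l)).
have [x Px] := H n (leqnn _).
exists (fun i => if i == n then x else g i) => i.
by rewrite ltnS leq_eqVlt; case: eqP => [->|_ /Pg].
Qed.

Section Codes.
Variables (T : finType) (c : T -> nat).
Implicit Types (A B : {set T}) (d : T -> T -> nat).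

(** [exit] is constant on a block; the maximum avoids picking a point. *)
Definition block_exit d v A B := \max_(x in B) exit d v A x.

Section Rows.
Variable F : (T -> T -> nat) -> {set T} -> nat * seq nat.

Definition block_row d v A B : row := ((F d B).1, block_exit d v A B :: (F d B).2).

Definition sorted_blocks d A :=
  let v := comb_depth d A in
  sort (relpre (block_row d v A) row_le) (enum (blocks d v A)).

Definition rows d A : seq row :=
  [seq block_row d (comb_depth d A) A B | B <- sorted_blocks d A].

End Rows.

(** [k] is fuel, and [#|A| <= k.+1] is enough because blocks are smaller than [A]. On a single point
    the sum is just its colour. Pickling makes the tag a number, so that tags can be compared inside
    row keys and labels. *)
Fixpoint code k d A : nat * seq nat :=
  if k is k'.+1 then
    if #|A| <= 1 then (\sum_(x in A) c x, [::]) else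
    let R := rows (code k') d A in (pickle (row_shape R, cell_order R), word R)
  else (\sum_(x in A) c x, [::]).

Definition isomorphic d A d' A' := exists f : T -> T,
  [/\ {in A &, injective f}, f @: A = A', {in A, forall x, c (f x) = c x}
    & {in A &, forall x y, x != y -> d' (f x) (f y) = d x y}].

(* Every part of the first nontrivial level of [A] has at least [m] elements. *)
Definition top_ge d A m :=
  [forall x in A, m <= #|[set z in A | (x == z) ||
     [exists u in A, exists w in A, (u != w) && (d u w < d x z)]]|].

(** The statement proved by induction on the size of [A]. [code_top] is the information on sizes
    that the tag has to carry for [code_spread]: breaking ties inside a block must not lengthen the
    comb around it. *)
Record good_code (F : (T -> T -> nat) -> {set T} -> nat * seq nat) A : Prop := GoodCode {
  code_size : forall d, ultrametric A d -> size (F d A).2 = #|A|.-1;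
  code_level : forall d v, ultrametric A d -> (v \in (F d A).2) = level d A v;
  code_iso : forall d d' A', ultrametric A d -> ultrametric A' d' ->
    isomorphic d A d' A' -> F d A = F d' A';
  code_complete : forall d d' A', ultrametric A d -> ultrametric A' d' ->
    #|A| = #|A'| -> F d A = F d' A' -> isomorphic d A d' A';
  code_relabel : forall d phi, ultrametric A d -> {homo phi : x y / x <= y} ->
    compatible phi (F d A).2 ->
    F (fun x y => phi (d x y)) A = ((F d A).1, map phi (F d A).2);
  code_spread : forall d y, ultrametric A d -> uniq y -> size y = size (F d A).2 ->
    same_pattern y (F d A).2 ->
    exists d', [/\ ultrametric A d', F d' A = ((F d A).1, y) &
      forall phi, map phi y = (F d A).2 ->
        {in A &, forall x z, x != z -> phi (d' x z) = d x z}];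
  code_top : forall d d', ultrametric A d -> ultrametric A d' -> 1 < #|A| ->
    (F d A).1 = (F d' A).1 -> forall m, top_ge d A m = top_ge d' A m }.

Lemma ultrametric_sub A B d : B \subset A -> ultrametric A d -> ultrametric B d.
Proof.
move=> /subsetP BA [dS dT]; split; first by move=> x y /BA xA /BA yA; apply: dS.
by move=> x y z /BA xA /BA yA /BA zA; apply: dT.
Qed.

Lemma ultrametric_relabel A d phi : {homo phi : x y / x <= y} ->
  ultrametric A d -> ultrametric A (fun x y => phi (d x y)).
Proof.
move=> phiM [dS dT]; split; first by move=> x y xA yA; rewrite dS.
move=> x y z xA yA zA xz; have := dT x y z xA yA zA xz.
by rewrite !geq_min => /orP[/phiM->|/phiM->]; rewrite ?orbT.
Qed.

(** * The rows of one ultrametric *)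

Section Blocks.
Variables (A : {set T}) (d : T -> T -> nat).
Hypotheses (dU : ultrametric A d) (A1 : 1 < #|A|).

Let v := comb_depth d A.
Let P := blocks d v A.

Lemma partition_blocks w : partition (blocks d w A) A.
Proof. exact: equivalence_partitionP (near_equiv dU w). Qed.

Lemma mem_blocks w B : reflect (exists2 x, x \in A & B = block d w A x) (B \in blocks d w A).
Proof. exact: imsetP. Qed.

Lemma block_in_blocks w x : x \in A -> block d w A x \in blocks d w A.
Proof. by move=> xA; apply/mem_blocks; exists x. Qed.

Lemma self_block w x : x \in A -> x \in block d w A x.
Proof. by move=> xA; rewrite mem_block xA nearxx. Qed.

Lemma blocks_block w B x : B \in blocks d w A -> x \in B -> x \in A /\ B = block d w A x.
Proof.
case/mem_blocks=> y yA ->; rewrite mem_block => /andP[xA yx]; split=> //.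
apply/setP=> z; rewrite !mem_block; case: (boolP (z \in A)) => //= zA.
by rewrite (near_equiv dU w yA xA zA).2.
Qed.

Lemma blocks_sub w B : B \in blocks d w A -> B \subset A.
Proof. by move=> BP; apply/subsetP=> x /(blocks_block BP)[]. Qed.

Lemma blocks_ne w B : B \in blocks d w A -> exists x, x \in B.
Proof. by case/mem_blocks=> x xA ->; exists x; apply: self_block. Qed.

Lemma blocks_eq w B B' x : B \in blocks d w A -> B' \in blocks d w A ->
  x \in B -> x \in B' -> B = B'.
Proof. by move=> BP BP' /(blocks_block BP)[_ ->] /(blocks_block BP')[_ ->]. Qed.

Lemma block_exitE w B x : B \in blocks d w A -> x \in B -> block_exit d w A B = exit d w A x.
Proof.
move=> BP xB; have [xA BE] := blocks_block BP xB; apply/eqP; rewrite eqn_leq.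
rewrite (@leq_bigmax_cond _ _ (exit d w A)) // andbT; apply/bigmax_leqP=> y.
rewrite BE mem_block => /andP[yA xy].
by rewrite (exit_near dU xA yA xy).
Qed.

Lemma near_blocks w x y : x \in A -> y \in A ->
  near d w x y = (block d w A x == block d w A y).
Proof.
move=> xA yA; apply/idP/eqP => [xy|e].
  by have [] := blocks_block (block_in_blocks w xA) (x := y); rewrite ?mem_block ?yA.
by have := self_block w yA; rewrite -e mem_block yA.
Qed.

Lemma comb_depth_level : level d A v. Proof. by case: (comb_depth_spec dU A1). Qed.
Lemma comb_depth_comb : comb d v A. Proof. by case: (comb_depth_spec dU A1). Qed.

(** The depth is a level, hence the minimum of two exits, neither of which exceeds it. *)
Lemma last_two_blocks : exists x y,
  [/\ x \in A, y \in A, ~~ near d v x y, exit d v A x = v & exit d v A y = v].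
Proof.
have /levelP[x [y [xA yA xy e]]] := comb_depth_level.
have n : ~~ near d v x y by rewrite near_lt // e ltnn.
have [m _] := comb_pair comb_depth_comb xA yA n.
exists x, y; split=> //; apply/eqP; rewrite eqn_leq exit_le -{1}e m geq_min leqnn ?orbT //.
Qed.

Lemma blocks_card B : B \in P -> #|B| < #|A|.
Proof.
move=> BP; apply: proper_card; rewrite properEneq (blocks_sub BP) andbT.
apply/eqP=> BA; have [x [y [xA yA n _ _]]] := last_two_blocks.
have xB : x \in B by rewrite BA.
by case/negP: n; rewrite near_blocks // -(blocks_block BP xB).2 -(blocks_block BP _).2 // BA.
Qed.

Lemma exists_far x : x \in A -> exists2 y, y \in A & ~~ near d v x y.
Proof.
move=> xA; have [y [z [yA zA n _ _]]] := last_two_blocks.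
case: (boolP (near d v x y)) => xy; last by exists y.
by exists z => //; rewrite (near_equiv dU v xA yA zA).2.
Qed.

Section WithCode.
Variable F : (T -> T -> nat) -> {set T} -> nat * seq nat.
Hypothesis FG : forall B, #|B| < #|A| -> good_code F B.

Let R := rows F d A.
Let PB := sorted_blocks F d A.

Lemma rowsE : R = sort row_le [seq block_row F d v A B | B <- enum P].
Proof. by rewrite sort_map. Qed.

Lemma size_rows : size R = size PB. Proof. exact: size_map. Qed.

Lemma mem_sorted_blocks B : (B \in PB) = (B \in P).
Proof. by rewrite mem_sort mem_enum. Qed.

Lemma uniq_sorted_blocks : uniq PB. Proof. by rewrite sort_uniq enum_uniq. Qed.

Definition nth_block i := nth set0 PB i.

Lemma nth_blockP i : i < size R -> nth_block i \in P.
Proof. by rewrite size_rows => iR; rewrite -mem_sorted_blocks mem_nth. Qed.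

Definition block_index x := index (block d v A x) PB.

Lemma block_index_lt x : x \in A -> block_index x < size R.
Proof. by move=> xA; rewrite size_rows index_mem mem_sorted_blocks block_in_blocks. Qed.

Lemma nth_block_index x : x \in A -> nth_block (block_index x) = block d v A x.
Proof. by move=> xA; rewrite /nth_block nth_index // mem_sorted_blocks block_in_blocks. Qed.

Lemma block_index_nth i x : i < size R -> x \in nth_block i -> block_index x = i.
Proof.
move=> iR xi; have [xA e] := blocks_block (nth_blockP iR) xi.
by rewrite /block_index -e index_uniq ?uniq_sorted_blocks -?size_rows.
Qed.

Lemma near_block_index x y : x \in A -> y \in A ->
  near d v x y = (block_index x == block_index y).
Proof.
move=> xA yA; rewrite near_blocks //; apply/eqP/eqP => [|e]; first by rewrite /block_index => ->.
by rewrite -nth_block_index // e nth_block_index.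
Qed.

Lemma nth_rows i : i < size R -> nth row0 R i = block_row F d v A (nth_block i).
Proof. by rewrite size_rows => iR; rewrite (nth_map set0). Qed.

Lemma rtag_rows i : i < size R -> rtag R i = (F d (nth_block i)).1.
Proof. by move=> iR; rewrite /rtag nth_rows. Qed.

Lemma rlev_rows i : i < size R ->
  rlev R i = block_exit d v A (nth_block i) :: (F d (nth_block i)).2.
Proof. by move=> iR; rewrite /rlev nth_rows. Qed.

Lemma rtop_rows i : i < size R -> rtop R i = block_exit d v A (nth_block i).
Proof. by move=> iR; rewrite /rtop rlev_rows. Qed.

Lemma rtop_block_index x : x \in A -> rtop R (block_index x) = exit d v A x.
Proof.
move=> xA; rewrite rtop_rows ?block_index_lt // nth_block_index //.
by rewrite (block_exitE (x := x)) ?block_in_blocks ?self_block.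
Qed.

Lemma block_ultrametric B : B \in P -> ultrametric B d.
Proof. by move=> BP; apply: ultrametric_sub dU; apply: blocks_sub BP. Qed.

Lemma block_good B : B \in P -> good_code F B.
Proof. by move=> BP; apply: FG; apply: blocks_card. Qed.

Lemma rsz_rows i : i < size R -> rsz R i = #|nth_block i|.
Proof.
move=> iR; have BP := nth_blockP iR; rewrite /rsz rlev_rows //=.
rewrite (code_size (block_good BP)) ?prednK //; last exact: block_ultrametric.
by have [x xB] := blocks_ne BP; apply/card_gt0P; exists x.
Qed.

Lemma entry_rows i k : i < size R -> entry R (i, k.+1) = nth 0 (F d (nth_block i)).2 k.
Proof. by move=> iR; rewrite /entry rlev_rows. Qed.

Lemma card_nth_block x : x \in A -> rsz R (block_index x) = #|block d v A x|.
Proof. by move=> xA; rewrite rsz_rows ?block_index_lt // nth_block_index. Qed.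

Lemma row_value_above i k : i < size R -> 0 < k < rsz R i -> v < entry R (i, k).
Proof.
case: k => // k iR kR; have BP := nth_blockP iR; rewrite entry_rows //.
have : nth 0 (F d (nth_block i)).2 k \in (F d (nth_block i)).2.
  by apply: mem_nth; move: kR; rewrite /rsz rlev_rows.
rewrite (code_level (block_good BP)); last exact: block_ultrametric.
case/levelP=> x [y [xB yB xy <-]]; rewrite -near_lt //.
have [xA e1] := blocks_block BP xB; have [yA e2] := blocks_block BP yB.
by rewrite near_blocks // -e1 -e2.
Qed.

Lemma rtop_rows_le i : i < size R -> rtop R i <= v.
Proof.
move=> iR; have [x xB] := blocks_ne (nth_blockP iR).
by rewrite rtop_rows // (block_exitE (nth_blockP iR) xB) exit_le.
Qed.

Lemma rtop_last : 1 < size R /\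
  rtop R (size R).-2 = v /\ rtop R (size R).-1 = v.
Proof.
have [x [y [xA yA n ex ey]]] := last_two_blocks.
have srt : sorted row_le R by rewrite rowsE; apply: sort_sorted; apply: row_le_total.
have xR := block_index_lt xA; have yR := block_index_lt yA.
have ne : block_index x != block_index y by rewrite -near_block_index.
have s1 : 1 < size R by move: ne xR yR; lia.
have le i : (size R).-2 <= i < size R -> rtop R i = v.
  case/andP=> li iR; apply/eqP; rewrite eqn_leq rtop_rows_le //=.
  case: (leqP (block_index x) i) => xi.
    by rewrite -ex -rtop_block_index // rtop_sorted // xi.
  by rewrite -ey -rtop_block_index // rtop_sorted // iR andbT; lia.
by split=> //; rewrite !le //; lia.
Qed.

Lemma rows_comb : comb_rows R.
Proof.
have [s1 [l2 l1]] := rtop_last; split=> //.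
- by move=> i iR; rewrite /rsz rlev_rows.
- by rewrite rowsE; apply: sort_sorted; apply: row_le_total.
- by rewrite l1 l2.
- move=> i j iR jR; have [x xi] := blocks_ne (nth_blockP iR).
  have [y yj] := blocks_ne (nth_blockP jR).
  rewrite -(block_index_nth iR xi) -(block_index_nth jR yj).
  have [xA _] := blocks_block (nth_blockP iR) xi.
  have [yA _] := blocks_block (nth_blockP jR) yj.
  rewrite !rtop_block_index // !card_nth_block // => lt.
  have n : ~~ near d v x y.
    by apply: contraL lt => /(exit_near dU xA yA) ->; rewrite ltnn.
  by have [_] := comb_pair comb_depth_comb xA yA n; apply.
- move=> i j k iR jR kj; apply: leq_ltn_trans (row_value_above jR kj).
  exact: rtop_rows_le.
Qed.

Lemma d_far x y : x \in A -> y \in A -> ~~ near d v x y ->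
  d x y = minn (rtop R (block_index x)) (rtop R (block_index y)).
Proof.
move=> xA yA n; rewrite !rtop_block_index //.
by have [] := comb_pair comb_depth_comb xA yA n.
Qed.

Lemma word_level w : (w \in word R) = level d A w.
Proof.
have RP := rows_comb; apply/(mem_word RP)/levelP => [[[i k] /andP[/= iR ks] <-]|].
  have BP := nth_blockP iR; case: k ks => [|k] ks.
    rewrite /entry /= -/(rtop R i) rtop_rows //.
    have [x xB] := blocks_ne BP; have [xA _] := blocks_block BP xB.
    have [y yA n] := exists_far xA; have [z [zA nz e]] := exit_attained yA n.
    by exists x, z; rewrite (block_exitE BP xB); split=> //; apply: far_neq nz.
  have : entry R (i, k.+1) \in (F d (nth_block i)).2.
    by rewrite entry_rows // mem_nth //; move: ks; rewrite /rsz rlev_rows.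
  rewrite (code_level (block_good BP)); last exact: block_ultrametric.
  case/levelP=> x [y [xB yB xy e]]; exists x, y; split=> //.
    exact: (blocks_block BP xB).1.
  exact: (blocks_block BP yB).1.
case=> x [y [xA yA xy <-]]; case: (boolP (near d v x y)) => n; last first.
  rewrite d_far // /minn; case: ifP => _; [exists (block_index x, 0) | exists (block_index y, 0)] => //.
    by rewrite /full_cell /= block_index_lt //= comb_ne // block_index_lt.
  by rewrite /full_cell /= block_index_lt //= comb_ne // block_index_lt.
have xR := block_index_lt xA; have BP := nth_blockP xR.
have : d x y \in (F d (nth_block (block_index x))).2.
  rewrite (code_level (block_good BP)); last exact: block_ultrametric.
  by apply: level_d => //; rewrite nth_block_index // mem_block ?xA ?yA ?nearxx.
case/(nthP 0)=> k ks e; exists (block_index x, k.+1); last by rewrite entry_rows.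
by rewrite /full_cell /= xR /rsz rlev_rows.
Qed.

Lemma size_word_rows : size (word R) = #|A|.-1.
Proof.
apply: succn_inj; rewrite prednK; last exact: ltnW A1.
rewrite (size_wordS rows_comb) (card_partition (partition_blocks v)).
rewrite -[RHS]big_enum (perm_big PB) /=; last first.
  by apply: uniq_perm; rewrite ?uniq_sorted_blocks ?enum_uniq // => B; rewrite mem_sorted_blocks mem_enum.
rewrite (big_nth set0) -size_rows big_mkord; apply: eq_bigr => i _.
exact: rsz_rows.
Qed.

End WithCode.
End Blocks.
End Codes.

(** * Isomorphism invariance and completeness of the rows *)

Section Isomorphism.
Variables (T : finType) (c : T -> nat).
Variable F : (T -> T -> nat) -> {set T} -> nat * seq nat.

Section Transport.
Variables (A A' : {set T}) (d d' : T -> T -> nat) (f : T -> T).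
Hypotheses (fI : {in A &, injective f}) (fA : f @: A = A').
Hypothesis fd : {in A &, forall x y, x != y -> d' (f x) (f y) = d x y}.

Lemma f_in x : x \in A -> f x \in A'.
Proof. by rewrite -fA; apply: imset_f. Qed.

Lemma near_transport v x y : x \in A -> y \in A -> near d' v (f x) (f y) = near d v x y.
Proof.
move=> xA yA; rewrite /near (inj_in_eq fI) //; case: (eqVneq x y) => //= xy.
by rewrite fd.
Qed.

Lemma level_transport v : level d' A' v = level d A v.
Proof.
apply/levelP/levelP => [[x' [y' []]]|[x [y [xA yA xy <-]]]]; last first.
  by exists (f x), (f y); rewrite !f_in // (inj_in_eq fI) // fd.
rewrite -fA => /imsetP[x xA ->] /imsetP[y yA ->]; rewrite (inj_in_eq fI) // => xy.
by rewrite fd // => e; exists x, y.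
Qed.

Lemma exit_transport v x : x \in A -> exit d' v A' (f x) = exit d v A x.
Proof.
move=> xA; rewrite /exit big_mkcondr /= -fA big_imset //= [RHS]big_mkcondr /=.
apply: eq_bigr => y yA; rewrite near_transport //.
by case: ifP => // n; rewrite fd // (far_neq n).
Qed.

Lemma block_transport v x : x \in A -> block d' v A' (f x) = f @: block d v A x.
Proof.
move=> xA; apply/setP=> y'; rewrite mem_block; apply/andP/imsetP => [[]|[y]].
  rewrite -fA => /imsetP[y yA ->]; rewrite near_transport // => n.
  by exists y; rewrite ?mem_block ?yA.
by rewrite mem_block => /andP[yA n] ->; rewrite f_in // near_transport.
Qed.

Lemma block_sub d0 v (A0 : {set T}) x : block d0 v A0 x \subset A0.
Proof. by apply/subsetP=> y; rewrite mem_block => /andP[]. Qed.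

Lemma card_imset_sub (B : {set T}) : B \subset A -> #|f @: B| = #|B|.
Proof.
by move=> /subsetP BA; apply: card_in_imset => x y /BA xA /BA yA; apply: fI.
Qed.

Lemma comb_transport v : comb d' v A' = comb d v A.
Proof.
have key x y : x \in A -> y \in A ->
    (d' (f x) (f y) = minn (exit d' v A' (f x)) (exit d' v A' (f y)) /\
     (exit d' v A' (f x) < exit d' v A' (f y) ->
        #|block d' v A' (f x)| <= #|block d' v A' (f y)|)) = 
    (d' (f x) (f y) = minn (exit d v A x) (exit d v A y) /\
     (exit d v A x < exit d v A y -> #|block d v A x| <= #|block d v A y|)).
  by move=> xA yA; rewrite !exit_transport // !block_transport // !card_imset_sub ?block_sub.
apply/combP/combP => H x y.
  move=> xA yA n; have := H (f x) (f y) (f_in xA) (f_in yA).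
  by rewrite near_transport // key // fd // ?(far_neq n) //; apply.
rewrite -fA => /imsetP[u uA ->] /imsetP[w wA ->]; rewrite near_transport // fA key // => n.
by rewrite fd // ?(far_neq n) //; apply: H.
Qed.

Lemma blocks_transport v : blocks d' v A' = [set f @: (B : {set T}) | B in blocks d v A].
Proof.
apply/setP=> B'; apply/mem_blocks/imsetP => [[x']|[B /mem_blocks[x xA ->] ->]].
  rewrite -{1}fA => /imsetP[x xA ->] ->; exists (block d v A x).
    exact: block_in_blocks.
  exact: block_transport.
by exists (f x); rewrite ?f_in ?block_transport.
Qed.

Lemma comb_depth_transport : ultrametric A d -> ultrametric A' d' -> 1 < #|A| ->
  comb_depth d' A' = comb_depth d A.
Proof.
move=> dU dU' A1; have [l co m] := comb_depth_spec dU A1.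
apply: comb_depth_eq => //; rewrite ?level_transport ?comb_transport // => w.
by rewrite level_transport comb_transport; apply: m.
Qed.

Lemma isomorphic_sub (B : {set T}) : {in A, forall x, c (f x) = c x} ->
  B \subset A -> isomorphic c d B d' (f @: B).
Proof.
move=> fc /subsetP BA; exists f; split=> //.
- by move=> x y /BA xA /BA yA; apply: fI.
- by move=> x /BA; apply: fc.
- by move=> x y /BA xA /BA yA; apply: fd.
Qed.

(** [row_le] is antisymmetric, so equal multisets of rows sort to the same list, however the blocks
    are enumerated. *)
Lemma rows_transport : ultrametric A d -> ultrametric A' d' -> 1 < #|A| ->
  (forall B, B \in blocks d (comb_depth d A) A -> F d B = F d' (f @: B)) ->
  rows F d A = rows F d' A'.
Proof.
move=> dU dU' A1 FE; rewrite !rowsE comb_depth_transport //.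
set v := comb_depth d A in FE *.
apply/(perm_sortP row_le_total row_le_trans row_le_anti).
rewrite perm_sym; set P := blocks d v A in FE *.
have BA B : B \in P -> B \subset A by apply: blocks_sub.
have gI : {in P &, injective (fun B : {set T} => f @: B)}.
  move=> B B' BP BP' e.
  have [x xB] := blocks_ne BP.
  have : f x \in f @: B' by rewrite -e imset_f.
  case/imsetP=> y yB' /(fI (subsetP (BA _ BP) _ xB) (subsetP (BA _ BP') _ yB')) xy.
  by apply: (blocks_eq dU BP BP' xB); rewrite xy.
have : perm_eq (enum (blocks d' v A')) [seq f @: (B : {set T}) | B <- enum P].
  apply: uniq_perm; first exact: enum_uniq.
    by rewrite map_inj_in_uniq ?enum_uniq // => B B'; rewrite !mem_enum; apply: gI.
  move=> B'; rewrite mem_enum blocks_transport.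
  by apply/imsetP/mapP=> -[B BP ->]; exists B; rewrite ?mem_enum // in BP *.
move/(perm_map (block_row F d' v A')) => pe; rewrite (perm_trans pe) //.
rewrite -map_comp; suff -> : [seq block_row F d v A B | B <- enum P] =
  [seq ((block_row F d' v A') \o (fun B : {set T} => f @: B)) B | B <- enum P] by [].
apply/eq_in_map=> B; rewrite mem_enum => BP /=.
rewrite /block_row FE //; congr (_, _ :: _).
have [x xB] := blocks_ne BP; have xA := subsetP (BA _ BP) _ xB.
rewrite (block_exitE dU BP xB) (block_exitE dU' (x := f x)) ?exit_transport ?imset_f //.
by rewrite blocks_transport; apply: imset_f.
Qed.

End Transport.

(** Equal rows pair off the blocks. The isomorphisms of paired blocks are glued together, and on
    both sides points of different blocks are at the minimum of their exit levels, which the rows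
    record. *)
Lemma rows_complete (A A' : {set T}) (d d' : T -> T -> nat) : ultrametric A d -> ultrametric A' d' ->
  1 < #|A| -> #|A| = #|A'| ->
  (forall B : {set T}, #|B| < #|A| -> good_code c F B) ->
  rows F d A = rows F d' A' -> isomorphic c d A d' A'.
Proof.
move=> dU dU' A1 AA' FG RR'.
have A1' : 1 < #|A'| by rewrite -AA'.
have FG' (B : {set T}) : #|B| < #|A'| -> good_code c F B by rewrite -AA'; apply: FG.
set R := rows F d A in RR'; set v := comb_depth d A; set v' := comb_depth d' A'.
pose blk := nth_block A d F; pose blk' := nth_block A' d' F.
pose Q i (h : T -> T) := [/\ {in blk i &, injective h}, h @: blk i = blk' i,
    {in blk i, forall x, c (h x) = c x}
  & {in blk i &, forall x y, x != y -> d' (h x) (h y) = d x y}].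
have [g gP] : exists g : nat -> T -> T, forall i, i < size R -> Q i (g i).
  apply: (finite_choice id) => i iR.
  have iR' : i < size (rows F d' A') by rewrite -RR'.
  have BP := nth_blockP iR; have BP' := nth_blockP iR'.
  apply: (code_complete (FG _ (blocks_card dU A1 BP))).
  - exact: (block_ultrametric dU BP).
  - exact: (block_ultrametric dU' BP').
  - by rewrite -(rsz_rows dU A1 FG) // -(rsz_rows dU' A1' FG') // -/R RR'.
  - have := nth_rows iR; rewrite -/R {1}RR' nth_rows // => -[e1 _ e2].
    by rewrite [LHS]surjective_pairing [RHS]surjective_pairing -e1 -e2.
pose bi := block_index A d F.
have biR x : x \in A -> bi x < size R by move=> xA; apply: block_index_lt.
have xbi x : x \in A -> x \in blk (bi x).
  by move=> xA; rewrite /blk nth_block_index // self_block.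
pose f x := g (bi x) x.
have fblk x : x \in A -> f x \in blk' (bi x).
  move=> xA; have [_ <- _ _] := gP _ (biR x xA).
  by apply: imset_f; apply: xbi.
have iR' i : i < size R -> i < size (rows F d' A') by rewrite -RR'.
have fA x : x \in A -> f x \in A'.
  move=> xA; apply: (subsetP (blocks_sub dU' (nth_blockP (iR' _ (biR x xA))))).
  exact: fblk.
have bif x : x \in A -> block_index A' d' F (f x) = bi x.
  by move=> xA; apply: (block_index_nth dU'); [apply/iR'/biR | apply: fblk].
have fI : {in A &, injective f}.
  move=> x y xA yA e; have exy : bi x = bi y by rewrite -!bif // e.
  have [gI _ _ _] := gP _ (biR x xA); apply: gI; rewrite ?xbi //.
    by rewrite exy xbi.
  by move: e; rewrite /f exy.
exists f; split=> //.
- apply/eqP; rewrite eqEcard card_in_imset // AA' leqnn andbT.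
  by apply/subsetP=> _ /imsetP[x xA ->]; apply: fA.
- by move=> x xA; have [_ _ gc _] := gP _ (biR x xA); apply: gc; apply: xbi.
- move=> x y xA yA xy; case: (boolP (near d v x y)) => n.
    have exy : bi x = bi y by apply/eqP; rewrite -(near_block_index dU).
    have [_ _ _ gd] := gP _ (biR x xA); rewrite /f -exy gd ?xbi //.
    by rewrite exy xbi.
  have n' : ~~ near d' v' (f x) (f y).
    by rewrite (near_block_index dU' F) ?fA // !bif // -(near_block_index dU).
  rewrite (d_far dU A1 F xA yA n) (d_far dU' A1' F _ _ n') ?fA // -RR' !bif //.
Qed.

End Isomorphism.

(** * Merging levels of an ultrametric *)

Section Relabelling.
Variables (T : finType) (c : T -> nat).
Variable F : (T -> T -> nat) -> {set T} -> nat * seq nat.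
Variables (A : {set T}) (d : T -> T -> nat).
Hypotheses (dU : ultrametric A d) (A1 : 1 < #|A|).
Hypothesis FG : forall B : {set T}, #|B| < #|A| -> good_code c F B.

Let R := rows F d A.
Let v := comb_depth d A.
Let RP : comb_rows R := rows_comb dU A1 FG.

Lemma level_entry x y : x \in A -> y \in A -> x != y -> near d v x y ->
  exists k, k.+1 < rsz R (block_index A d F x) /\
    entry R (block_index A d F x, k.+1) = d x y.
Proof.
move=> xA yA xy n; have xR := block_index_lt d F xA; have BP := nth_blockP xR.
have : d x y \in (F d (nth_block A d F (block_index A d F x))).2.
  rewrite (code_level (block_good dU A1 FG BP)); last exact: (block_ultrametric dU BP).
  by apply: level_d => //; rewrite nth_block_index // mem_block ?xA ?yA ?nearxx.
case/(nthP 0)=> k ks e; exists k; rewrite entry_rows //; split=> //.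
by rewrite /rsz rlev_rows.
Qed.

Lemma last_entry : full_cell R ((size R).-1, 0) /\ entry R ((size R).-1, 0) = v.
Proof.
have l := lt_lst RP; have [_ [_ e]] := rtop_last dU A1 F.
by rewrite /full_cell /= l (comb_ne RP).
Qed.

Variable phi : nat -> nat.
Hypotheses (phiM : {homo phi : x y / x <= y}) (cp : compatible phi (word R)).

Let dQ x y := phi (d x y).

(** Inner cells are read before exit cells, so [d x y] forms a descent with the level [v] of the
    last exit cell. *)
Lemma relabel_above x y : x \in A -> y \in A -> x != y -> v < d x y -> phi v < phi (d x y).
Proof.
move=> xA yA xy lt; have n : near d v x y by rewrite near_lt.
have [k [ks e]] := level_entry xA yA xy n; have [lf le] := last_entry.
have := @compatible_full R RP phi cp (block_index A d F x, k.+1) ((size R).-1, 0).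
by rewrite le e; apply=> //; rewrite /full_cell /= block_index_lt.
Qed.

Lemma near_relabel x y : x \in A -> y \in A -> near dQ (phi v) x y = near d v x y.
Proof.
move=> xA yA; rewrite /near; case: eqVneq => //= xy; apply/idP/idP; last exact: relabel_above.
by apply: contraTT; rewrite -!leqNgt => /phiM.
Qed.

Lemma exit_relabel x : x \in A -> exit dQ (phi v) A x = phi (exit d v A x).
Proof.
move=> xA; have [y yA n] := exists_far dU A1 xA; have [z [zA nz e]] := exit_attained yA n.
apply/eqP; rewrite eqn_leq; apply/andP; split.
  apply/bigmax_leqP=> w /andP[wA]; rewrite near_relabel // => nw.
  by apply: phiM; apply: exit_ub.
by rewrite e; apply: (@exit_ub _ dQ) => //; rewrite near_relabel.
Qed.

Lemma block_relabel x : x \in A -> block dQ (phi v) A x = block d v A x.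
Proof.
move=> xA; apply/setP=> y; rewrite !mem_block.
by case: (boolP (y \in A)) => //= yA; rewrite near_relabel.
Qed.

Lemma blocks_relabel : blocks dQ (phi v) A = blocks d v A.
Proof.
apply/setP=> B; apply/mem_blocks/mem_blocks => -[x xA ->]; exists x => //.
  exact: block_relabel.
by rewrite block_relabel.
Qed.

(** If the relabelled ultrametric had a deeper comb, [comb_extend] would make [d] a comb at the
    level following [v]. *)
Lemma comb_depth_relabel : comb_depth dQ A = phi v.
Proof.
have [lv cv mv] := comb_depth_spec dU A1.
apply: comb_depth_eq.
- exact: ultrametric_relabel.
- by case/levelP: lv => x [y [xA yA xy e]]; apply/levelP; exists x, y; rewrite /dQ e.
- apply/combP=> x y xA yA; rewrite near_relabel // => n.
  have [e s] := comb_pair cv xA yA n; rewrite !exit_relabel // !block_relabel //.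
  split; last first.
    by move=> lt; apply: s; rewrite ltnNge; apply: contraTN lt => /phiM; rewrite -leqNgt.
  rewrite /dQ e; case: (leqP (exit d v A x) (exit d v A y)) => [/phiM /minn_idPl ->//|].
  by move/ltnW/phiM/minn_idPr.
move=> w /levelP[x [y [xA yA xy <-]]] cw; rewrite leqNgt; apply/negP=> lt.
have vlt : v < d x y.
  by rewrite ltnNge; apply: contraTN lt => /phiM; rewrite -leqNgt.
have ex : exists u, level d A u && (v < u) by exists (d x y); rewrite level_d.
case: (ex_minnP ex) => v1 /andP[lv1 vv1] m1.
have := mv v1 lv1; rewrite leqNgt vv1; case/(_ _)/negP=> //.
apply: (comb_extend dU (phi := phi) (th := v) (w := phi (d x y))) => //.
- by move=> u lu vu; apply: m1; rewrite lu.
- case/levelP: lv1 vv1 => x1 [y1 [x1A y1A xy1 <-]]; exact: relabel_above.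
- by apply/phiM/m1; rewrite level_d.
Qed.

(** Labels of the inner cells of one row increase with the column, so the word of a block is a
    subsequence of the whole word. *)
Lemma compatible_block i : i < size R -> compatible phi (F d (nth_block A d F i)).2.
Proof.
move=> iR p q /andP[pq qs] lt.
have qs' : q.+1 < rsz R i by rewrite /rsz rlev_rows.
have := @compatible_full R RP phi cp (i, p.+1) (i, q.+1).
rewrite !entry_rows //; apply=> //; rewrite /full_cell /= ?iR //; first by lia.
by rewrite !label_cons /= !lexlt_cons !ltnn !eqxx /= ltnS pq.
Qed.

Lemma rows_relabel : rows F dQ A = relabel_rows phi R.
Proof.
have row_eq B : B \in blocks d v A -> block_row F dQ (phi v) A B =
    ((block_row F d v A B).1, map phi (block_row F d v A B).2).
  move=> BP; have [x xB] := blocks_ne BP; have [xA BE] := blocks_block dU BP xB.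
  have xR := block_index_lt d F xA.
  have nb : nth_block A d F (block_index A d F x) = B by rewrite nth_block_index.
  rewrite /block_row /=; have -> : F dQ B = ((F d B).1, map phi (F d B).2).
    apply: (code_relabel (block_good dU A1 FG BP)) => //; first exact: block_ultrametric BP.
    by rewrite -nb; apply: compatible_block.
  congr (_, _ :: _); rewrite (block_exitE dU BP xB).
  rewrite (block_exitE (ultrametric_relabel phiM dU) (x := x)) ?exit_relabel //.
  by rewrite blocks_relabel.
rewrite rowsE comb_depth_relabel blocks_relabel.
apply: (sorted_eq row_le_trans row_le_anti); rewrite ?sort_sorted //.
- exact: row_le_total.
- exact: sorted_relabel.
rewrite perm_sort /R rowsE /relabel_rows.
have -> : [seq block_row F dQ (phi v) A B | B <- enum (blocks d v A)] =
   [seq (r.1, map phi r.2) | r <- [seq block_row F d v A B | B <- enum (blocks d v A)]].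
  by rewrite -map_comp; apply/eq_in_map=> B; rewrite mem_enum => /row_eq.
by apply: perm_map; rewrite perm_sym perm_sort.
Qed.

End Relabelling.

Lemma pattern_relabel (y b : seq nat) : uniq y -> size y = size b -> same_pattern y b ->
  (* [phi] is the least monotone map whose value at each letter of [y] is at least the corresponding
     letter of [b]; the pattern turns these bounds into equalities. *)
  exists2 phi, {homo phi : i j / i <= j} & map phi y = b.
Proof.
move=> yU sz pat; pose phi w := \max_(k < size b | nth 0 y k <= w) nth 0 b k.
exists phi => [i j ij|].
  apply/bigmax_leqP=> k yk.
  by apply: (@leq_bigmax_cond _ _ (fun k : 'I_(size b) => nth 0 b k)); apply: leq_trans ij.
apply: (@eq_from_nth _ 0); rewrite ?size_map // => k; rewrite sz => ks.
rewrite (nth_map 0) ?sz //; apply/eqP; rewrite eqn_leq; apply/andP; split; last first.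
  exact: (@leq_bigmax_cond _ _ (fun k : 'I_(size b) => nth 0 b k) (Ordinal ks)).
apply/bigmax_leqP=> l yl; case: (ltngtP l k) => [lk|kl|->//].
  rewrite -pat ?lk // ltn_neqAle yl andbT nth_uniq ?sz //.
  by rewrite neq_ltn lk.
by apply/ltnW; rewrite ltnNge -pat ?kl ?ltn_ord // -leqNgt.
Qed.

Lemma top_geE (T : finType) (A : {set T}) (d : T -> T -> nat) v m :
  {in A &, forall x y, x != y -> v <= d x y} -> level d A v ->
  top_ge d A m = [forall x in A, m <= #|block d v A x|].
Proof.
move=> vm /levelP[x0 [y0 [xA0 yA0 xy0 e0]]]; apply: eq_forallb_in => x xA.
congr (_ <= #|pred_of_set _|); apply/setP=> z; rewrite !inE /near.
case: (boolP (z \in A)) => //= zA; case: eqVneq => //= xz.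
apply/exists_inP/idP => [[u uA /exists_inP[w wA /andP[uw lt]]]|lt].
  by apply: leq_ltn_trans lt; apply: vm.
by exists x0 => //; apply/exists_inP; exists y0; rewrite // xy0 e0.
Qed.

(** * Breaking the ties of an ultrametric *)

Section Spreading.
Variables (T : finType) (c : T -> nat).
Variable F : (T -> T -> nat) -> {set T} -> nat * seq nat.
Variables (A : {set T}) (d : T -> T -> nat).
Hypotheses (dU : ultrametric A d) (A1 : 1 < #|A|).
Hypothesis FG : forall B : {set T}, #|B| < #|A| -> good_code c F B.

Let R := rows F d A.
Let v := comb_depth d A.
Let RP : comb_rows R := rows_comb dU A1 FG.
Let blk := nth_block A d F.
Let bi := block_index A d F.

Variable y : seq nat.
Hypotheses (yU : uniq y) (ysz : size y = size (word R)) (yR : same_pattern y (word R)).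

Let S := spread_rows R y.
Let SP : comb_rows S := spread_comb RP yU ysz yR.

Variable e : nat -> T -> T -> nat.
Hypothesis eP : forall i, i < size R ->
  [/\ ultrametric (blk i) (e i), F (e i) (blk i) = ((F d (blk i)).1, drop 1 (rlev S i)) &
    forall phi, map phi (drop 1 (rlev S i)) = (F d (blk i)).2 ->
      {in blk i &, forall x z, x != z -> phi (e i x z) = d x z}].

(** The comb whose exit levels are read off [S] and whose blocks carry the standardised ultrametrics
    [e]. *)
Definition spread_metric x z :=
  if bi x == bi z then e (bi x) x z else minn (rtop S (bi x)) (rtop S (bi z)).

Local Notation d' := spread_metric.
Let v' := rtop S (size R).-1.

Let biR x : x \in A -> bi x < size R. Proof. exact: block_index_lt. Qed.

Let biS x : x \in A -> bi x < size S. Proof. by rewrite size_spread; exact: biR. Qed.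

Let xbi x : x \in A -> x \in blk (bi x).
Proof. by move=> xA; rewrite /blk nth_block_index // self_block. Qed.

Let in_blk x z : x \in A -> bi z = bi x -> z \in A -> z \in blk (bi x).
Proof. by move=> xA <- zA; apply: xbi. Qed.

Let rtop_le i : i < size R -> rtop S i <= v'.
Proof.
move=> iR; apply: (rtop_leq SP); have l := lt_lst RP.
by rewrite size_spread l andbT -ltnS prednK // (leq_ltn_trans _ iR).
Qed.

Let rtop_twin : rtop S (size R).-2 = v'.
Proof. by have := comb_last SP; rewrite size_spread. Qed.

Let inner x z : x \in A -> z \in A -> x != z -> bi x = bi z ->
  exists2 k, k.+1 < rsz R (bi x) & entry S (bi x, k.+1) = d' x z.
Proof.
move=> xA zA xz b; have [eU Fe _] := eP (biR xA); rewrite /d' -b eqxx.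
have BP := nth_blockP (biR xA).
have : e (bi x) x z \in (F (e (bi x)) (blk (bi x))).2.
  rewrite (code_level (block_good dU A1 FG BP)) //; apply: level_d => //; first exact: xbi.
  exact: in_blk.
rewrite Fe /= => /(nthP 0)[k]; rewrite size_spread_row ?biR // => ks <-.
by exists k; [rewrite -ltn_predRL | rewrite nth_drop].
Qed.

Let inner_gt x z i : x \in A -> z \in A -> x != z -> bi x = bi z -> i < size R ->
  rtop S i < d' x z.
Proof.
move=> xA zA xz b iR; have [k ks <-] := inner xA zA xz b.
by apply: (comb_above SP); rewrite ?size_spread ?biR // rsz_spread.
Qed.

Let lst_lt : (size R).-1 < size R. Proof. exact: lt_lst RP. Qed.

Let near_spread x z : x \in A -> z \in A -> near d' v' x z = (bi x == bi z).
Proof.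
move=> xA zA; rewrite /near; case: eqVneq => [->|xz] /=; first by rewrite eqxx.
case: eqVneq => [b|nb]; first exact: inner_gt lst_lt.
apply/negbTE; rewrite -leqNgt /d' (negPf nb) geq_min.
by rewrite rtop_le ?biR.
Qed.

Let far_metric x z : bi x != bi z -> d' x z = minn (rtop S (bi x)) (rtop S (bi z)).
Proof. by rewrite /d' => /negPf->. Qed.

Lemma spread_ultrametric : ultrametric A d'.
Proof.
split=> [x z xA zA|x w z xA wA zA xz].
  case: (eqVneq (bi x) (bi z)) => b; last first.
    by rewrite !far_metric // 1?eq_sym // minnC.
  have [[eS _] _ _] := eP (biR xA).
  by rewrite /d' b eqxx -b; apply: eS; rewrite ?xbi ?in_blk.
case: (eqVneq (bi x) (bi z)) => b.
  case: (eqVneq (bi w) (bi x)) => bw; last first.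
    apply: ltnW; apply: leq_ltn_trans (inner_gt xA zA xz b (biR xA)).
    by rewrite far_metric 1?eq_sym // !geq_min leqnn.
  have [[_ eT] _ _] := eP (biR xA).
  by rewrite /d' bw b eqxx -b; apply: eT; rewrite ?xbi ?in_blk.
rewrite (far_metric b); case: (eqVneq (bi w) (bi x)) => bw.
  by rewrite [d' w z]far_metric bw // geq_minr.
case: (eqVneq (bi w) (bi z)) => bw'.
  by rewrite [d' x w]far_metric bw' // geq_minl.
by rewrite [d' x w]far_metric 1?eq_sym // [d' w z]far_metric //; lia.
Qed.

Let dU' := spread_ultrametric.

Let block_spread x : x \in A -> block d' v' A x = block d v A x.
Proof.
move=> xA; apply/setP=> z; rewrite !mem_block; case: (boolP (z \in A)) => //= zA.
by rewrite near_spread // -near_block_index.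
Qed.

Lemma blocks_spread : blocks d' v' A = blocks d v A.
Proof.
apply/setP=> B; apply/mem_blocks/mem_blocks => -[x xA ->]; exists x => //.
  exact: block_spread.
by rewrite block_spread.
Qed.

Let blk_in i : i < size R -> exists x, [/\ x \in A, x \in blk i & bi x = i].
Proof.
move=> iR; have BP := nth_blockP iR; have [x xB] := blocks_ne BP.
by exists x; rewrite xB (blocks_block dU BP xB).1 /bi (block_index_nth dU iR xB).
Qed.

Lemma exit_spread x : x \in A -> exit d' v' A x = rtop S (bi x).
Proof.
move=> xA; apply/eqP; rewrite eqn_leq; apply/andP; split.
  apply/bigmax_leqP=> z /andP[zA]; rewrite near_spread // => b.
  by rewrite far_metric // geq_minl.
have [i [iR ti nb]] : exists i, [/\ i < size R, rtop S i = v' & bi x != i].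
  have l1 := lt_lst RP; have l2 := lt_twin RP.
  case: (eqVneq (bi x) (size R).-1) => [->|nb]; last by exists (size R).-1.
  by exists (size R).-2; rewrite rtop_twin (ltn_trans l2 l1) neq_ltn l2 orbT.
have [z [zA _ bz]] := blk_in iR.
have n : ~~ near d' v' x z by rewrite near_spread // bz.
apply: leq_trans (exit_ub zA n); rewrite far_metric ?bz // ti leq_min leqnn.
by rewrite rtop_le ?biR.
Qed.

Lemma card_block_spread x : x \in A -> #|block d' v' A x| = rsz S (bi x).
Proof.
by move=> xA; rewrite block_spread // rsz_spread (card_nth_block dU A1 FG).
Qed.

Lemma spread_depth_comb : comb d' v' A.
Proof.
apply/combP=> x z xA zA; rewrite near_spread // => nb.
rewrite !exit_spread // !card_block_spread // far_metric //; split=> //.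
by apply: (comb_mono SP); rewrite ?biS.
Qed.

Lemma spread_depth_level : level d' A v'.
Proof.
have l1 := lt_lst RP; have l2 := lt_twin RP.
have [x [xA _ bx]] := blk_in l1; have [z [zA _ bz]] := blk_in (ltn_trans l2 l1).
have nb : bi x != bi z by rewrite bx bz neq_ltn l2 orbT.
apply/levelP; exists x, z; rewrite far_metric // bx bz rtop_twin minnn; split=> //.
by apply: contra_neq nb => ->.
Qed.

Section Collapse.
Variable phi : nat -> nat.
Hypothesis phiy : map phi y = word R.

Let phi_entry p : p \in cells R -> phi (spread_entry R y p) = entry R p.
Proof.
move=> pC; rewrite spread_entryE // -(nth_word pC) -phiy (nth_map 0) //.
by rewrite ysz index_cell_size.
Qed.

Let phi_rtop i : i < size R -> phi (rtop S i) = rtop R i.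
Proof.
move=> iR; rewrite rtop_spread //; case: (eqVneq i (size R).-1) => [->|ni].
  by rewrite spread_last phi_entry ?twin_cell // -(comb_last RP).
rewrite phi_entry // mem_cells /= iR (comb_ne RP) //=.
by apply: contra_neq ni => -[].
Qed.

Let rtop_collapse i j : i < size R -> j < size R ->
  rtop S i <= rtop S j -> rtop R i <= rtop R j.
Proof.
have [k kP] : exists k : nat -> nat, forall i, i < size R ->
    [/\ (k i, 0) \in cells R, rtop S i = spread_entry R y (k i, 0) & rtop R i = entry R (k i, 0)].
  exists (fun i => if i == (size R).-1 then (size R).-2 else i) => {}i iR.
  rewrite rtop_spread //; case: eqVneq => [->|ni].
    by rewrite spread_last twin_cell // -(comb_last RP).
  rewrite mem_cells /= iR (comb_ne RP) //=; split=> //.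
  by apply: contra_neq ni => -[].
move=> iR jR; have [ci -> ->] := kP i iR; have [cj -> ->] := kP j jR.
rewrite leqNgt (spread_lt yU ysz yR) // negb_or -leqNgt => /andP[//].
Qed.

Lemma spread_collapse : {in A &, forall x z, x != z -> phi (d' x z) = d x z}.
Proof.
move=> x z xA zA xz; case: (eqVneq (bi x) (bi z)) => b.
  rewrite /d' -b eqxx; have [_ _ H] := eP (biR xA); apply: H; rewrite ?xbi ?in_blk //.
  have := rlev_rows (biR xA); rewrite -/R -/blk => rE.
  have -> : (F d (blk (bi x))).2 = drop 1 (rlev R (bi x)) by rewrite rE /= drop0.
  apply: (@eq_from_nth _ 0).
    by rewrite size_map size_spread_row ?biR // size_drop subn1.
  move=> k; rewrite size_map => ks; rewrite (nth_map 0) //.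
  move: ks; rewrite size_spread_row ?biR // => ks.
  have ck : (bi x, k.+1) \in cells R by rewrite row_cell ?biR.
  rewrite nth_spread_row ?biR //; have -> := phi_entry ck; by rewrite nth_drop.
rewrite far_metric // (d_far dU A1 F xA zA) -/bi; last by rewrite (near_block_index dU F).
case: (leqP (rtop S (bi x)) (rtop S (bi z))) => [le|/ltnW le].
  rewrite phi_rtop ?biR //; apply/esym/minn_idPl; apply: rtop_collapse; rewrite ?biR //.
rewrite phi_rtop ?biR //; apply/esym/minn_idPr; apply: rtop_collapse; rewrite ?biR //.
Qed.

End Collapse.

Lemma spread_block i : i < size R ->
  F d' (blk i) = ((F d (blk i)).1, drop 1 (rlev S i)).
Proof.
move=> iR; have [eU <- _] := eP iR; have BP := nth_blockP iR.
have BA := subsetP (blocks_sub dU BP).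
have Bi x : x \in blk i -> bi x = i by apply: (block_index_nth dU).
apply: (code_iso (block_good dU A1 FG BP)) => //.
  by apply: ultrametric_sub dU'; apply/subsetP.
exists id; split=> //; first exact: imset_id.
by move=> x z xB zB _; rewrite /d' !Bi // eqxx.
Qed.

(** Breaking ties must not lengthen the comb. A comb of [d'] past [v'] is first cut back to the next
    level [v1'], which lies in a single block [i0] because the letters of [y] are distinct. Merging
    back by [phi] then makes [d] a comb at [v1], above its depth [v]. *)
Lemma spread_max w : level d' A w -> comb d' w A -> w <= v'.
Proof.
move=> lw cw; rewrite leqNgt; apply/negP=> vw.
have ex : exists u, level d' A u && (v' < u) by exists w; rewrite lw.
case: (ex_minnP ex) => v1' /andP[lv1' vv1'] m1' {ex}.
have min1' u : level d' A u -> v' < u -> v1' <= u by move=> lu vu; apply: m1'; rewrite lu.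
have cv1' : comb d' v1' A.
  apply: (comb_extend dU' (phi := id) (th := v') (w := w)) => //; first exact: spread_depth_comb.
  exact: min1'.
have [phi phiM phiy] := pattern_relabel yU ysz yR.
have dE := spread_collapse phiy; set v1 := phi v1'.
case/levelP: lv1' => x1 [z1 [x1A z1A xz1 e1]].
have b1 : bi x1 = bi z1 by apply/eqP; rewrite -near_spread // near_lt // e1.
set i0 := bi x1 in b1; have i0R : i0 < size R by apply: biR.
have ge1' x z : x \in A -> z \in A -> x != z -> bi x = bi z -> v1' <= d' x z.
  move=> xA zA xz b; apply: min1'; first exact: level_d.
  exact: inner_gt lst_lt.
have [k0 k0s ek0] := inner x1A z1A xz1 b1; rewrite e1 -/i0 in k0s ek0.
have c0 : (i0, k0.+1) \in cells R by rewrite row_cell // ltn_predRL.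
have gt1' x z : x \in A -> z \in A -> x != z -> bi x = bi z -> bi x != i0 -> v1' < d' x z.
  move=> xA zA xz b ni; rewrite ltn_neqAle ge1' // andbT; apply: contra_neq ni => e2.
  have [k ks] := inner xA zA xz b.
  have ck : (bi x, k.+1) \in cells R by rewrite row_cell ?biR // ltn_predRL.
  by rewrite -e2 -ek0 !entry_spread ?cell_full // => /(spread_inj yU ysz ck c0) [].
have BA i x : i < size R -> x \in blk i -> x \in A /\ bi x = i.
  move=> iR xi; have BP := nth_blockP iR.
  by rewrite (blocks_block dU BP xi).1 /bi (block_index_nth dU iR xi).
(* A level that is least inside the block and separates [x1] from [z1] is met at each of its points:
   no [x] can be closer than [u] to both [x1] and [z1]. *)
have ultra_far dd (U : ultrametric A dd) u x : dd x1 z1 = u -> x \in A -> bi x = i0 ->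
    {in A &, forall x z, x != z -> bi x = bi z -> u <= dd x z} ->
    exists2 z, z \in A & [/\ x != z, bi z = i0 & dd x z = u].
  move=> eu xA bx ge; case: (eqVneq x x1) => [->|n1]; first by exists z1; rewrite // -b1.
  case: (eqVneq x z1) => [->|n2].
    by exists x1; rewrite // eq_sym xz1 -eu; split=> //; case: U => ->.
  have [dS dT] := U; have := dT x1 x z1 x1A xA z1A xz1.
  rewrite eu geq_min => /orP[] le; [exists x1 | exists z1] => //; split=> //.
  - by apply/eqP; rewrite eqn_leq dS // le -dS // ge.
  - by apply/eqP; rewrite eqn_leq le ge // bx.
have exit' x : x \in A -> bi x = i0 -> exit d' v1' A x = v1'.
  move=> xA bx; apply/eqP; rewrite eqn_leq exit_le /=.
  have [|z zA [xz bz ez]] := ultra_far d' dU' v1' x e1 xA bx.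
    by move=> ? ? ? ? ? ?; apply: ge1'.
  by rewrite -{1}ez; apply: exit_ub; rewrite // near_lt // ez ltnn.
have eb' x : x \in A -> bi x != i0 ->
    exit d' v' A x = exit d' v1' A x /\ block d' v' A x = block d' v1' A x.
  move=> xA bx; apply: exit_block_eq => //; first exact: ltnW.
  move=> z zA; rewrite near_spread // => /eqP b; rewrite /near; case: eqVneq => //= xz.
  exact: gt1'.
have sizes' x z : x \in A -> z \in A -> bi x != i0 -> bi z = i0 ->
    rsz R (bi x) <= #|block d' v1' A z|.
  move=> xA zA bx bz; have [ex bx'] := eb' x xA bx.
  rewrite -(rsz_spread R y) -card_block_spread // bx'.
  have lt : exit d' v1' A x < exit d' v1' A z.
    by rewrite -ex exit_spread // exit' //; apply: leq_ltn_trans (rtop_le (biR xA)) _.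
  have n : ~~ near d' v1' x z.
    apply: contraTN lt => n; by rewrite (exit_near dU' xA zA n) ltnn.
  by have [_] := comb_pair cv1' xA zA n; apply.
(* The comb at [v1'] bounds the other block by a part of [i0], and that part is proper because [v1']
   cuts [i0]. *)
have lt0 x : x \in A -> bi x != i0 -> rsz R (bi x) < rsz R i0.
  move=> xA bx; apply: leq_ltn_trans (sizes' x x1 xA x1A bx erefl) _.
  rewrite (card_nth_block dU A1 FG x1A) -block_spread //; apply: proper_card.
  apply/properP; split.
    by apply/subsetP=> z; rewrite !mem_block => /andP[-> n]; apply: near_leq n; apply: ltnW.
  exists z1; rewrite !mem_block z1A //=; last by rewrite near_lt // e1 ltnn.
  by rewrite near_spread //= -b1.
have e2 : d x1 z1 = v1 by rewrite -dE // e1.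
have vv1 : v < v1.
  rewrite -e2 -near_lt // (near_block_index dU F) //; exact/eqP.
have ge1 x z : x \in A -> z \in A -> x != z -> bi x = bi z -> v1 <= d x z.
  by move=> xA zA xz b; rewrite -dE //; apply/phiM/ge1'.
have entryS p : p \in cells R -> phi (entry S p) = entry R p.
  move=> pC; rewrite entry_spread ?cell_full // spread_entryE // -(nth_word pC) -phiy.
  by rewrite (nth_map 0) // ysz index_cell_size.
(* At equality the tie would have been broken by the labels in favour of the smaller block, giving
   it a value below [v1']. *)
have gt1 x z : x \in A -> z \in A -> x != z -> bi x = bi z -> bi x != i0 -> v1 < d x z.
  move=> xA zA xz b ni; rewrite ltn_neqAle ge1 // andbT; apply/negP=> /eqP e3.
  have := gt1' x z xA zA xz b ni.
  have [k ks ek] := inner xA zA xz b.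
  have ck : (bi x, k.+1) \in cells R by rewrite row_cell ?biR // ltn_predRL.
  rewrite -ek -ek0 !entry_spread ?cell_full // (spread_lt yU ysz yR) //.
  rewrite -!entryS // ek ek0 dE // -/v1 e3 ltnn eqxx /=.
  by rewrite !label_cons /= !lexlt_cons /=; have := lt0 x xA ni; case: ltngtP.
have [lv cv mv] := comb_depth_spec dU A1.
have exit1 x : x \in A -> bi x = i0 -> exit d v1 A x = v1.
  move=> xA bx; apply/eqP; rewrite eqn_leq exit_le /=.
  have [|z zA [xz bz ez]] := ultra_far d dU v1 x e2 xA bx.
    by move=> ? ? ? ? ? ?; apply: ge1.
  by rewrite -{1}ez; apply: exit_ub; rewrite // near_lt // ez ltnn.
have nb x z : x \in A -> z \in A -> near d v x z = (bi x == bi z).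
  exact: (near_block_index dU F).
have eb x : x \in A -> bi x != i0 ->
    exit d v A x = exit d v1 A x /\ block d v A x = block d v1 A x.
  move=> xA bx; apply: exit_block_eq => //; first exact: ltnW.
  move=> z zA; rewrite nb // => /eqP b; rewrite /near; case: eqVneq => //= xz.
  exact: gt1.
have subblock dd u x : x \in A -> bi x = i0 ->
    (forall z, z \in A -> near dd u x z -> bi x = bi z) ->
    block dd u A x = block dd u (blk i0) x.
  move=> xA bx H; apply/setP=> z; rewrite !mem_block; apply/andP/andP => -[zz n]; split=> //.
    by rewrite -bx in_blk // -(H z).
  by case: (BA _ _ i0R zz).
(* After merging, level [v1] may cut [i0] into more parts than [v1'] did. The tag of [i0] is the
   same for [d] and [d'], and [code_top] transfers the lower bound on all parts. *)
have sizes x z : x \in A -> z \in A -> bi x != i0 -> bi z = i0 ->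
    rsz R (bi x) <= #|block d v1 A z|.
  move=> xA zA bx bz.
  have BP := nth_blockP i0R; have [eU Fe _] := eP i0R.
  have x1B : x1 \in blk i0 by apply: xbi.
  have z1B : z1 \in blk i0 by apply: in_blk.
  have zB : z \in blk i0 by rewrite -bz xbi.
  have c1 : 1 < #|blk i0| by apply/card_gt1P; exists x1, z1.
  have tagE : (F d' (blk i0)).1 = (F d (blk i0)).1 by rewrite spread_block.
  have U' : ultrametric (blk i0) d' by apply: ultrametric_sub dU'; apply: (blocks_sub dU BP).
  have := code_top (block_good dU A1 FG BP) U' (block_ultrametric dU BP) c1 tagE (rsz R (bi x)).
  rewrite (top_geE (v := v1')); last 2 first.
  - move=> x2 z2 /(BA _ _ i0R)[x2A b2] /(BA _ _ i0R)[z2A b2'] xz2.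
    by apply: ge1'; rewrite // b2.
  - by apply/levelP; exists x1, z1.
  rewrite (top_geE (v := v1)); last 2 first.
  - move=> x2 z2 /(BA _ _ i0R)[x2A b2] /(BA _ _ i0R)[z2A b2'] xz2.
    by apply: ge1; rewrite // b2.
  - by apply/levelP; exists x1, z1.
  have -> : [forall z in blk i0, rsz R (bi x) <= #|block d' v1' (blk i0) z|].
    apply/forall_inP=> z2 /(BA _ _ i0R)[z2A b2]; rewrite -subblock ?sizes' //.
    move=> z3 z3A /(near_leq (ltnW vv1')); rewrite near_spread // => /eqP//.
  move/esym/forall_inP/(_ z zB); rewrite -subblock //.
  by move=> z3 z3A /(near_leq (ltnW vv1)); rewrite nb // => /eqP.
have cv1 : comb d v1 A.
  apply/combP=> x z xA zA n.
  have mixed x2 z2 : x2 \in A -> z2 \in A -> bi x2 = i0 -> bi z2 != i0 ->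
      d x2 z2 = minn (exit d v1 A x2) (exit d v1 A z2).
    move=> x2A z2A bx bz; rewrite exit1 // -(eb z2 z2A bz).1.
    have n2 : ~~ near d' v1' x2 z2.
      apply: contra bz => /(near_leq (ltnW vv1')); rewrite near_spread // bx.
      by rewrite eq_sym.
    have xz2 := far_neq n2; have [e3 _] := comb_pair cv1' x2A z2A n2.
    have le1 : exit d' v1' A z2 <= v1' by apply: exit_le.
    have vle : exit d v A z2 <= v by apply: exit_le.
    rewrite -dE // e3 exit' // (minn_idPr le1) -(eb' z2 z2A bz).1 exit_spread //.
    rewrite (minn_idPr (leq_trans vle (ltnW vv1))) -(rtop_block_index dU F) //.
    have rE : phi (rtop S (bi z2)) = rtop R (bi z2).
      rewrite rtop_spread ?biR //; case: (eqVneq (bi z2) (size R).-1) => [->|ni].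
        rewrite spread_last -(entry_spread (R := R)) ?entryS ?cell_full ?twin_cell //.
        by rewrite /rtop /entry /=; case: RP.
      have cz : (bi z2, 0) \in cells R.
        rewrite mem_cells /= biR // (comb_ne RP) ?biR //=.
        by apply: contra_neq ni => -[].
      by rewrite -(entry_spread (R := R)) ?entryS ?cell_full.
    exact: rE.
  case: (eqVneq (bi x) i0) => bx; case: (eqVneq (bi z) i0) => bz.
  - rewrite !exit1 // minnn ltnn; split=> //; apply/eqP; rewrite eqn_leq far_le //.
    by rewrite ge1 ?bx // (far_neq n).
  - split; first exact: mixed.
    rewrite (exit1 x xA bx) -(eb z zA bz).1 => lt.
    by have := leq_ltn_trans (exit_le d v A z) vv1; rewrite ltnNge (ltnW lt).
  - have [dS _] := dU; rewrite dS // minnC mixed //; split=> // _.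
    rewrite -(eb x xA bx).2 -(card_nth_block dU A1 FG) //; exact: sizes.
  - rewrite -(eb x xA bx).1 -(eb z zA bz).1 -(eb x xA bx).2 -(eb z zA bz).2.
    apply: comb_pair => //; rewrite nb //; apply/eqP=> b.
    by have xz := far_neq n; case/negP: n; rewrite near_lt ?gt1.
have lv1 : level d A v1 by apply/levelP; exists x1, z1.
by have := mv v1 lv1 cv1; rewrite leqNgt vv1.
Qed.

Lemma comb_depth_spread : comb_depth d' A = v'.
Proof.
by apply: (comb_depth_eq dU'); [exact: spread_depth_level | exact: spread_depth_comb | exact: spread_max].
Qed.

Lemma rows_spread_metric : rows F d' A = S.
Proof.
rewrite rowsE comb_depth_spread blocks_spread.
have SE : S = [seq block_row F d' v' A B | B <- sorted_blocks F d A].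
  apply: (@eq_from_nth _ row0); first by rewrite size_map size_spread /R size_rows.
  move=> i; rewrite size_spread => iR; rewrite (nth_map set0); last by rewrite -size_rows.
  rewrite -/(nth_block A d F i) -/blk /block_row spread_block //=.
  have [x [xA xB bx]] := blk_in iR.
  have iS : i < size S by rewrite size_spread.
  rewrite (block_exitE dU' (x := x)) ?blocks_spread ?nth_blockP //.
  rewrite exit_spread // bx -(rlev_cons SP iS) -(rtag_rows iR) -/R.
  by rewrite -(rtag_spread R y) -surjective_pairing.
apply: (sorted_eq row_le_trans row_le_anti); rewrite ?(comb_sorted SP) ?sort_sorted //.
  exact: row_le_total.
rewrite perm_sort SE; apply: perm_map; apply: uniq_perm; rewrite ?enum_uniq ?uniq_sorted_blocks //.
by move=> B; rewrite mem_enum mem_sorted_blocks.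
Qed.

End Spreading.

(** * The induction on the number of points *)

Section GoodCode.
Variables (T : finType) (c : T -> nat).
Implicit Types (A B : {set T}) (d : T -> T -> nat).

Lemma isomorphic_card d A d' A' : isomorphic c d A d' A' -> #|A| = #|A'|.
Proof. by case=> f [fI <- _ _]; rewrite card_in_imset. Qed.

Section Step.
Variables (F : (T -> T -> nat) -> {set T} -> nat * seq nat) (A : {set T}).
Hypothesis A1 : 1 < #|A|.
Hypothesis FG : forall B, #|B| < #|A| -> good_code c F B.

(** A block that exits at the first level contains the part of its points there, and by the comb it
    is no larger than any block that exits later. Conversely each first-level part contains the
    block of any of its points. *)
Lemma top_ge_rows d m : ultrametric A d ->
  top_ge d A m = all (fun r => m <= r.2) (row_shape (rows F d A)).
Proof.
move=> dU; set R := rows F d A; have RP : comb_rows R := rows_comb dU A1 FG.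
set v := comb_depth d A; have R0 : 0 < size R by case: RP => /ltnW.
have biR x : x \in A -> block_index A d F x < size R by apply: block_index_lt.
have tops i : i < size R -> rtop R 0 <= rtop R i by move=> iR; apply: (rtop_leq RP).
have topv : rtop R 0 <= v by apply: rtop_rows_le.
have least : {in A &, forall x z, x != z -> rtop R 0 <= d x z}.
  move=> x z xA zA xz; case: (boolP (near d v x z)) => n.
    by move: n; rewrite near_lt // => /ltnW; apply: leq_trans.
  by rewrite (d_far dU A1 F xA zA n) leq_min !tops ?biR.
have rep i : i < size R -> exists x, [/\ x \in A, block_index A d F x = i & x \in nth_block A d F i].
  move=> iR; have BP := nth_blockP iR; have [x xB] := blocks_ne BP.
  by exists x; rewrite xB (blocks_block dU BP xB).1 (block_index_nth dU iR xB).
rewrite (top_geE (v := rtop R 0)) //; last first.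
  have [x [xA bx _]] := rep 0 R0; have [y yA n] := exists_far dU A1 xA.
  have [z [zA nz e]] := exit_attained yA n; apply/levelP; exists x, z; rewrite -e.
  by rewrite -bx rtop_block_index // (far_neq nz).
apply/forall_inP/(all_nthP (0, 0)) => [H i|H x xA].
  rewrite size_map => iR; rewrite (nth_map row0) // -/(rlev R i) -/(rsz R i).
  have main j : j < size R -> rtop R j = rtop R 0 -> m <= rsz R j.
    move=> jR tj; have [x [xA bx _]] := rep j jR; apply: leq_trans (H x xA) _.
    rewrite -bx (card_nth_block dU A1 FG) //; apply: subset_leq_card.
    apply/subsetP=> z; rewrite !mem_block => /andP[zA n]; rewrite zA /=.
    apply: contraLR n => n; rewrite near_lt ?(far_neq n) // -leqNgt.
    by rewrite -tj -bx rtop_block_index // exit_ub.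
  case: (ltngtP (rtop R 0) (rtop R i)) (tops i iR) => // [lt|e] _; last exact: main.
  by apply: leq_trans (main 0 R0 erefl) _; apply: (comb_mono RP).
have := H (block_index A d F x); rewrite size_map => /(_ (biR x xA)).
rewrite (nth_map row0) ?biR // -/(rlev R _) -/(rsz R _) (card_nth_block dU A1 FG) // => le.
apply: leq_trans le _; apply/subset_leq_card/subsetP=> z; rewrite !mem_block => /andP[-> n].
exact: near_leq n.
Qed.

Lemma rows_spread d y : ultrametric A d -> uniq y -> size y = size (word (rows F d A)) ->
  same_pattern y (word (rows F d A)) ->
  exists d', [/\ ultrametric A d', rows F d' A = spread_rows (rows F d A) y &
    forall phi, map phi y = word (rows F d A) ->
      {in A &, forall x z, x != z -> phi (d' x z) = d x z}].
Proof.
move=> dU yU ysz yR; set R := rows F d A; have RP : comb_rows R := rows_comb dU A1 FG.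
set S := spread_rows R y; pose blk := nth_block A d F.
pose Q i (e : T -> T -> nat) := [/\ ultrametric (blk i) e,
    F e (blk i) = ((F d (blk i)).1, drop 1 (rlev S i)) &
    forall phi, map phi (drop 1 (rlev S i)) = (F d (blk i)).2 ->
      {in blk i &, forall x z, x != z -> phi (e x z) = d x z}].
have [e eP] : exists e, forall i, i < size R -> Q i (e i).
  apply: (@finite_choice _ d Q) => i iR; have BP := nth_blockP iR.
  have bE : (F d (blk i)).2 = drop 1 (rlev R i) by rewrite rlev_rows //= drop0.
  apply: (code_spread (block_good dU A1 FG BP)).
  - exact: (block_ultrametric dU BP).
  - exact: uniq_spread_row.
  - by rewrite size_spread_row // bE size_drop subn1.
  - by rewrite bE; apply: pattern_spread_row.
exists (spread_metric F A d y e); split.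
- exact: (spread_ultrametric dU A1 FG yU ysz yR eP).
- exact: (rows_spread_metric dU A1 FG yU ysz yR eP).
- by move=> phi phiy; apply: (spread_collapse dU A1 FG yU ysz yR eP).
Qed.

End Step.

Lemma codeE k d A : 1 < #|A| -> code c k.+1 d A =
  (pickle (row_shape (rows (code c k) d A), cell_order (rows (code c k) d A)),
   word (rows (code c k) d A)).
Proof. by move=> A1; rewrite /= leqNgt A1. Qed.

Lemma code_small k d A : #|A| <= 1 -> code c k d A = (\sum_(x in A) c x, [::]).
Proof. by case: k => //= k ->. Qed.

Lemma small_eq A x y : #|A| <= 1 -> x \in A -> y \in A -> x = y.
Proof. by move=> /card_le1_eqP H xA yA; apply: H. Qed.

Lemma good_code_small k A : #|A| <= 1 -> good_code c (code c k) A.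
Proof.
move=> A1; have none x y : x \in A -> y \in A -> x != y -> False.
  by move=> xA yA /eqP; apply; apply: small_eq yA.
split.
- by move=> d dU; rewrite code_small //; case: #|A| A1 => [|[]].
- move=> d v dU; rewrite code_small //=; apply/esym/negbTE/negP.
  by case/levelP=> x [y [xA yA xy _]]; apply: none xy.
- move=> d d' A' dU dU' iso; rewrite !code_small // -?(isomorphic_card iso) //.
  case: iso => f [fI <- fc _]; rewrite big_imset //; congr pair.
  by apply: eq_bigr => x /fc.
- move=> d d' A' dU dU' AA'; rewrite !code_small -?AA' // => -[e].
  case: (set_0Vmem A) => [A0|[x xA]].
    have A'0 : A' = set0 by apply/eqP; rewrite -cards_eq0 -AA' A0 cards0.
    exists id; rewrite A0 A'0; split; try by move=> ?; rewrite inE.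
    by rewrite imset0.
  have AE : A = [set x] by apply/setP=> z; rewrite inE; apply/idP/eqP => [/small_eq|->]; first exact.
  have /eqP/cards1P[x' A'E] : #|A'| = 1 by rewrite -AA' AE cards1.
  move: e; rewrite AE A'E !big_set1 => e; exists (fun=> x'); split.
  + by move=> u w /set1P-> /set1P->.
  + by rewrite imset_set1.
  + by move=> u /set1P->.
  + by move=> u w /set1P-> /set1P->; rewrite eqxx.
- by move=> d phi dU phiM; rewrite !code_small.
- move=> d y dU _; rewrite code_small //= => /size0nil -> _; exists d; split=> //.
    by rewrite code_small.
  by move=> phi _ x z xA zA xz; case: (none x z).
- by move=> d d' _ _; rewrite ltnNge A1.
Qed.

Lemma code_good k A : #|A| <= k.+1 -> good_code c (code c k) A.
Proof.
elim: k A => [|k IH] A Ak; first exact: good_code_small.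
case: (leqP #|A| 1) => A1; first exact: good_code_small.
have FG B : #|B| < #|A| -> good_code c (code c k) B.
  by move=> lt; apply: IH; rewrite -ltnS (leq_trans lt).
split.
- by move=> d dU; rewrite codeE // (size_word_rows dU A1 FG).
- by move=> d v dU; rewrite codeE // (word_level dU A1 FG).
- move=> d d' A' dU dU' iso; rewrite !codeE // -?(isomorphic_card iso) //.
  case: iso => f [fI fA fc fd]; suff -> : rows (code c k) d A = rows (code c k) d' A' by [].
  apply: (rows_transport fI fA fd) => // B BP.
  apply: (code_iso (block_good dU A1 FG BP)).
  + exact: (block_ultrametric dU BP).
  + apply: ultrametric_sub dU'; rewrite -fA; apply: imsetS; exact: (blocks_sub dU BP).
  + apply: (isomorphic_sub fI fd fc); exact: (blocks_sub dU BP).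
- move=> d d' A' dU dU' AA'; rewrite !codeE -?AA' // => -[/(pcan_inj pickleK)[sh co] wd].
  have A1' : 1 < #|A'| by rewrite -AA'.
  have FG' B : #|B| < #|A'| -> good_code c (code c k) B by rewrite -AA'; apply: FG.
  apply: (rows_complete dU dU' A1 AA' FG).
  exact: (rows_eq (rows_comb dU A1 FG) (rows_comb dU' A1' FG')).
- move=> d phi dU phiM; rewrite !codeE // => cp; have RP := rows_comb dU A1 FG.
  by rewrite (rows_relabel dU A1 FG phiM cp) shape_relabel cell_order_relabel // word_relabel.
- move=> d y dU yU; rewrite !codeE // => ysz yR; have RP := rows_comb dU A1 FG.
  have [d' [dU' rE H]] := rows_spread A1 FG dU yU ysz yR.
  exists d'; split=> //; rewrite codeE // rE shape_spread //.
  by rewrite cell_order_spread // word_spread.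
- move=> d d' dU dU' _; rewrite !codeE // => /(pcan_inj pickleK)[sh _] m.
  by rewrite !(top_ge_rows A1 FG) // sh.
Qed.

End GoodCode.

(** * Chains of set partitions *)

Section Chains.
Variable n : nat.
Hypothesis n2 : 1 < n.
Implicit Types (P Q : {set {set 'I_n}}) (C : {set {set {set 'I_n}}}).
Implicit Types (x y : 'I_n) (d : 'I_n -> 'I_n -> nat) (m r v : nat).

Local Notation D := (order_complex_Pi n).

Definition joined P x y := [exists B in P, (x \in B) && (y \in B)].

Definition dist C x y := #|[set P in C | joined P x y]|.

(** Counted from the coarse end: the coarsest member has rank 1, and a member of rank [r] joins the
    pairs of level at least [r]. *)
Definition rank C P := #|[set Q in C | refines P Q]|.

Definition level_chain d m := [set blocks d r setT | r : 'I_m].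

(** Level 0 keeps the coarsest member of [level_chain d m] away from the top partition, level [m]
    keeps the finest away from the bottom one, and the levels in between keep consecutive members
    distinct. *)
Definition height d m := forall v, level d setT v = (v <= m).

Lemma joined_pblock P x y : partition P setT -> joined P x y = (y \in pblock P x).
Proof.
case/and3P=> /eqP cov tr _; apply/exists_inP/idP => [[B BP /andP[xB yB]]|yP].
  by rewrite (def_pblock tr BP xB).
have xc : x \in cover P by rewrite cov inE.
by exists (pblock P x); rewrite ?pblock_mem // mem_pblock xc.
Qed.

Lemma partition_joined P : partition P setT -> P = equivalence_partition (joined P) setT.
Proof.
move=> PP; rewrite -{1}(equivalence_partition_pblock PP).
by apply: eq_imset => x; apply/setP=> y; rewrite !inE joined_pblock.
Qed.

Lemma joined_refl P x : partition P setT -> joined P x x.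
Proof. by move=> PP; rewrite joined_pblock // mem_pblock (cover_partition PP) inE. Qed.

Lemma joined_sym P x y : joined P x y = joined P y x.
Proof. by apply: eq_existsb => B; rewrite [(x \in B) && _]andbC. Qed.

Lemma joined_trans P x y z : partition P setT -> joined P x y -> joined P y z -> joined P x z.
Proof.
move=> PP; rewrite !joined_pblock // => xy yz.
have tr := partition_trivIset PP.
by rewrite -(same_pblock tr xy).
Qed.

Lemma refinesP P Q : partition P setT -> partition Q setT ->
  reflect (forall x y, joined P x y -> joined Q x y) (refines P Q).
Proof.
move=> PP PQ; apply: (iffP forall_inP) => [H x y /exists_inP[B /H /exists_inP[B' QB' /subsetP s]]|H B BP].
  by case/andP=> /s xB /s yB; apply/exists_inP; exists B'; rewrite ?xB.
have [x xB] : exists x, x \in B.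
  by apply/set0Pn; apply: contraTneq BP => ->; have /and3P[] := PP.
have := joined_refl x PQ; case/exists_inP=> B' QB' /andP[xB' _].
apply/exists_inP; exists B' => //; apply/subsetP=> y yB.
have : joined Q x y by apply: H; apply/exists_inP; exists B; rewrite ?xB.
by rewrite joined_pblock // (def_pblock (partition_trivIset PQ) QB' xB').
Qed.

Lemma joined_inj P Q : partition P setT -> partition Q setT -> joined P =2 joined Q -> P = Q.
Proof.
move=> PP PQ e; rewrite (partition_joined PP) (partition_joined PQ).
by apply: eq_imset => x; apply/setP=> y; rewrite !inE e.
Qed.

Lemma partition_blocksT d r : ultrametric setT d -> partition (blocks d r setT) setT.
Proof. by move=> dU; apply: partition_blocks. Qed.

Lemma joined_blocks d r x y : ultrametric setT d -> joined (blocks d r setT) x y = near d r x y.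
Proof.
move=> dU; rewrite joined_pblock ?partition_blocksT //.
by rewrite pblock_equivalence_partition ?inE //; apply: near_equiv.
Qed.

Lemma partition_bot : partition (Pi_bot n) setT.
Proof.
apply/and3P; split.
- rewrite cover_imset; apply/eqP/setP=> x; rewrite inE; apply/bigcupP.
  by exists x; rewrite ?inE.
- by apply/trivIsetP=> _ _ /imsetP[x _ ->] /imsetP[y _ ->] ne; rewrite disjoints1 inE; apply: contra ne => /eqP->.
- by apply/imsetP=> -[x _ /setP/(_ x)]; rewrite !inE eqxx.
Qed.

Lemma joined_bot x y : joined (Pi_bot n) x y = (x == y).
Proof.
apply/exists_inP/eqP => [[_ /imsetP[z _ ->]]|->]; first by rewrite !inE => /andP[/eqP-> /eqP->].
by exists [set y]; rewrite ?imset_f // !inE eqxx.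
Qed.

Lemma joined_top x y : joined (Pi_top n) x y.
Proof. by apply/exists_inP; exists setT; rewrite ?inE. Qed.

Lemma partition_top : partition (Pi_top n) setT.
Proof.
apply/and3P; split; first by rewrite /cover big_set1.
  by apply/trivIsetP=> _ _ /set1P-> /set1P->; rewrite eqxx.
rewrite inE; apply/eqP=> /setP/(_ (Ordinal (ltnW n2))).
by rewrite !inE.
Qed.

Lemma Pi_properP P : reflect
  [/\ partition P setT, exists x y, x != y /\ joined P x y & exists x y, ~~ joined P x y]
  (P \in Pi_proper n).
Proof.
rewrite inE /srefines; apply: (iffP and3P) => [[PP /andP[nb _] /andP[nt _]]|[PP [x [y [xy j]]] [x' [y' nj]]]].
  split=> //.
    suff : [exists x, exists y, (x != y) && joined P x y].
      by case/existsP=> x /existsP[y /andP[]]; exists x, y.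
    apply: contraR nb; rewrite negb_exists => /forallP H; apply/eqP.
    apply: joined_inj => // [|x y]; first exact: partition_bot.
    rewrite joined_bot; case: eqVneq => [->|xy]; first by rewrite joined_refl.
    by have := H x; rewrite negb_exists => /forallP/(_ y); rewrite xy /= => /negbTE->.
  suff : [exists x, exists y, ~~ joined P x y].
    by case/existsP=> x /existsP[y]; exists x, y.
  apply: contraR nt; rewrite negb_exists => /forallP H; apply/eqP.
  apply: joined_inj => // [|x y]; first exact: partition_top.
  by rewrite joined_top; have := H x; rewrite negb_exists => /forallP/(_ y) /negPn->.
split=> //; apply/andP; split.
- by apply: contraNneq xy => e; rewrite -e joined_bot in j.
- apply/refinesP => // [|u w]; first exact: partition_bot.
  by rewrite joined_bot => /eqP->; apply: joined_refl.
- by apply: contraNneq nj => ->; apply: joined_top.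
- by apply/refinesP => // [|u w _]; [exact: partition_top | exact: joined_top].
Qed.

Lemma chainP C : reflect
  ((forall P, P \in C -> P \in Pi_proper n) /\
   (forall P Q, P \in C -> Q \in C -> refines P Q \/ refines Q P))
  (C \in D).
Proof.
rewrite inE; apply: (iffP andP) => -[/subsetP s H]; split=> //.
- by move=> P Q PC QC; have /forall_inP/(_ P PC)/forall_inP/(_ Q QC)/orP := H.
- apply/forall_inP=> P PC; apply/forall_inP=> Q QC; apply/orP; exact: H.
Qed.

Section OneChain.
Variable C : {set {set {set 'I_n}}}.
Hypothesis CD : C \in D.

Lemma chain_proper P : P \in C -> P \in Pi_proper n.
Proof. by case/chainP: CD => H _; apply: H. Qed.

Lemma chain_partition P : P \in C -> partition P setT.
Proof. by case/chain_proper/Pi_properP. Qed.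

(** The members joining [x] and [y] are closed under coarsening, hence an initial segment of the
    chain in order of rank. *)
Lemma joined_rank P x y : P \in C -> joined P x y = (rank C P <= dist C x y).
Proof.
move=> PC; have PP := chain_partition PC; apply/idP/idP => [j|].
  apply/subset_leq_card/subsetP=> Q; rewrite !inE => /andP[QC r]; rewrite QC.
  by move/(refinesP PP (chain_partition QC)): r; apply.
apply: contraTT => nj; rewrite -ltnNge; apply: proper_card; apply/properP; split.
  apply/subsetP=> Q; rewrite !inE => /andP[QC j]; rewrite QC /=.
  case/chainP: CD => _ /(_ P Q PC QC)[//|/(refinesP (chain_partition QC) PP) H].
  by rewrite H in nj.
by exists P; rewrite !inE PC //=; apply/refinesP.
Qed.

Lemma rank_gt0 P : P \in C -> 0 < rank C P.
Proof.
move=> PC; apply/card_gt0P; exists P; rewrite inE PC.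
by have PP := chain_partition PC; apply/refinesP.
Qed.

Lemma rank_le P : rank C P <= #|C|.
Proof. by apply/subset_leq_card/subsetP=> Q; rewrite inE => /andP[]. Qed.

Lemma dist_le x y : dist C x y <= #|C|.
Proof. by apply/subset_leq_card/subsetP=> Q; rewrite inE => /andP[]. Qed.

Lemma dist_ultrametric : ultrametric setT (dist C).
Proof.
split=> [x y _ _|x y z _ _ _ _].
  by apply: eq_card => P; rewrite !inE joined_sym.
case: (leqP (dist C x y) (dist C y z)) => le;
  apply/subset_leq_card/subsetP=> P; rewrite !inE => /andP[PC j]; rewrite PC /=.
  by apply: (joined_trans (y := y)); rewrite ?chain_partition // joined_rank // (leq_trans _ le) -?joined_rank.
by apply: (joined_trans (y := y)); rewrite ?chain_partition // joined_rank // (leq_trans _ (ltnW le)) -?joined_rank.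
Qed.

Lemma near_rank P x y : P \in C -> near (dist C) (rank C P).-1 x y = joined P x y.
Proof.
move=> PC; rewrite /near prednK ?rank_gt0 // -joined_rank //.
by case: eqVneq => //= ->; rewrite joined_refl ?chain_partition.
Qed.

Lemma chain_block P : P \in C -> P = blocks (dist C) (rank C P).-1 setT.
Proof.
move=> PC; apply: joined_inj (chain_partition PC) _ _.
  exact: partition_blocksT dist_ultrametric.
by move=> x y; rewrite joined_blocks ?near_rank //; apply: dist_ultrametric.
Qed.

Lemma chain_level_chain : C = level_chain (dist C) #|C|.
Proof.
apply/eqP; rewrite eqEcard; apply/andP; split.
  apply/subsetP=> P PC; have r0 := rank_gt0 PC; have r1 := rank_le P.
  have lt : (rank C P).-1 < #|C| by rewrite prednK.
  by apply/imsetP; exists (Ordinal lt) => //; apply: chain_block.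
by apply: leq_trans (leq_imset_card _ _) _; rewrite card_ord.
Qed.

Lemma chain_height : height (dist C) #|C|.
Proof.
move=> v; apply/idP/idP => [/levelP[x [y [_ _ _ <-]]]|]; first exact: dist_le.
have bI : {in setT &, injective (fun r : 'I_#|C| => blocks (dist C) r setT)}.
  apply/imset_injP; rewrite cardsT card_ord.
  have -> : [set blocks (dist C) (r : 'I_#|C|) setT | r in setT] = C; last by [].
  rewrite [RHS]chain_level_chain; apply/setP=> P.
  by apply/imsetP/imsetP => -[r _ ->]; exists r.
have inC r : r < #|C| -> blocks (dist C) r setT \in Pi_proper n.
  move=> rC; apply: chain_proper; rewrite {2}chain_level_chain.
  by apply/imsetP; exists (Ordinal rC).
have dU := dist_ultrametric; have := dist_le; set d := dist C in bI inC dU *; set m := #|C| => dm.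
rewrite leq_eqVlt => /orP[/eqP->|vm].
  case: (posnP m) => m0.
    pose x := Ordinal (ltnW n2); pose y := Ordinal n2.
    by apply/levelP; exists x, y; split; rewrite ?inE //; apply/eqP; rewrite m0 -leqn0 -m0 dm.
  have lt : m.-1 < m by rewrite prednK.
  case/Pi_properP: (inC _ lt) => _ [x [y [xy j]]] _; move: j; rewrite joined_blocks // near_lt // prednK // => le.
  by apply/levelP; exists x, y; rewrite !inE; split=> //; apply/eqP; rewrite eqn_leq dm.
case: v vm => [|v] vm.
  case/Pi_properP: (inC _ vm) => _ _ [x [y]]; rewrite joined_blocks // => nj.
  apply/levelP; exists x, y; rewrite !inE (far_neq nj); split=> //; apply/eqP.
  by rewrite -leqn0; apply: far_le nj.
(* If the level [v.+1] were missing, the thresholds [v] and [v.+1] would cut out the same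
   partition. *)
case: (boolP (level d setT v.+1)) => // nl; pose i := Ordinal (ltnW vm); pose j := Ordinal vm.
have e : blocks d i setT <> blocks d j setT.
  by move=> e; have := bI i j (in_setT _) (in_setT _) e => /(congr1 val)/=/eqP; rewrite ltn_eqF.
case: e; apply: eq_imset => x; apply/setP=> y; rewrite !inE /= /near; case: eqVneq => //= xy.
rewrite leq_eqVlt; case: eqP => //= e; case/negP: nl; apply/levelP.
by exists x, y; rewrite !inE.
Qed.

Lemma dist_subchain C' x y : C' \subset C ->
  dist C' x y = #|[set P in C' | rank C P <= dist C x y]|.
Proof.
move/subsetP=> s; apply: eq_card => P; rewrite !inE.
by case: (boolP (P \in C')) => //= /s PC; rewrite joined_rank.
Qed.

Lemma rank_inj : {in C &, injective (rank C)}.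
Proof. by move=> P Q PC QC e; rewrite (chain_block PC) e -chain_block. Qed.

Lemma subset_level_chain d' m' phi : ultrametric setT d' -> height d' m' ->
  {homo phi : i j / i <= j} -> (forall x y, x != y -> phi (d' x y) = dist C x y) ->
  C \subset level_chain d' m'.
Proof.
move=> dU' h' phiM e; apply/subsetP=> P PC; have r0 := rank_gt0 PC.
case/Pi_properP: (chain_proper PC) => PP [x [y [xy j]]] [x' [y' nj]].
have xy' : x' != y' by apply: contraNneq nj => ->; rewrite joined_refl.
have ex : exists k, rank C P <= phi k by exists (d' x y); rewrite e // -joined_rank.
(* [P] joins the pairs with [phi (d' x y) >= rank C P]; by monotonicity these are the pairs with
   [d' x y >= k], so [P] is the member of threshold [k.-1]. *)
case: (ex_minnP ex) => k rk km.
have k0 : 0 < k.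
  rewrite lt0n; apply: contraNneq nj => k0; rewrite joined_rank // (leq_trans rk) // -e //.
  by apply: phiM; rewrite k0.
have km' : k.-1 < m'.
  rewrite prednK //; apply: (@leq_trans (d' x y)).
    by apply: km; rewrite e // -joined_rank.
  by rewrite -h' level_d ?inE.
apply/imsetP; exists (Ordinal km') => //=; apply: joined_inj => // [|u w].
  exact: partition_blocksT.
rewrite joined_blocks // /near prednK //; case: eqVneq => [->|uw] /=.
  exact: joined_refl.
rewrite joined_rank // -e //; apply/idP/idP => [/km//|/phiM]; exact: leq_trans.
Qed.

End OneChain.

Section OfMetric.
Variables (d : 'I_n -> 'I_n -> nat) (m : nat).
Hypotheses (dU : ultrametric setT d) (dh : height d m).

Lemma level_chain_in : level_chain d m \in D.
Proof.
apply/chainP; split=> [_ /imsetP[r _ ->]|_ _ /imsetP[r _ ->] /imsetP[s _ ->]].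
  apply/Pi_properP; split; first exact: partition_blocksT.
    have /levelP[x [y [_ _ xy e]]] : level d setT m by rewrite dh.
    by exists x, y; rewrite joined_blocks // near_lt // e ltn_ord.
  have /levelP[x [y [_ _ xy e]]] : level d setT 0 by rewrite dh.
  by exists x, y; rewrite joined_blocks // near_lt // e.
case: (leqP r s) => rs; [right | left]; apply/refinesP; rewrite ?partition_blocksT // => x y.
  by rewrite !joined_blocks //; apply: near_leq.
by rewrite !joined_blocks //; apply: near_leq; apply: ltnW.
Qed.

Lemma blocks_inj : injective (fun r : 'I_m => blocks d r setT).
Proof.
have main (r s : 'I_m) : r < s -> blocks d r setT <> blocks d s setT.
  move=> rs e; have /levelP[x [y [_ _ xy dxy]]] : level d setT s by rewrite dh ltnW.
  have : joined (blocks d r setT) x y by rewrite joined_blocks // near_lt // dxy.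
  by rewrite e joined_blocks // near_lt // dxy ltnn.
move=> r s e; apply: val_inj; case: (ltngtP r s) => // lt; first by case: (main r s).
by case: (main s r).
Qed.

Lemma card_level_chain : #|level_chain d m| = m.
Proof. by rewrite card_imset ?card_ord //; apply: blocks_inj. Qed.

Lemma dist_level_chain x y : x != y -> dist (level_chain d m) x y = d x y.
Proof.
move=> xy; have dm : d x y <= m by rewrite -dh level_d ?inE.
have -> : dist (level_chain d m) x y =
    #|[set blocks d (r : 'I_m) setT | r in [set r : 'I_m | r < d x y]]|.
  apply: eq_card => P; rewrite !inE; apply/andP/imsetP.
    case=> /imsetP[r _ ->]; rewrite joined_blocks // near_lt // => lt.
    by exists r; rewrite ?inE.
  case=> r; rewrite inE => lt ->; rewrite joined_blocks // near_lt //; split=> //.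
  exact: imset_f.
rewrite card_imset; last exact: blocks_inj.
rewrite cardsE -sum1_card -[RHS]card_ord -[RHS]sum1_card (big_ord_widen m (fun=> 1) dm).
by apply: eq_bigl => r.
Qed.

End OfMetric.
End Chains.

(** * The Young subgroup as the stabiliser of a colouring *)

Section YoungSubgroup.
Variables (n : nat) (lam : seq nat).
Hypothesis hlam : is_composition n lam.
Import GroupScope.

Definition young_colour (i : 'I_n) :=
  find (fun j => i < sumn (take j.+1 lam))%N (iota 0 (size lam)).

Lemma sumn_take_leq j k : (j <= k)%N -> (sumn (take j lam) <= sumn (take k lam))%N.
Proof. by move=> jk; rewrite -(subnKC jk) takeD sumn_cat leq_addr. Qed.

Lemma young_colour_lt i : (young_colour i < size lam)%N.
Proof.
case/andP: hlam => _ /eqP lamn.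
have s0 : (0 < size lam)%N.
  by have := ltn_ord i; move: (nat_of_ord i) => k; rewrite -lamn; case: lam.
have : has (fun j => i < sumn (take j.+1 lam))%N (iota 0 (size lam)).
  apply/hasP; exists (size lam).-1; first by rewrite mem_iota add0n prednK ?leqnn.
  by rewrite prednK // take_size lamn ltn_ord.
by rewrite has_find size_iota.
Qed.

Lemma young_blockE j (i : 'I_n) : (i \in young_block n lam j) = (young_colour i == j).
Proof.
have lt := young_colour_lt i; rewrite inE; apply/andP/eqP => [[ji ij]|<-].
  case: (ltngtP (young_colour i) j) => // [cj|jc].
    have hs : has (fun j => i < sumn (take j.+1 lam))%N (iota 0 (size lam)).
      by rewrite has_find size_iota.
    have := nth_find 0%N hs; rewrite nth_iota // add0n => ic.
    by have := leq_trans ic (leq_trans (sumn_take_leq cj) ji); rewrite ltnn.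
  by have := before_find 0%N jc; rewrite nth_iota ?(ltn_trans jc) // add0n ij.
split; last first.
  have hs : has (fun j => i < sumn (take j.+1 lam))%N (iota 0 (size lam)).
    by rewrite has_find size_iota.
  by have := nth_find 0%N hs; rewrite nth_iota // add0n.
case e : (young_colour i) => [|k]; first by rewrite take0.
have kc : (k < young_colour i)%N by rewrite e.
by have := before_find 0%N kc; rewrite nth_iota ?(ltn_trans kc) // add0n => /negbT; rewrite -leqNgt.
Qed.

Definition colour_stab := [set s : 'S_n | [forall i, young_colour (s i) == young_colour i]].

Lemma colour_stabP (s : 'S_n) : reflect (forall i, young_colour (s i) = young_colour i) (s \in colour_stab).
Proof. by rewrite inE; apply: (iffP forallP) => H i; apply/eqP. Qed.

Lemma group_set_colour_stab : group_set colour_stab.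
Proof.
apply/group_setP; split; first by apply/colour_stabP => i; rewrite perm1.
by move=> s t /colour_stabP sP /colour_stabP tP; apply/colour_stabP => i; rewrite permM tP.
Qed.

(** Induction on the number of moved points: composing with the transposition of [i] and [s i], two
    points of one colour, fixes [i] and moves no new point. *)
Lemma youngP (s : 'S_n) : reflect (forall i, young_colour (s i) = young_colour i) (s \in young n lam).
Proof.
have -> : (s \in young n lam) = (s \in colour_stab); last exact: colour_stabP.
rewrite /young bigprodGE; apply/idP/idP => [|/colour_stabP].
  apply/subsetP; rewrite -[colour_stab]/(gval (Group group_set_colour_stab)) gen_subG.
  apply/bigcupsP=> j _; apply/subsetP=> t; rewrite inE => tA.
  apply/colour_stabP => i; case: (boolP (i \in young_block n lam j)) => ij.
    have : t i \in young_block n lam j by rewrite (perm_closed _ tA).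
    by move: ij; rewrite !young_blockE => /eqP-> /eqP.
  by rewrite (out_perm tA).
set G := <<_>>; move: {2}#|_| (leqnn #|[set i | s i != i]|) => k.
elim: k s => [|k IH] s.
  rewrite leqn0 cards_eq0 => /eqP/setP s1 _; suff -> : s = 1 by apply: group1.
  by apply/permP=> i; have := s1 i; rewrite !inE perm1 => /negbFE/eqP.
move=> sk sP; case: (set_0Vmem [set i | s i != i]) => [s0|[i]].
  by apply: IH => //; rewrite s0 cards0.
rewrite inE => si; pose t := tperm i (s i).
have ct x : young_colour (t x) = young_colour x by rewrite /t; case: tpermP => // ->.
have tG : t \in G.
  apply: mem_gen; apply/bigcupP; exists (Ordinal (young_colour_lt i)) => //=.
  rewrite inE; apply/subsetP=> x; rewrite inE young_blockE /=.
  by rewrite /t; case: tpermP => [->|->|]; rewrite ?sP ?eqxx.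
rewrite -(groupMr _ tG); apply: IH => [|x]; last by rewrite permM ct sP.
rewrite -ltnS; apply: leq_trans sk; apply: proper_card; apply/properP; split.
  apply/subsetP=> x; rewrite !inE permM; apply: contra => /eqP sx; rewrite sx /t.
  case: tpermP => [xi|xs|] //; first by rewrite -xi sx.
  by rewrite -(inj_eq (@perm_inj _ s)) sx -xs eqxx.
by exists i; rewrite !inE // permM /t tpermR eqxx.
Qed.

End YoungSubgroup.

(** * Permutations acting on chains *)

Section Action.
Variable n : nat.
Hypothesis n2 : 1 < n.
Implicit Types (P Q : {set {set 'I_n}}) (C : {set {set {set 'I_n}}}) (s : 'S_n).
Import GroupScope.

Local Notation D := (order_complex_Pi n).
Local Notation to := (Pi_action n).

Lemma Pi_actE P s : to P s = [set s @: (B : {set 'I_n}) | B in P].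
Proof. by []. Qed.

Lemma chain_actE C s : to^* C s = [set to P s | P in C].
Proof. by []. Qed.

Lemma joined_act P s x y : joined (to P s) (s x) (s y) = joined P x y.
Proof.
rewrite Pi_actE; apply/exists_inP/exists_inP => [[_ /imsetP[B BP ->]]|[B BP xy]].
  by rewrite !(mem_imset _ _ (@perm_inj _ s)); exists B.
exists (s @: B); first exact: imset_f.
by rewrite !(mem_imset _ _ (@perm_inj _ s)).
Qed.

Lemma dist_act C s x y : dist (to^* C s) (s x) (s y) = dist C x y.
Proof.
rewrite -[RHS](card_imset _ (act_inj to s)); apply: eq_card => P; rewrite !inE.
apply/andP/imsetP => [[/imsetP[Q QC ->]]|[Q]].
  by rewrite joined_act => j; exists Q; rewrite ?inE ?QC.
by rewrite inE => /andP[QC j] ->; split; [exact: imset_f | rewrite joined_act].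
Qed.

Lemma card_act C s : #|to^* C s| = #|C|.
Proof. by apply: card_imset; apply: act_inj. Qed.

(** Transport of structure: the permuted chain is the level chain of the permuted ultrametric. *)
Lemma act_chain C s : C \in D -> to^* C s \in D.
Proof.
move=> CD; pose d' x y := dist C (s^-1 x) (s^-1 y).
have fd : {in setT &, forall x y, x != y -> d' (s x) (s y) = dist C x y}.
  by move=> x y _ _ _; rewrite /d' !permK.
have fT : s @: setT = setT.
  by apply/eqP; rewrite eqEcard subsetT card_imset ?leqnn //; apply: perm_inj.
have sI : {in setT &, injective s} by move=> x y _ _; apply: perm_inj.
have U : ultrametric setT d'.
  have [dS dT] := dist_ultrametric n2 CD; split=> [x y _ _|x y z _ _ _ xz].
    by rewrite /d' dS ?inE.
  by apply: dT; rewrite ?inE // (inj_eq perm_inj).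
have h : height d' #|C|.
  by move=> v; rewrite (level_transport sI fT fd) chain_height.
have -> : to^* C s = level_chain d' #|C|; last exact: level_chain_in.
have bE r : to (blocks (dist C) r setT) s = blocks d' r setT.
  by rewrite (blocks_transport sI fT fd).
rewrite chain_actE {1}(chain_level_chain n2 CD); apply/setP=> P; apply/imsetP/imsetP.
  by case=> _ /imsetP[r _ ->] ->; exists r; rewrite ?bE.
case=> r _ ->; exists (blocks (dist C) r setT); rewrite ?bE //.
exact: imset_f.
Qed.

Lemma chain_eq C C' : C \in D -> C' \in D -> #|C| = #|C'| ->
  (forall x y, x != y -> dist C x y = dist C' x y) -> C = C'.
Proof.
move=> CD CD' e H; rewrite (chain_level_chain n2 CD) (chain_level_chain n2 CD') e.
apply/setP=> P; apply/imsetP/imsetP => -[r _ ->]; exists r => //; apply: eq_imset => x;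
  by apply/setP=> y; rewrite !inE /near; case: eqVneq => //= xy; rewrite H.
Qed.

End Action.

(** * Standardisation of words *)

Section Standardisation.

(** The letter at [k] is the position of [k] once the positions are sorted by letter, ties from left
    to right. *)
Lemma standardisation (b : seq nat) :
  exists2 y, perm_eq y (iota 0 (size b)) & same_pattern y b.
Proof.
pose lab k := [:: nth 0 b k; k]; pose le j k := lexle (lab j) (lab k).
have labI : injective lab by move=> j k [].
have tr : transitive le by move=> ? ? ?; apply: lexle_trans.
have rf : reflexive le by move=> ?; apply: lexle_refl.
pose o := sort le (iota 0 (size b)).
have srt : sorted le o by apply: sort_sorted => ? ?; apply: lexle_total.
have oM k : (k \in o) = (k < size b) by rewrite mem_sort mem_iota.
have so : size o = size b by rewrite size_sort size_iota.
pose y := mkseq (fun k => index k o) (size b).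
have yE k : k < size b -> nth 0 y k = index k o by move=> kb; rewrite nth_mkseq.
have idx j k : j < size b -> k < size b -> index j o <= index k o -> le j k.
  move=> jb kb; move/(sorted_leq_nth tr rf 0 srt).
  by rewrite !inE !index_mem !oM jb kb !nth_index ?oM // => /(_ isT isT).
have yU : uniq y.
  apply/(uniqP 0) => j k; rewrite !inE size_mkseq => jb kb; rewrite !yE // => e.
  by rewrite -(nth_index 0 (s := o) (x := j)) ?oM // e nth_index ?oM.
exists y.
  apply: uniq_perm => //; first exact: iota_uniq.
  have sub : {subset y <= iota 0 (size b)}.
    move=> v /mapP[k]; rewrite mem_iota => /andP[_ kb] ->.
    by rewrite mem_iota /= add0n -so index_mem oM.
  by have [] := uniq_min_size yU sub _; rewrite size_mkseq size_iota.
move=> p q /andP[pq qb]; have pb := ltn_trans pq qb; rewrite !yE //.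
have pqle : le p q = (nth 0 b p <= nth 0 b q).
  by rewrite /le /lab !lexle_cons pq andbT orbC -leq_eqVlt.
rewrite -pqle; apply/idP/idP => [/ltnW|le1]; first exact: idx.
rewrite ltnNge; apply/negP=> /(idx _ _ qb pb) le2.
have /labI e : lab p = lab q by apply: lexle_anti; apply/andP.
by rewrite e ltnn in pq.
Qed.

(** A monotone map carries [y] to [y']. Both are permutations of [iota 0 N], so it maps this sorted
    list to itself and is the identity there. *)
Lemma pattern_unique y y' b N : perm_eq y (iota 0 N) -> perm_eq y' (iota 0 N) ->
  size b = N -> same_pattern y b -> same_pattern y' b -> y = y'.
Proof.
move=> py py' sb yb y'b.
have sy : size y = N by rewrite (perm_size py) size_iota.
have sy' : size y' = N by rewrite (perm_size py') size_iota.
have yU : uniq y by rewrite (perm_uniq py) iota_uniq.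
have yU' : uniq y' by rewrite (perm_uniq py') iota_uniq.
have pat : same_pattern y y'.
  move=> p q /andP[pq]; rewrite sy' => qN.
  rewrite yb ?pq ?sb // -y'b ?pq ?sb // [RHS]leq_eqVlt nth_uniq ?sy' ?(ltn_trans pq) //.
  by rewrite ltn_eqF.
have [phi phiM phiy] := pattern_relabel yU (etrans sy (esym sy')) pat.
have e : map phi (iota 0 N) = iota 0 N.
  apply: (sorted_eq leq_trans anti_leq).
  - by apply: homo_sorted (iota_sorted 0 N) => i j; apply: phiM.
  - exact: iota_sorted.
  by apply: perm_trans py'; rewrite -phiy; apply: perm_map; rewrite perm_sym.
rewrite -phiy -[LHS]map_id; apply/eq_in_map=> v; rewrite (perm_mem py) mem_iota add0n /= => vN.
have := congr1 (fun s => nth 0 s v) e; rewrite (nth_map 0) ?size_iota // nth_iota //.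
Qed.

End Standardisation.

Lemma descent (f : nat -> nat) u w : u < w -> f w < f u ->
  exists2 j, u < j <= w & f j < f j.-1.
Proof.
elim: w => // w IH; rewrite ltnS => uw fw; case: (ltnP (f w.+1) (f w)) => lt.
  by exists w.+1; rewrite // ltnS uw leqnn.
move: uw; rewrite leq_eqVlt => /orP[/eqP uw|uw].
  by move: fw; rewrite uw ltnNge lt.
have [j /andP[uj jw] fj] := IH uw (leq_ltn_trans lt fw).
by exists j; rewrite // uj leqW.
Qed.

(** * The partition of the quotient complex *)

Section Quotient.
Variables (n : nat) (c : 'I_n -> nat) (G : {group 'S_n}).
Hypothesis n2 : 1 < n.
Hypothesis GP : forall s : 'S_n, reflect (forall i, c (s i) = c i) (s \in G).
Implicit Types (P Q : {set {set 'I_n}}) (C : {set {set {set 'I_n}}}) (s : 'S_n).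

Local Notation D := (order_complex_Pi n).
Local Notation to := (Pi_action n).
Local Notation K := (quotient_complex to D G).

Definition chain_code C := code c n (dist C) setT.

Lemma chain_good : good_code c (code c n) [set: 'I_n].
Proof. by apply: code_good; rewrite cardsT card_ord. Qed.

Lemma chain_iso C C' (s : 'I_n -> 'I_n) : injective s -> (forall x, c (s x) = c x) ->
  (forall x y, x != y -> dist C' (s x) (s y) = dist C x y) ->
  isomorphic c (dist C) setT (dist C') setT.
Proof.
move=> sI sc sd; exists s; split=> [x y _ _||x _|x y _ _]; [exact: sI | | exact: sc | exact: sd].
by apply/eqP; rewrite eqEcard subsetT card_imset ?leqnn.
Qed.

Section Codes.
Variable C : {set {set {set 'I_n}}}.
Hypothesis CD : C \in D.

Let dU := dist_ultrametric n2 CD.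

Lemma chain_code_size : size (chain_code C).2 = n.-1.
Proof. by rewrite (code_size chain_good) // cardsT card_ord. Qed.

Lemma chain_code_mem v : (v \in (chain_code C).2) = (v <= #|C|).
Proof. by rewrite (code_level chain_good) // chain_height. Qed.

(** The numbers from 0 to [#|C|] are all letters of a word of length [n.-1]. *)
Lemma chain_card : #|C| <= n.-2.
Proof.
have : size (iota 0 #|C|.+1) <= size (chain_code C).2.
  apply: uniq_leq_size; first exact: iota_uniq.
  by move=> v; rewrite mem_iota add0n ltnS chain_code_mem.
by rewrite size_iota chain_code_size; lia.
Qed.

Lemma facet_code : #|C| = n.-2 -> perm_eq (chain_code C).2 (iota 0 n.-1).
Proof.
move=> Cn; have sub : {subset iota 0 n.-1 <= (chain_code C).2}.
  by move=> v; rewrite mem_iota add0n chain_code_mem Cn; lia.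
have sz : size (chain_code C).2 <= size (iota 0 n.-1) by rewrite size_iota chain_code_size.
have u := leq_size_uniq (iota_uniq 0 n.-1) sub sz.
apply: uniq_perm; rewrite ?iota_uniq // => v; apply/idP/idP; last exact: sub.
by rewrite chain_code_mem Cn mem_iota; lia.
Qed.

Lemma chain_code_act s : s \in G -> chain_code (to^* C s)%act = chain_code C.
Proof.
move=> /GP sc; apply/esym/(code_iso chain_good) => //.
  exact: (dist_ultrametric n2 (act_chain n2 s CD)).
by apply: (chain_iso (s := s)) => // [|x y _]; [exact: perm_inj | exact: dist_act].
Qed.

Lemma chain_code_complete C' : C' \in D -> #|C| = #|C'| -> chain_code C = chain_code C' ->
  exists2 s, s \in G & C' = (to^* C s)%act.
Proof.
move=> CD' cC e; have := code_complete chain_good dU (dist_ultrametric n2 CD') erefl e.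
case=> f [fI _ fc fd]; have fI' : injective f by move=> x y; apply: fI; rewrite inE.
exists (perm fI'); first by apply/GP => i; rewrite permE fc ?inE.
apply: (chain_eq n2) => //; [exact: act_chain | by rewrite card_act |] => x y xy.
set s := perm fI'; have xy' : (s^-1 x != s^-1 y)%g by rewrite (inj_eq perm_inj).
rewrite -[x](permKV s) -[y](permKV s) dist_act -(fd _ _ _ _ xy') ?inE //.
by rewrite -!(permE fI').
Qed.

(** [F] is the level chain of an ultrametric that has the tag of [C] and the standardised word; its
    levels are the letters from 0 to [n.-2], which gives it [n.-2] members. *)
Lemma chain_extension : exists F phi, [/\ F \in D, #|F| = n.-2, C \subset F,
  forall x y, x != y -> phi (dist F x y) = dist C x y &
  [/\ map phi (chain_code F).2 = (chain_code C).2,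
      same_pattern (chain_code F).2 (chain_code C).2 &
      (chain_code F).1 = (chain_code C).1]].
Proof.
have [y py pat] := standardisation (chain_code C).2.
have sy : size y = size (chain_code C).2 by rewrite (perm_size py) size_iota.
have yU : uniq y by rewrite (perm_uniq py) iota_uniq.
have [d [dV dE H]] := code_spread chain_good dU yU sy pat.
have [phi phiM phiy] := pattern_relabel yU sy pat.
have dC : forall x z, x != z -> phi (d x z) = dist C x z.
  by move=> x z; apply: H; rewrite ?inE.
have h : height d n.-2.
  move=> v; rewrite -(code_level chain_good) // dE /= (perm_mem py).
  by rewrite mem_iota chain_code_size add0n /=; lia.
pose F := level_chain d n.-2; have FD : F \in D by apply: level_chain_in.
have dF x z : x != z -> dist F x z = d x z by apply: dist_level_chain.
have FE : chain_code F = ((chain_code C).1, y).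
  rewrite -dE; apply: (code_iso chain_good) => //; first exact: dist_ultrametric.
  exists id; split=> //; first exact: imset_id.
  by move=> x z _ _ xz; rewrite dF.
exists F, phi; split=> //; first exact: card_level_chain.
- exact: (subset_level_chain n2 CD dV h phiM).
- by move=> x z xz; rewrite dF // dC.
- by rewrite FE.
Qed.

End Codes.

(* The descent set of the inverse of the permutation [chain_code F]. *)
Definition min_face (F : {set {set {set 'I_n}}}) :=
  [set P in F | index (rank F P) (chain_code F).2 < index (rank F P).-1 (chain_code F).2].

Lemma min_face_sub F : min_face F \subset F.
Proof. by apply/subsetP=> P; rewrite inE => /andP[]. Qed.

Lemma sub_chain C (F : {set {set {set 'I_n}}}) : F \in D -> C \subset F -> C \in D.
Proof.
move=> /chainP[H1 H2] /subsetP s; apply/chainP; split=> [P /s|P Q /s PF /s]; first exact: H1.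
exact: H2.
Qed.

Section Facet.
Variables C F : {set {set {set 'I_n}}}.
Hypotheses (FD : F \in D) (Fn : #|F| = n.-2) (CF : C \subset F).

Let CD : C \in D := sub_chain FD CF.
Let b := (chain_code F).2.
Let phi j := #|[set P in C | rank F P <= j]|.

Let bU : uniq b. Proof. by rewrite (perm_uniq (facet_code FD Fn)) iota_uniq. Qed.

Let distE x y : dist C x y = phi (dist F x y). Proof. exact: dist_subchain. Qed.

Let phiM : {homo phi : i j / i <= j}.
Proof.
move=> i j ij; apply/subset_leq_card/subsetP=> P; rewrite !inE => /andP[-> r].
exact: leq_trans ij.
Qed.

Let phiS P : P \in C -> phi (rank F P).-1 < phi (rank F P).
Proof.
move=> PC; have PF := subsetP CF _ PC; have r0 := rank_gt0 n2 FD PF.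
apply: proper_card; apply/properP; split.
  by apply/subsetP=> Q; rewrite !inE => /andP[-> r] /=; apply: leq_trans r (leq_pred _).
by exists P; rewrite inE PC //= -ltnNge prednK.
Qed.

(** Between the two values of a descent of [b] some [j] stands before [j.-1]. The member of [F] of
    rank [j] then belongs to [min_face F], hence to [C], and keeps these values apart under [phi];
    so [phi] is compatible. *)
Lemma min_face_code : min_face F \subset C ->
  (chain_code C).1 = (chain_code F).1 /\ same_pattern b (chain_code C).2.
Proof.
move/subsetP=> s; have cp : compatible phi b.
  move=> p q /andP[pq qs] lt; have ps := ltn_trans pq qs.
  have [|j /andP[uj jw] fj] := descent (f := fun v => index v b) lt.
    by rewrite !(index_uniq _ _ bU).
  have jF : j <= #|F|.
    by apply: leq_trans jw _; rewrite -chain_code_mem // mem_nth.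
  have [P PF Pj] : exists2 P, P \in F & rank F P = j.
    have jm : j.-1 < #|F| by rewrite prednK // (leq_ltn_trans _ uj).
    have PF : blocks (dist F) j.-1 setT \in F.
      rewrite {2}(chain_level_chain n2 FD); apply/imsetP; by exists (Ordinal jm).
    exists (blocks (dist F) j.-1 setT) => //.
    have := chain_block n2 FD PF; set r := rank F _ => e.
    have r0 : 0 < r by apply: rank_gt0.
    have rm : r.-1 < #|F| by rewrite prednK // rank_le.
    have := @blocks_inj n (dist F) #|F| (dist_ultrametric n2 FD) (chain_height n2 FD) (Ordinal jm) (Ordinal rm) e.
    by move/(congr1 val) => /= e'; rewrite -(prednK r0) -e' prednK // (leq_ltn_trans _ uj).
  have PC : P \in C by apply: s; rewrite inE PF Pj.
  have := phiS PC; rewrite Pj => lt'.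
  apply: leq_ltn_trans (leq_trans lt' _); apply: phiM => //.
  by rewrite -ltnS (ltn_predK uj).
have dF := dist_ultrametric n2 FD.
have CE : chain_code C = ((chain_code F).1, map phi b).
  rewrite -(code_relabel chain_good dF phiM cp).
  apply: (code_iso chain_good); first exact: dist_ultrametric.
    exact: ultrametric_relabel.
  by exists id; split=> //; exact: imset_id.
rewrite CE; split=> // p q; rewrite size_map => /andP[pq qs]; have ps := ltn_trans pq qs.
rewrite !(nth_map 0) //; apply/idP/idP => [/ltnW/phiM//|].
apply: contraTT; rewrite -leqNgt -ltnNge leq_eqVlt nth_uniq // gtn_eqF //=.
by apply: cp; rewrite pq.
Qed.

(** If [j] stands before [j.-1] in [b], the common pattern forces [psi] to separate them, so some
    member of [C] has rank exactly [j] in [F]. *)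
Lemma code_min_face psi : (forall x y, x != y -> psi (dist F x y) = dist C x y) ->
  map psi b = (chain_code C).2 -> same_pattern b (chain_code C).2 -> min_face F \subset C.
Proof.
move=> psiE mE pat; apply/subsetP=> P; rewrite inE => /andP[PF].
rewrite -/b; set j := rank F P => lt.
have j0 : 0 < j by apply: rank_gt0.
have jb : j \in b by rewrite chain_code_mem // rank_le.
have jb' : j.-1 \in b by rewrite chain_code_mem // (leq_trans (leq_pred _)) // rank_le.
have psi_phi v : v <= #|F| -> psi v = phi v.
  rewrite -(chain_height n2 FD) => /levelP[x [y [_ _ xy <-]]].
  by rewrite psiE // distE.
have := @pat (index j b) (index j.-1 b).
rewrite -mE size_map lt index_mem jb' => /(_ isT).
rewrite !(nth_map 0) ?index_mem // !nth_index // ltnNge leq_pred /=.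
rewrite !psi_phi ?(leq_trans (leq_pred _)) ?rank_le // => /esym/negbT; rewrite -ltnNge => lt'.
have [Q] : exists Q, Q \in [set Q in C | rank F Q <= j] :\: [set Q in C | rank F Q <= j.-1].
  apply/set0Pn; rewrite -subset0 subDset setU0; apply: contraTN lt' => /subset_leq_card.
  by rewrite -leqNgt.
rewrite !inE => /andP[nQ /andP[QC rj]]; move: nQ; rewrite QC /= -ltnNge prednK // => jr.
have e : rank F Q = rank F P by apply/eqP; rewrite eqn_leq rj jr.
by rewrite -(rank_inj n2 FD (subsetP CF _ QC) PF e).
Qed.

End Facet.

(** The two partitions are comparable and join equally many pairs. This allows inclusions between
    orbits to be checked inside one facet. *)
Lemma chain_act_fix C P s : C \in D -> P \in C -> to P s \in C -> to P s = P.
Proof.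
move=> CD PC sC; have PP := chain_partition n2 CD PC; have PQ := chain_partition n2 CD sC.
pose J Q := [set p : 'I_n * 'I_n | joined Q p.1 p.2].
have J_card : #|J (to P s)| = #|J P|.
  have gI : injective (fun p : 'I_n * 'I_n => (s p.1, s p.2)).
    by move=> [x y] [x' y'] /= [/perm_inj-> /perm_inj->].
  rewrite -[RHS](card_imset _ gI); apply: eq_card => -[x y]; rewrite inE /=.
  apply/idP/imsetP => [j|[[x' y']]]; last by rewrite inE /= => j [-> ->]; rewrite joined_act.
  exists (s^-1 x, s^-1 y)%g; rewrite ?inE /= ?permKV //.
  by rewrite -(joined_act P s) !permKV.
have J_eq : J (to P s) = J P.
  apply/eqP; case/chainP: CD => _ /(_ _ _ PC sC)[] /(refinesP _ _) H.
    rewrite eq_sym eqEcard J_card leqnn andbT; apply/subsetP=> p; rewrite !inE; exact: H.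
  rewrite eqEcard J_card leqnn andbT; apply/subsetP=> p; rewrite !inE; exact: H.
apply: joined_inj => // x y; have := in_set (fun p : 'I_n * 'I_n => joined P p.1 p.2) (x, y).
by rewrite -/(J P) -J_eq inE.
Qed.

Lemma facetP_card C : maxset [in D] C = (C \in D) && (#|C| == n.-2).
Proof.
apply/maxsetP/andP => [[CD M]|[CD /eqP Cn]].
  split=> //; have [F [phi [FD Fn CF _ _]]] := chain_extension CD.
  by rewrite -(M F FD CF) Fn.
split=> // B BD CB; apply/esym/eqP; rewrite eqEcard CB Cn; exact: chain_card.
Qed.

(** An arbitrary chain of the orbit; the default [set0] is reached only for empty [H], which no
    orbit is. *)
Definition representative (H : {set {set {set {set 'I_n}}}}) := odflt set0 [pick C in H].

Lemma facet_rep H : H \in facets K ->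
  [/\ representative H \in D, #|representative H| = n.-2,
      H = orbit to^* G (representative H) & representative H \in H].
Proof.
case/imsetP=> C; rewrite inE facetP_card => /andP[CD /eqP Cn] HE.
rewrite /representative; case: pickP => [C' /= C'H|/(_ C)]; last by rewrite /= HE orbit_refl.
have HE' : H = orbit to^* G C' by rewrite HE; apply/esym/orbit_eqP; rewrite -HE.
have /orbitP[s sG e] : C' \in orbit to^* G C by rewrite -HE.
by split=> //=; rewrite -e; [apply: act_chain | rewrite card_act].
Qed.

Definition facet_min (H : {set {set {set {set 'I_n}}}}) :=
  orbit to^* G (min_face (representative H)).

Lemma quotient_partitionable : partitionable K.
Proof.
have face_leP (H H' : {set {set {set {set 'I_n}}}}) : reflect (exists C C', [/\ C \in H, C' \in H' & C \subset C']) (face_le K H H').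
  apply: (iffP exists_inP) => [[C CH /exists_inP[C' CH' s]]|[C [C' [CH CH' s]]]].
    by exists C, C'.
  by exists C => //; apply/exists_inP; exists C'.
(* Each of the two order relations between orbits has its own witness. Elements of [G] move the
   upper one into [R] and the lower one onto [min_face R]. A further element relates the two chains
   of [H]; it sends the members of [min_face R] to members of [R], so by [chain_act_fix] it fixes
   them and one chain serves for both relations. *)
have itvP (H F : {set {set {set {set 'I_n}}}}) : F \in facets K -> H \in faces K ->
    reflect (exists C, [/\ C \in H, min_face (representative F) \subset C
                         & C \subset representative F])
            (face_le K (facet_min F) H && face_le K H F).
  move=> FK HK; have [RD Rn FE RF] := facet_rep FK; set R := representative F in RD Rn FE RF *.
  apply: (iffP andP) => [[/face_leP[M [C1 [MF C1H MC]]] /face_leP[C2 [F' [C2H F'F C2F]]]]|].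
    case/imsetP: HK => C0 C0D HE.
    have actS (X Y : {set {set {set 'I_n}}}) s : X \subset Y -> (to^* X s)%act \subset (to^* Y s)%act by apply: imsetS.
    have [t1 t1G Mt] : exists2 t, t \in G & (to^* M t)%act = min_face R.
      by apply/orbitP; rewrite orbit_sym.
    have [t2 t2G Ft] : exists2 t, t \in G & (to^* F' t)%act = R.
      by apply/orbitP; rewrite orbit_sym -FE.
    have C1H' : (to^* C1 t1)%act \in H by move: C1H; rewrite HE orbit_actr.
    have C2H' : (to^* C2 t2)%act \in H by move: C2H; rewrite HE orbit_actr.
    exists (to^* C2 t2)%act; split=> //; last by rewrite -Ft actS.
    have [s sG es] : exists2 s, s \in G & (to^* (to^* C1 t1) s)%act = (to^* C2 t2)%act.
      apply/orbitP; move: C1H' C2H'; rewrite HE => /orbit_eqP e /orbit_eqP e'.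
      by apply/orbit_eqP; rewrite e e'.
    have sub : (to^* (min_face R) s)%act \subset (to^* C2 t2)%act.
      by rewrite -es -Mt; apply/actS/actS.
    have subR : (to^* C2 t2)%act \subset R by rewrite -Ft actS.
    apply/subsetP=> P PM; have PR := subsetP (min_face_sub R) _ PM.
    have sP : to P s \in (to^* (min_face R) s)%act by apply: imset_f.
    have sPC := subsetP sub _ sP; have sPR := subsetP subR _ sPC.
    by rewrite -(chain_act_fix RD PR sPR).
  case=> C [CH MC CR]; split; apply/face_leP.
    by exists (min_face R), C; rewrite orbit_refl.
  by exists C, R.
exists facet_min; split.
- move=> F FK; have [RD Rn FE RF] := facet_rep FK; split.
    by apply: imset_f; apply: sub_chain RD (min_face_sub _).
  apply/face_leP; exists (min_face (representative F)), (representative F).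
  by rewrite orbit_refl RF min_face_sub.
- apply/setP=> H; apply/bigcupP/idP => [[F _]|HK]; first by rewrite inE => /andP[].
  case/imsetP: (HK) => C CD HE.
  (* The covering facet is the one with the standardised word, moved onto the representative of its
     orbit. *)
  have [F [phi [FD Fn CF phiE [mE pat _]]]] := chain_extension CD.
  have FK : orbit to^* G F \in facets K by apply: imset_f; rewrite inE facetP_card FD Fn /=.
  exists (orbit to^* G F) => //; rewrite inE HK; apply/itvP => //.
  have [RD Rn RE RF] := facet_rep FK; set R := representative _ in RD Rn RE RF *.
  have [s sG sE] : exists2 s, s \in G & (to^* F s)%act = R.
    exact/orbitP.
  have subR : (to^* C s)%act \subset R by rewrite -sE; apply: imsetS.
  exists (to^* C s)%act; split=> //; first by rewrite HE mem_orbit.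
  apply: (code_min_face RD subR (psi := phi)).
  + move=> x y xy; rewrite -sE -[x](permKV s) -[y](permKV s) !dist_act.
    by apply: phiE; rewrite (inj_eq perm_inj).
  + by rewrite -sE !chain_code_act.
  + by rewrite -sE !chain_code_act.
- move=> F1 F2 FK1 FK2; apply: contraNT; rewrite -setI_eq0 => /set0Pn[H].
  rewrite !inE => /andP[/andP[HK /(itvP _ _ FK1 HK)[C1 [C1H M1 S1]]]].
  case/andP=> _ /(itvP _ _ FK2 HK)[C2 [C2H M2 S2]].
  have [RD1 Rn1 FE1 _] := facet_rep FK1; have [RD2 Rn2 FE2 _] := facet_rep FK2.
  have [t1 p1] := min_face_code RD1 Rn1 S1 M1; have [t2 p2] := min_face_code RD2 Rn2 S2 M2.
  have e : chain_code C1 = chain_code C2.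
    case/imsetP: HK C1H C2H => C CD -> /orbitP[s1 s1G <-] /orbitP[s2 s2G <-].
    by rewrite !chain_code_act.
  (* Both words are permutations with the pattern of the same chain code, and the tags agree, so
     completeness of the code makes the two facets conjugate under [G]. *)
  have [s sG sE] : exists2 s, s \in G & representative F2 = (to^* (representative F1) s)%act.
    apply: chain_code_complete => //; first by rewrite Rn1.
    rewrite [LHS]surjective_pairing [RHS]surjective_pairing -t1 -t2 e; congr pair.
    apply: (@pattern_unique _ _ (chain_code C2).2 n.-1); rewrite ?facet_code //.
      by rewrite chain_code_size // (sub_chain RD2).
    by rewrite -e.
  by rewrite FE1 FE2 sE; apply/eqP/esym/orbit_eqP/mem_orbit.
Qed.

End Quotient.

(** * At most one point: the empty chain is the only face *)

Lemma order_complex_small n : n <= 1 -> order_complex_Pi n = [set set0].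
Proof.
move=> n1; have eqT (x y : 'I_n) : x = y.
  apply: val_inj; move: (leq_trans (ltn_ord x) n1) (leq_trans (ltn_ord y) n1).
  by rewrite !ltnS !leqn0 /= => /eqP-> /eqP->.
suff none (P : {set {set 'I_n}}) : P \notin Pi_proper n.
  apply/setP=> C; rewrite !inE; apply/andP/eqP => [[/subsetP s _]|->].
    by apply/setP=> P; rewrite inE; apply/negbTE/negP=> /s; apply/negP.
  by split; [exact: sub0set | apply/forall_inP=> P; rewrite inE].
rewrite inE /srefines; apply/and3P=> -[PP /andP[nb _] /andP[nt _]].
have : P \subset Pi_top n.
  apply/subsetP=> B BP; rewrite inE; apply/eqP/setP=> x.
  have /set0Pn[y yB] : B != set0 by apply: contraTneq BP => ->; case/and3P: PP.
  by rewrite inE (eqT x y).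
rewrite subset1 (negPf nt) => /eqP P0; case/negP: nb; apply/eqP.
rewrite P0; apply/eqP; rewrite -subset0; apply/subsetP=> B /imsetP[x _ _].
by have := cover_partition PP => /setP/(_ x); rewrite P0 /cover big_set0 !inE.
Qed.

Lemma point_partitionable (aT : finGroupType) (V : finType) (to : {action aT &-> V})
    (G : {group aT}) : partitionable (quotient_complex to [set set0] G).
Proof.
set K := quotient_complex _ _ _; pose O := orbit to^* G set0.
have facesE : faces K = [set O] by rewrite /= imset_set1.
have facetsE : facets K = [set O].
  rewrite /= (_ : [set C | _] = [set set0]) ?imset_set1 //; apply/setP=> C; rewrite !inE.
  apply/maxsetP/eqP => [[] | ->]; rewrite !inE; first by move/eqP.
  by split=> // B; rewrite inE => /eqP.
have leO : face_le K O O.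
  by apply/exists_inP; exists set0; rewrite ?orbit_refl //; apply/exists_inP; exists set0; rewrite ?orbit_refl.
exists id; rewrite facetsE facesE; split.
- by move=> _ /set1P->; rewrite set11 leO.
- rewrite big_set1; apply/setP=> H; rewrite !inE.
  by case: eqP => [->|//]; rewrite leO.
- by move=> _ _ /set1P-> /set1P->; rewrite eqxx.
Qed.

Theorem theorem4p4 (n : nat) (lam : seq nat) (hlam : is_composition n lam) :
  partitionable
    (quotient_complex (Pi_action n) (order_complex_Pi n) (young n lam)).
Proof.
case: (leqP n 1) => n2; last exact: (quotient_partitionable n2 (youngP hlam)).
by rewrite order_complex_small //; apply: point_partitionable.
Qed.
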